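(* If $X\subseteq\mathbb{R}^d$ is a non-empty set, then \[ \dim_{\mathrm F}^{\theta}X\leq \dim_{\mathrm F}X+d\left(1+\frac{\dim_{\mathrm F}X}{2}\right)\theta \] for all $\theta\in[0,1]$. In particular, $\theta\mapsto\dim_{\mathrm F}^{\theta}X$ is Lipschitz continuous on the whole range $[0,1]$, with $\dim_{\mathrm F}^{0}X=\dim_{\mathrm F}X$ and, if $X$ is Borel, $\dim_{\mathrm F}^{1}X=\dim_{\mathrm H}X$.
   Context: For a finite Borel measure $\mu$ on $\mathbb{R}^d$ write $\widehat\mu(z)=\int e^{-2\pi i z\cdot x}\,d\mu(x)$. For $s\geq 0$ and $\theta\in(0,1]$ let $\mathcal{J}_{s,\theta}(\mu)=\left(\int_{\mathbb{R}^d}|\widehat\mu(z)|^{2/\theta}|z|^{s/\theta-d}\,dz\right)^{\theta}$, and let $\mathcal{J}_{s,0}(\mu)=\sup_{z\in\mathbb{R}^d}|\widehat\mu(z)|^2|z|^s$. The Fourier spectrum of $\mu$ at $\theta\in[0,1]$ is $\dim_{\mathrm F}^{\theta}\mu=\sup\{s\geq 0:\mathcal{J}_{s,\theta}(\mu)<\infty\}\in[0,\infty]$, with $\sup\emptyset=0$. For non-empty $X\subseteq\mathbb{R}^d$, $\dim_{\mathrm F}^{\theta}X=\sup\{\min\{\dim_{\mathrm F}^{\theta}\mu,d\}:\operatorname{spt}(\mu)\subseteq X\}$, where the supremum is over non-zero finite Borel measures $\mu$ on $\mathbb{R}^d$ whose (closed) support is contained in $X$. The Fourier dimension of a measure is $\dim_{\mathrm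 F}\mu=\sup\{s\geq 0: \text{there is } c>0 \text{ with } |\widehat\mu(z)|\leq c|z|^{-s/2}\text{ for all } z\neq 0\}$ and that of a non-empty set is $\dim_{\mathrm F}X=\sup\{\min\{\dim_{\mathrm F}\mu,d\}:\operatorname{spt}(\mu)\subseteq X\}$ (same class of measures). $\dim_{\mathrm H}$ denotes Hausdorff dimension. *)

(* Defs.v *)
From HB Require Import structures.
From mathcomp Require Import all_boot all_order all_algebra.
From mathcomp Require Import complex.
From mathcomp Require Import all_classical all_reals all_analysis.
From mathcomp Require Import measurable_realfun.

Set Implicit Arguments.
Unset Strict Implicit.
Unset Printing Implicit Defensive.

Import Order.TTheory GRing.Theory Num.Theory.
Import numFieldNormedType.Exports.

Local Open Scope classical_set_scope.
Local Open Scope ring_scope.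

(* 'rV[R]_d with its Borel sigma-algebra.  As a type it is convertible to
   'rV[R]_d, so that sets and vectors can be used on either side. *)
Definition borelRV (R : realType) (d : nat) :=
  g_sigma_algebraType (@open 'rV[R]_d).

Definition dotv (R : realType) (d : nat) (x y : 'rV[R]_d) : R :=
  \sum_(i < d) x ord0 i * y ord0 i.

(* The Euclidean norm; the library's norm `|x| on 'rV[R]_d is the sup norm. *)
Definition enorm (R : realType) (d : nat) (x : 'rV[R]_d) : R :=
  Num.sqrt (dotv x x).

Section lebesgue.
Variable R : realType.

Definition consv (d : nat) (p : measurableTypeR R * borelRV R d) :
    borelRV R d.+1 :=
  \row_(j < d.+1) oapp ((p.2 : 'rV[R]_d) ord0) p.1 (unlift ord0 j).

Lemma consv0 d (p : measurableTypeR R * borelRV R d) :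
  (consv p : 'rV[R]_d.+1) ord0 ord0 = p.1.
Proof. by rewrite mxE unlift_none. Qed.

Lemma consvS d (p : measurableTypeR R * borelRV R d) (j : 'I_d) :
  (consv p : 'rV[R]_d.+1) ord0 (lift ord0 j) = (p.2 : 'rV[R]_d) ord0 j.
Proof. by rewrite mxE liftK. Qed.

Lemma ball_rVP d (a b : 'rV[R]_d) (e : R) :
  ball a e b <-> 0 < e /\ forall j, ball (a ord0 j) e (b ord0 j).
Proof.
split.
  by rewrite /ball/=; case=> e0 h; split=> // j; exact: h.
case=> e0 h; split=> // i j; rewrite (ord1 i); exact: h.
Qed.

Lemma measurable_consv d : measurable_fun [set: _] (@consv d).
Proof.
apply: (@measurability _ _ _ (borelRV R d.+1) setT (@consv d)
  (@open 'rV[R]_d.+1) erefl).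
move=> _ [U oU <-]; rewrite setTI.
pose c (k : 'rV[rat]_d.+1 * nat) : 'rV[R]_d.+1 := map_mx ratr k.1.
pose B k : set 'rV[R]_d.+1 := ball (c k) k.2.+1%:R^-1.
pose D := [set k | B k `<=` U].
have -> : @consv d @^-1` U = \bigcup_(k in D) (@consv d @^-1` B k).
  apply/seteqP; split; last by move=> p [k Dk Bk]; exact: (Dk _ Bk).
  move=> p Up.
  have : nbhs (consv p : 'rV[R]_d.+1) U by exact: open_nbhs_nbhs.
  rewrite -nbhs_ballE => -[e /= e0 eU].
  have [n ne] : exists n : nat, n.+1%:R^-1 + n.+1%:R^-1 < e.
    have e20 : 0 < e / 2 by rewrite divr_gt0.
    have := near_infty_natSinv_lt (PosNum e20).
    case=> n _ /(_ n (leqnn n))/= h; exists n.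
    by rewrite (splitr e) ltrD.
  have n0 : 0 < n.+1%:R^-1 :> R by rewrite invr_gt0.
  have hq j : exists q : rat, ball (ratr q : R) n.+1%:R^-1 ((consv p : 'rV[R]_d.+1) ord0 j).
    move: ((consv p : 'rV[R]_d.+1) ord0 j) => x.
    have /rat_in_itvoo[q] : x - n.+1%:R^-1 < x + n.+1%:R^-1.
      by rewrite ltrD2l gtrN.
    rewrite in_itv/= => /andP[h1 h2]; exists q.
    by rewrite /ball/= ltr_distl h1.
  have [q qP] := choice hq.
  have Bp : B (\row_j q j, n) (consv p).
    apply/ball_rVP; split=> [//|j].
    have cE : c (\row_j q j, n) ord0 j = ratr (q j) by rewrite /c/= !mxE.
    by rewrite cE; exact: qP.
  exists (\row_j q j, n) => //= y By; apply: eU.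
  apply: (@le_ball _ _ _ (n.+1%:R^-1 + n.+1%:R^-1)).
    exact: ltW.
  exact: ball_triangle (ball_sym Bp) By.
rewrite bigcup_mkcond.
apply: countable_bigcupT_measurable; first exact: countableP.
move=> k; case: ifPn => // _.
have -> : @consv d @^-1` B k =
    (ball (c k ord0 ord0) k.2.+1%:R^-1 : set (measurableTypeR R)) `*`
    (ball (\row_j c k ord0 (lift ord0 j)) k.2.+1%:R^-1 : set (borelRV R d)).
  apply/seteqP; split=> [p /ball_rVP[e0 h]|p [/= h0 /ball_rVP[e0 h]]].
    split; first by have := h ord0; rewrite consv0.
    apply/ball_rVP; split=> // j.
    by have := h (lift ord0 j); rewrite consvS mxE.
  apply/ball_rVP; split=> // j.
  have [i ->|->] := unliftP ord0 j; last by rewrite consv0.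
  by have := h i; rewrite consvS mxE.
apply: measurableX.
  by apply: open_measurable; exact: ball_open.
by apply: sub_sigma_algebra; exact: ball_open.
Qed.

Section consv_measure.
Variables (d : nat) (mu : {measure set (borelRV R d) -> \bar R}).

Definition consv_measure : set (borelRV R d.+1) -> \bar R :=
  pushforward (lebesgue_measure \x^ mu)%E (@consv d).

Let consv_measure0 : consv_measure set0 = 0%E.
Proof. by rewrite /consv_measure /pushforward preimage_set0 measure0. Qed.

Let consv_measure_ge0 A : (0 <= consv_measure A)%E.
Proof. by rewrite /consv_measure /pushforward; exact: measure_ge0. Qed.

Let consv_measure_sigma_additive : semi_sigma_additive consv_measure.
Proof.
apply: (@measure_semi_sigma_additive _ _ _ (pushforward _ _)).
exact: measurable_consv.
Qed.

HB.instance Definition _ := isMeasure.Build _ _ _ consv_measure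
  consv_measure0 consv_measure_ge0 consv_measure_sigma_additive.

End consv_measure.

(* Lebesgue measure on R^d: the image of the product of the Lebesgue measures
   on R and R^(d-1) under (x, v) |-> (x, v_1, ..., v_(d-1)); on R^0 it is the
   unit mass at the only point. *)
Fixpoint lebesgueRV (d : nat) : {measure set (borelRV R d) -> \bar R} :=
  match d with
  | 0 => (@dirac _ (borelRV R 0) (0 : 'rV[R]_0) R)
  | d'.+1 => consv_measure (lebesgueRV d')
  end.

End lebesgue.

Section fourier_spectrum.
Variables (R : realType) (d : nat).
Implicit Types (mu : {finite_measure set (borelRV R d) -> \bar R}).
Implicit Types (X : set 'rV[R]_d) (theta s : R).

(* \int e^{-2 pi i z.x} dmu(x), split into real and imaginary parts. *)
Definition fourier mu (z : 'rV[R]_d) : R[i] :=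
  ((\int[mu]_x cos (2 * pi * dotv z x)) -i*
   (\int[mu]_x sin (2 * pi * dotv z x)))%C.

Definition fourier_energy mu s theta : \bar R :=
  if theta == 0 then
    ereal_sup
      [set (Normc.normc (fourier mu z) ^+ 2 * enorm z `^ s)%:E | z in setT]
  else
    ((\int[lebesgueRV R d]_z
       (Normc.normc (fourier mu z) `^ (2 / theta) *
        enorm z `^ (s / theta - d%:R))%:E) `^ theta)%E.

(* Adding 0 to the set implements the convention that its supremum is 0 when
   it is empty. *)
Definition fourier_spectrum mu theta : \bar R :=
  ereal_sup (0%E |`
    [set s%:E | s in [set s | 0 <= s /\ (fourier_energy mu s theta < +oo)%E]]).

Definition fourier_dim mu : \bar R :=
  ereal_sup [set s%:E | s in [set s | 0 <= s /\
    exists2 c : R, 0 < c &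
      forall z : 'rV[R]_d, z != 0 ->
        Normc.normc (fourier mu z) <= c * enorm z `^ (- s / 2)]].

Definition msupport mu : set 'rV[R]_d :=
  [set x | forall U : set 'rV[R]_d, open U -> U x -> (0 < mu U)%E].

Definition carried X : set {finite_measure set (borelRV R d) -> \bar R} :=
  [set mu : {finite_measure set (borelRV R d) -> \bar R} |
    (0 < mu setT)%E /\ msupport mu `<=` X].

Definition set_fourier_spectrum X theta : \bar R :=
  ereal_sup [set mine (fourier_spectrum mu theta) d%:R%:E | mu in carried X].

Definition set_fourier_dim X : \bar R :=
  ereal_sup [set mine (fourier_dim mu) d%:R%:E | mu in carried X].

Lemma fourier_spectrum_ge0 mu theta : (0 <= fourier_spectrum mu theta)%E.
Proof. by apply: ereal_sup_ubound; left. Qed.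

Lemma carried_dirac X (x : 'rV[R]_d) :
  X x -> carried X (@dirac _ (borelRV R d) x R).
Proof.
move=> Xx; split; first by rewrite /= diracT lte01.
move=> y yx; suff -> : y = x by [].
apply: contrapT => ynx.
have /yx : open (~` [set x]).
  by apply: closed_openC; apply: accessible_closed_set1;
    apply: hausdorff_accessible; exact: norm_hausdorff.
by move=> /(_ ynx); rewrite /= diracE memNset ?ltxx//=; apply.
Qed.

(* As X is non-empty, its Fourier spectrum takes values in [0, d]. *)
Lemma set_fourier_spectrum_fin_num X theta :
  X !=set0 -> set_fourier_spectrum X theta \is a fin_num.
Proof.
case=> x Xx; rewrite ge0_fin_numE.
  apply: (@le_lt_trans _ _ d%:R%:E); last exact: ltry.
  by apply: ge_ereal_sup => _ [mu _ <-]; rewrite ge_min lexx orbT.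
apply: le_trans (ereal_sup_ubound _); last first.
  by exists (@dirac _ (borelRV R d) x R) => //; exact: carried_dirac.
by rewrite le_min fourier_spectrum_ge0/= lee_fin ler0n.
Qed.

End fourier_spectrum.

Section hausdorff.
Variables (R : realType) (d : nat).
Implicit Types (X U : set 'rV[R]_d) (s delta : R).

Definition ediam U : \bar R :=
  ereal_sup [set (enorm (p.1 - p.2))%:E | p in U `*` U].

(* |U|^s, with |set0|^s = 0 also for s = 0. *)
Definition ediam_pow s U : \bar R :=
  if U == set0 then 0%E else (ediam U `^ s)%E.

Definition hausdorff_content s delta X : \bar R :=
  ereal_inf [set (\sum_(0 <= n <oo) ediam_pow s (U n))%E | U in
    [set U : nat -> set 'rV[R]_d |
      (forall n, (ediam (U n) <= delta%:E)%E) /\ X `<=` \bigcup_n U n]].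

Definition hausdorff_measure s X : \bar R :=
  ereal_sup [set hausdorff_content s delta X | delta in [set e | 0 < e]].

Definition hausdorff_dim X : \bar R :=
  ereal_inf [set s%:E | s in
    [set s | 0 <= s /\ hausdorff_measure s X = 0%E]].

End hausdorff.

(* Main.v *)
From HB Require Import structures.
Require Import Defs.
From mathcomp Require Import all_boot all_order all_algebra.
From mathcomp Require Import complex.
From mathcomp Require Import all_classical all_reals all_analysis.
From mathcomp Require Import measurable_realfun.
From mathcomp Require Import ring lra zify.

Set Implicit Arguments.
Unset Strict Implicit.
Unset Printing Implicit Defensive.

Import Order.TTheory GRing.Theory Num.Theory.
Import numFieldNormedType.Exports.

Local Open Scope classical_set_scope.
Local Open Scope ring_scope.

(** A nonnegative multiplier keeps the support inside X, and the Fejer kernel is nonnegative with an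
    explicit compactly supported transform. Its averaging cubes have bounded size, so |z| is
    essentially constant on them and the averaging itself costs no power of |z|. The loss has
    another origin: a pointwise bound on |nu^|^(2/theta') |z|^(t/theta' - d) gives decay of exponent
    t - d theta', and interpolating it with integrability wins d theta back. Complex exponentials
    are replaced by 1 + cos with a free phase, so that each interchange of integrals is Tonelli for
    nonnegative functions. At theta = 1 the role of the Riesz kernel is played by one identity
    between triangles in frequency and Fejer kernels in space, applied at every scale. Admissible
    measures have their closed support inside X, so for Borel X a measure that merely charges X does
    not do. This is why the tree bounds one more coordinate of the witness at each generation, with
    total loss at most 1/2: Konig's lemma then places each point of the support in X. Net contents
    are used because they are finite and satisfy an increasing sets lemma. *)

(* If J_{t,theta'}(mu) is finite and theta < theta', multiply mu by a product of Fejer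
   kernels: the transform of the new measure at z is bounded by the average of the
   transform of mu over a cube around z.  Jensen's inequality turns this into a pointwise
   decay of order |z|^((d theta' - t) / 2) together with integrability, whence
   J_{s,theta} is finite for s < t - d (theta' - theta).  So the spectrum grows by at most
   d (theta' - theta), which is stronger than the stated bound.  It is nondecreasing: the
   integrand is A^(1/theta) |z|^(-d) with A = |mu^(z)|^2 |z|^s, which decreases in theta
   where A >= 1, and where A <= 1 lowering s by any epsilon makes it integrable at infinity.

   For theta = 1, finiteness of J_{s,1} is finiteness of the s-energy.  It bounds
   mu(B(x, r)) by r^t, t < s, on a set of positive measure, and the mass distribution
   principle gives dim_H.  Conversely, if a Borel set X has dim_H X > s, some unit cube
   carries positive s-dimensional net content of X.  X is the projection of a closed
   subset of R^d x N^N, and the increasing sets lemma for net contents bounds the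
   coordinates in N^N one after the other, losing little content, so that a Frostman
   measure on a binary tree has its support in X; its cubes satisfy the growth bound that
   makes the energies of order t < s finite. *)

(** * Lebesgue measure on R^d *)

Section lebRV.
Variable R : realType.
Local Notation leb := (@lebesgue_measure R).

Lemma measurable_coord d (i : 'I_d) :
  measurable_fun setT (fun x : borelRV R d => (x : 'rV[R]_d) ord0 i).
Proof.
move=> mD; apply: (measurability _ (RGenOpens.measurableE R)) => //.
move=> _ [_ [a [b ->] <-]]; rewrite setTI; apply: sub_sigma_algebra => /=.
apply: open_comp; last exact: interval_open.
by move=> x _; exact: coord_continuous.
Qed.

Lemma measurable_dotv d dT (T : measurableType dT) (w : 'rV[R]_d)
    (h : T -> 'rV[R]_d) :
  (forall i, measurable_fun setT (fun t => h t ord0 i)) ->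
  measurable_fun setT (fun t => dotv w (h t)).
Proof.
move=> mh; rewrite /dotv; apply: measurable_sum => i.
by apply: measurable_funM => //; exact: measurable_cst.
Qed.

Lemma measurable_cos : measurable_fun setT (@cos R).
Proof. by apply: continuous_measurable_fun; exact: continuous_cos. Qed.

Lemma measurable_sin : measurable_fun setT (@sin R).
Proof. by apply: continuous_measurable_fun; exact: continuous_sin. Qed.

(** The recursive [lebesgueRV] under a name of its own, to which the measure and sigma-finite
    structures can be attached for inference. *)
Definition lebRV d : set (borelRV R d) -> \bar R := lebesgueRV R d.

HB.instance Definition _ d := Measure.on (@lebRV d).

Definition cube d (c : 'rV[R]_d) (r : R) : set (borelRV R d) :=
  [set x | forall i, `|(x : 'rV[R]_d) ord0 i - c ord0 i| <= r].

Lemma measurable_cube d (c : 'rV[R]_d) r : measurable (cube c r).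
Proof.
have -> : cube c r = \bigcap_(i in [set: 'I_d])
    ((fun x : borelRV R d => (x : 'rV[R]_d) ord0 i) @^-1` `[c ord0 i - r, c ord0 i + r]).
  apply/seteqP; split=> [x h i _|x h i]/=.
    by rewrite in_itv/= -ler_distl.
  by have := h i I; rewrite /= in_itv/= -ler_distl.
apply: fin_bigcap_measurable => // i _.
rewrite -[X in measurable X]setTI.
by apply: measurable_coord => //; exact: measurable_itv.
Qed.

Lemma lebRV_cube d (c : 'rV[R]_d) r : 0 <= r ->
  lebRV (cube c r) = ((2 * r) ^+ d)%:E.
Proof.
rewrite /lebRV; elim: d c => [|d IH] c r0.
  by rewrite /= expr0 diracE mem_set// => i; case: i.
have E : @consv R d @^-1` (cube c r) =
    (`[c ord0 ord0 - r, c ord0 ord0 + r]%classic : set (measurableTypeR R)) `*`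
    (cube (\row_j c ord0 (lift ord0 j)) r : set (borelRV R d)).
  apply/seteqP; split=> [p /= h|p [/= h0 h] i].
    split.
      by have := h ord0; rewrite consv0/= in_itv/= -ler_distl.
    by move=> j; have := h (lift ord0 j); rewrite consvS mxE.
  have [j ->|->] := unliftP ord0 i.
    by have := h j; rewrite consvS mxE.
  by rewrite consv0; move: h0; rewrite in_itv/= -ler_distl.
transitivity ((leb \x^ lebesgueRV R d) (@consv R d @^-1` cube c r))%E; first by [].
rewrite E product_measure2E//; last exact: measurable_cube.
rewrite IH//.
transitivity ((2 * r)%:E * ((2 * r) ^+ d)%:E)%E; last by rewrite -EFinM exprS.
congr (_ * _)%E; rewrite [LHS]lebesgue_measure_itv/= lte_fin.
case: ltP => [_|h].
  by rewrite -EFinB; congr (_%:E); ring.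
by have -> : r = 0; [lra|rewrite mulr0].
Qed.

Lemma lebRV_sigma_finite d : sigma_finite setT (@lebRV d).
Proof.
exists (fun n => cube (0 : 'rV[R]_d) n%:R).
  apply/esym; rewrite -subTset => x _.
  pose N := Num.truncn (`|x : 'rV[R]_d|).
  exists N.+1 => // i; rewrite mxE subr0.
  apply: le_trans (ltW (truncnS_gt _)).
  by rewrite [leRHS]mx_normrE; apply: (le_bigmax _ (fun k : 'I_1 * 'I_d => `|(x : 'rV[R]_d) k.1 k.2|) (ord0, i)).
move=> n; split; first exact: measurable_cube.
by rewrite lebRV_cube// ltry.
Qed.

HB.instance Definition _ d := Measure_isSigmaFinite.Build _ _ _
  (@lebRV d) (@lebRV_sigma_finite d).

Lemma ge0_integral_lebRVS d (f : borelRV R d.+1 -> \bar R) :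
  measurable_fun setT f -> (forall x, 0 <= f x)%E ->
  (\int[@lebRV d.+1]_x f x =
   \int[@lebRV d]_w \int[leb]_v f (consv (v, w)))%E.
Proof.
move=> mf f0.
transitivity (\int[(leb \x^ @lebRV d)%E]_p f (consv p))%E.
  rewrite -[RHS]/(integral _ (@consv R d @^-1` setT) (f \o @consv R d)).
  rewrite -ge0_integral_pushforward//; exact: measurable_consv.
(* [\x^] is built by integrating in the other order; uniqueness of the product measure identifies it
   with [\x], to which Tonelli applies. *)
rewrite (eq_measure_integral (leb \x @lebRV d)%E); last first.
  move=> A mA _; apply/esym/product_measure_unique => // B C mB mC.
  by rewrite /= product_measure2E.
rewrite fubini_tonelli2//.
by apply: measurableT_comp => //; exact: measurable_consv.
Qed.

Lemma measurable_prod_coord d (f : 'I_d -> R -> R) :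
  (forall i, measurable_fun setT (f i)) ->
  measurable_fun setT
    (fun x : borelRV R d => \prod_(i < d) f i ((x : 'rV[R]_d) ord0 i)).
Proof.
move=> mf; apply: measurable_prod => i _.
by apply: measurableT_comp => //; exact: measurable_coord.
Qed.

Lemma integral_lebRV0 (f : borelRV R 0 -> \bar R) :
  (\int[@lebRV 0]_x f x = f (0%R : 'rV[R]_0))%E.
Proof.
transitivity (\int[@lebRV 0]_x (cst (f (0%R : 'rV[R]_0)) x))%E.
  by apply: eq_integral => x _ /=; congr f; apply/rowP => -[].
have := @integral_dirac _ (borelRV R 0) (0%R : 'rV[R]_0) R setT measurableT
  (cst (f (0%R : 'rV[R]_0))) (@measurable_cst _ _ _ _ setT _).
by rewrite diracE mem_set// mul1e.
Qed.

Lemma ge0_integral_lebRV_prod d (f : 'I_d -> R -> R) (m : 'I_d -> R) :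
  (forall i, measurable_fun setT (f i)) -> (forall i v, 0 <= f i v) ->
  (forall i, \int[leb]_v (f i v)%:E = (m i)%:E)%E ->
  (\int[@lebRV d]_x (\prod_(i < d) f i ((x : 'rV[R]_d) ord0 i))%:E =
   (\prod_(i < d) m i)%:E)%E.
Proof.
elim: d f m => [|d IH] f m mf f0 fm; first by rewrite integral_lebRV0 !big_ord0.
rewrite ge0_integral_lebRVS; last 2 first.
- by apply/measurable_EFinP; exact: measurable_prod_coord.
- by move=> x; rewrite lee_fin; apply: prodr_ge0.
have m0 : 0 <= m ord0.
  by rewrite -lee_fin -fm; apply: integral_ge0 => v _; rewrite lee_fin.
transitivity (\int[@lebRV d]_w ((m ord0)%:E *
    (\prod_(i < d) f (lift ord0 i) ((w : 'rV[R]_d) ord0 i))%:E))%E.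
  apply: eq_integral => w _.
  transitivity (\int[leb]_v ((\prod_(i < d) f (lift ord0 i) ((w : 'rV[R]_d) ord0 i))%:E *
      (f ord0 v)%:E))%E.
    apply: eq_integral => v _; rewrite big_ord_recl consv0/= -EFinM mulrC.
    by congr ((_ * _)%:E); apply: eq_bigr => i _; rewrite consvS.
  rewrite ge0_integralZl_EFin//; first by rewrite fm muleC.
  + by move=> v _; rewrite lee_fin.
  + by apply: measurableT_comp => //; exact: (mf ord0).
  + by apply: prodr_ge0.
rewrite ge0_integralZl_EFin//; last 2 first.
- by move=> w _; rewrite lee_fin; apply: prodr_ge0.
- by apply/measurable_EFinP; exact: (@measurable_prod_coord d (fun i => f (lift ord0 i))).
by rewrite (IH (fun i => f (lift ord0 i)) (fun i => m (lift ord0 i)))// -EFinM big_ord_recl.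
Qed.

Lemma dotv_consv d v (w : borelRV R d) (x : 'rV[R]_d.+1) :
  dotv (consv (v, w)) x =
  v * x ord0 ord0 + dotv (w : 'rV[R]_d) (\row_i x ord0 (lift ord0 i)).
Proof.
rewrite /dotv big_ord_recl consv0/=; congr (_ + _).
by apply: eq_bigr => i _; rewrite consvS mxE.
Qed.

(* [1 + cos] is used instead of [cos] so that Tonelli applies. *)
Lemma integral_lebRV_prod_cos d (f : 'I_d -> R -> R) (m k g : 'I_d -> R)
    (x : 'rV[R]_d) (b : R) :
  (forall i, measurable_fun setT (f i)) -> (forall i v, 0 <= f i v) ->
  (forall i, \int[leb]_v (f i v)%:E = (m i)%:E)%E ->
  (forall i, 0 <= k i <= m i) ->
  (forall i c, \int[leb]_v (f i v * (1 + cos (2 * pi * (v * x ord0 i) + c)))%:E =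
     (m i + k i * cos (g i + c))%:E)%E ->
  (\int[@lebRV d]_w (\prod_(i < d) f i ((w : 'rV[R]_d) ord0 i) *
      (1 + cos (2 * pi * dotv w x + b)))%:E =
   (\prod_(i < d) m i + \prod_(i < d) k i * cos (\sum_(i < d) g i + b))%:E)%E.
Proof.
have c1 (y : R) : 0 <= 1 + cos y by have := cos_geN1 y; lra.
elim: d f m k g x b => [|d IH] f m k g x b mf f0 fm km fc.
  by rewrite integral_lebRV0 !big_ord0 /dotv !big_ord0 mulr0 !mul1r.
rewrite ge0_integral_lebRVS; last 2 first.
- apply/measurable_EFinP; apply: measurable_funM; first exact: measurable_prod_coord.
  apply: measurable_funD => //.
  apply: measurableT_comp; first exact: measurable_cos.
  apply: measurable_funD => //; apply: measurable_funM => //.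
  under eq_fun do rewrite /dotv; apply: measurable_sum => i.
  by apply: measurable_funM => //; exact: measurable_coord.
- by move=> w; rewrite lee_fin mulr_ge0//; apply: prodr_ge0.
pose x' : 'rV[R]_d := \row_i x ord0 (lift ord0 i).
pose P (w : borelRV R d) := \prod_(i < d) f (lift ord0 i) ((w : 'rV[R]_d) ord0 i).
have P0 w : 0 <= P w by apply: prodr_ge0.
have mP : measurable_fun setT P by exact: (@measurable_prod_coord d (fun i => f (lift ord0 i))).
pose b' := g ord0 + b.
have /andP[k0 km0] := km ord0.
(* Integrating out the first coordinate leaves [P * (m + k cos)]. Written as
   [(m - k) P + k P (1 + cos)] it is a sum of nonnegative terms, by [k i <= m i], and the induction
   hypothesis applies with the phase [b']. *)
transitivity (\int[@lebRV d]_w ((m ord0 - k ord0)%:E * (P w)%:E +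
   (k ord0)%:E * (P w * (1 + cos (2 * pi * dotv (w : 'rV[R]_d) x' + b')))%:E))%E.
  apply: eq_integral => w _.
  transitivity (\int[leb]_v ((P w)%:E * (f ord0 v * (1 + cos (2 * pi * (v * x ord0 ord0) + (2 * pi * dotv (w : 'rV[R]_d) x' + b))))%:E))%E.
    apply: eq_integral => v _.
    rewrite big_ord_recl consv0/= dotv_consv -EFinM.
    rewrite [2 * pi * (_ + dotv _ _)]mulrDr -addrA [P w * _]mulrCA [f ord0 v * (P w * _)]mulrA.
    congr ((_ * _ * _)%:E).
    by apply: eq_bigr => i _; rewrite consvS.
  rewrite ge0_integralZl_EFin//; last 2 first.
  - by move=> v _; rewrite lee_fin mulr_ge0.
  - apply: measurableT_comp => //; apply: measurable_funM; first exact: (mf ord0).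
    apply: measurable_funD => //.
    apply: measurableT_comp; first exact: measurable_cos.
    by apply: measurable_funD => //; apply: measurable_funM => //; apply: measurable_funM.
  rewrite fc -!EFinM -EFinD; congr (_%:E).
  rewrite /b' [g ord0 + _]addrCA; ring.
rewrite ge0_integralD//; last 4 first.
- by move=> w _; rewrite -EFinM lee_fin mulr_ge0// subr_ge0.
- apply: emeasurable_funM => //; exact/measurable_EFinP.
- by move=> w _; rewrite -EFinM lee_fin !mulr_ge0.
- apply: emeasurable_funM => //; apply/measurable_EFinP; apply: measurable_funM => //.
  apply: measurable_funD => //; apply: measurableT_comp; first exact: measurable_cos.
  apply: measurable_funD => //; apply: measurable_funM => //.
  under eq_fun do rewrite /dotv; apply: measurable_sum => i.
  by apply: measurable_funM => //; exact: measurable_coord.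
rewrite ge0_integralZl_EFin ?subr_ge0//; last 2 first.
- by move=> w _; rewrite lee_fin.
- exact/measurable_EFinP.
rewrite ge0_integralZl_EFin//; last 2 first.
- by move=> w _; rewrite lee_fin mulr_ge0.
- apply/measurable_EFinP; apply: measurable_funM => //.
  apply: measurable_funD => //; apply: measurableT_comp; first exact: measurable_cos.
  apply: measurable_funD => //; apply: measurable_funM => //.
  under eq_fun do rewrite /dotv; apply: measurable_sum => i.
  by apply: measurable_funM => //; exact: measurable_coord.
rewrite (@ge0_integral_lebRV_prod _ (fun i => f (lift ord0 i)) (fun i => m (lift ord0 i)))//.
rewrite (IH (fun i => f (lift ord0 i)) (fun i => m (lift ord0 i)) (fun i => k (lift ord0 i))
  (fun i => g (lift ord0 i)))//; last by move=> i c; rewrite mxE.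
rewrite -!EFinM -EFinD; congr (_%:E).
rewrite !big_ord_recl /b' addrA [_ + g ord0]addrC.
set A := \prod_(i < d) m _; set B := \prod_(i < d) k _; set S := cos _.
by ring.
Qed.

End lebRV.

(** * The triangle function and the Fejer kernel in one dimension *)

Section triangle.
Variable R : realType.
Local Notation leb := (@lebesgue_measure R).

Lemma is_derive_continuous (F f : R -> R) :
  (forall x : R, is_derive x 1 F (f x)) -> continuous F.
Proof.
by move=> dF x; apply: differentiable_continuous; apply/derivable1_diffP; case: (dF x).
Qed.

Lemma integral_itv_is_derive (F f : R -> R) (a b : R) : a < b ->
  (forall x : R, is_derive x 1 F (f x)) -> continuous f ->
  (\int[leb]_(x in `[a, b]) (f x)%:E = (F b - F a)%:E)%E.
Proof.
move=> ab dF cf.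
have cF := is_derive_continuous dF.
rewrite (@continuous_FTC2 _ f F a b)//.
- exact: continuous_subspaceT.
- split.
  + by move=> x; case: (dF x).
  + exact/cvg_at_right_filter/cF.
  + exact/cvg_at_left_filter/cF.
- by move=> x _; rewrite derive1E; case: (dF x).
Qed.

Lemma is_derive1_cst (k x : R) : is_derive x 1 (fun _ : R => k) 0.
Proof. exact: is_derive_cst. Qed.

Lemma is_derive1_id (x : R) : is_derive x 1 (fun v : R => v) 1.
Proof. exact: is_derive_id. Qed.

Lemma is_derive1_add (f g : R -> R) (x a b : R) : is_derive x 1 f a -> is_derive x 1 g b ->
  is_derive x 1 (fun v => f v + g v) (a + b).
Proof. by move=> ? ?; exact: is_deriveD. Qed.

Lemma is_derive1_mul (f g : R -> R) (x a b : R) : is_derive x 1 f a -> is_derive x 1 g b ->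
  is_derive x 1 (fun v => f v * g v) (f x * b + g x * a).
Proof. by move=> ? ?; exact: is_deriveM. Qed.

Lemma is_derive1_affine (x k l : R) : is_derive x 1 (fun v => k * v + l) k.
Proof.
have := @is_deriveD _ _ _ _ _ _ _ _ _ (@is_deriveZ _ _ _ id k x 1 1 (is_derive_id _ _)) (@is_derive_cst _ _ _ l x 1).
by rewrite addr0 [k *: _]mulr1.
Qed.

Lemma is_derive1_cos_affine (x k l : R) :
  is_derive x 1 (fun v => cos (k * v + l)) (- sin (k * x + l) * k).
Proof. by apply: (@is_derive1_comp _ (@cos R)); exact: is_derive1_affine. Qed.

Lemma is_derive1_sin_affine (x k l : R) :
  is_derive x 1 (fun v => sin (k * v + l)) (cos (k * x + l) * k).
Proof. by apply: (@is_derive1_comp _ (@sin R)); exact: is_derive1_affine. Qed.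

Lemma is_derive1_shift (x c : R) : is_derive x 1 (fun v => v - c) 1.
Proof. by have := is_derive1_affine x 1 (- c); under eq_fun do rewrite mul1r. Qed.

Lemma is_derive1_quadratic (x k c : R) :
  is_derive x 1 (fun v => v + k * (v - c) ^+ 2) (1 + 2 * k * (x - c)).
Proof.
apply: (is_derive_eq (is_derive1_add (is_derive1_id x) (is_derive1_mul (is_derive1_cst k x) (is_derive1_mul (is_derive1_shift x c) (is_derive1_shift x c))))).
by ring.
Qed.

Definition tri (r c v : R) : R := Num.max 0 (1 - r * `|v - c|).

Lemma tri_ge0 r c v : 0 <= tri r c v.
Proof. by rewrite /tri le_max lexx. Qed.

Lemma tri_le1 r c v : 0 <= r -> tri r c v <= 1.
Proof.
by move=> r0; rewrite /tri ge_max ler01/= gerBl mulr_ge0.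
Qed.

Lemma continuous_tri r c : continuous (tri r c).
Proof.
move=> v; apply: (@continuous_max _ _ (cst 0) (fun v => 1 - r * `|v - c|)).
  exact: cvg_cst.
apply: cvgB; first exact: cvg_cst.
apply: cvgM; first exact: cvg_cst.
by apply: cvg_norm; apply: cvgB; [exact: cvg_id|exact: cvg_cst].
Qed.

Lemma measurable_tri r c : measurable_fun setT (tri r c).
Proof. by apply: continuous_measurable_fun; exact: continuous_tri. Qed.

(** The Fejer kernel [r^-1 (sin (a / 2r) / (a / 2r))^2] written with a cosine and extended by its
    limit at 0; it is the cosine transform of [tri r 0] at frequency [a]. *)
Definition ktri (r a : R) : R :=
  if a == 0 then r^-1 else 2 * r * (1 - cos (a / r)) / a ^+ 2.

Lemma integral_tri_split (r c : R) (f : R -> R) : 0 < r -> continuous f ->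
  (forall v, 0 <= f v) ->
  (\int[leb]_v (tri r c v * f v)%:E =
   \int[leb]_(v in `[(c - r^-1)%R, c]) ((1 + 1 * r * (v - c)) * f v)%:E +
   \int[leb]_(v in `[c, (c + r^-1)%R]) ((1 + -1 * r * (v - c)) * f v)%:E)%E.
Proof.
move=> r0 cf f0.
have h0 : 0 < r^-1 by rewrite invr_gt0.
have mf : measurable_fun setT (fun v => (tri r c v * f v)%:E).
  apply: measurableT_comp => //; apply: measurable_funM; first exact: measurable_tri.
  exact: continuous_measurable_fun.
have rr : r * r^-1 = 1 by rewrite divff// gt_eqF.
transitivity (\int[leb]_(v in `[(c - r^-1)%R, (c + r^-1)%R]) (tri r c v * f v)%:E)%E.
  rewrite [RHS]integral_mkcond; apply: eq_integral => v _.
  rewrite patchE; case: ifPn => // /negP vn; congr (_%:E).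
  suff -> : tri r c v = 0 by rewrite mul0r.
  rewrite /tri max_l// subr_le0.
  rewrite -rr ler_pM2l// leNgt; apply/negP => h; apply: vn.
  by rewrite inE/= in_itv/= -ler_distl ltW.
have -> : `[c - r^-1, c + r^-1]%classic = `[c - r^-1, c]%classic `|` `]c, c + r^-1]%classic.
  apply/seteqP; split=> v /=; rewrite !in_itv/=.
    by move=> /andP[h1 h2]; case: (leP v c) => h; [left|right]; apply/andP; split; lra.
  by case=> /andP[h1 h2]; apply/andP; split; lra.
rewrite ge0_integral_setU//; last 3 first.
- exact: measurable_funTS.
- by move=> v _; rewrite lee_fin mulr_ge0// tri_ge0.
- rewrite disj_set2E; apply/eqP/seteqP; split => v //=.
  by rewrite !in_itv/= => -[/andP[_ h1] /andP[h2 _]]; lra.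
congr (_ + _)%E.
  apply: eq_integral => v; rewrite inE/= in_itv/= => /andP[h1 h2]; congr (_ * _)%:E.
  rewrite /tri ler0_norm ?subr_le0// max_r; last first.
    by rewrite subr_ge0 -rr ler_pM2l//; lra.
  ring.
rewrite integral_itv_obnd_cbnd; last exact: measurable_funTS.
apply: eq_integral => v; rewrite inE/= in_itv/= => /andP[h1 h2]; congr (_ * _)%:E.
rewrite /tri ger0_norm ?subr_ge0// max_r; last first.
  by rewrite subr_ge0 -rr ler_pM2l//; lra.
ring.
Qed.

Lemma integral_tri_cos (r c a b : R) : 0 < r ->
  (\int[leb]_v (tri r c v * (1 + cos (a * v + b)))%:E =
   (r^-1 + ktri r a * cos (a * c + b))%:E)%E.
Proof.
move=> r0; rewrite (integral_tri_split _ r0 (f := fun v => 1 + cos (a * v + b))); last 2 first.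
- exact: (is_derive_continuous (fun v => is_derive1_add (is_derive1_cst 1 v) (is_derive1_cos_affine v a b))).
- by [].
have h0 : 0 < r^-1 by rewrite invr_gt0.
have rn0 : r != 0 by rewrite gt_eqF.
have cf e : continuous (fun x => (1 + e * r * (x - c)) * (1 + cos (a * x + b))).
  exact: (is_derive_continuous (fun v =>
    is_derive1_mul (is_derive1_add (is_derive1_cst 1 v) (is_derive1_mul (is_derive1_cst (e * r) v) (is_derive1_shift v c)))
      (is_derive1_add (is_derive1_cst 1 v) (is_derive1_cos_affine v a b)))).
have [u0|a0] := eqVneq a 0.
  pose F (e v : R) := (v + e * r / 2 * (v - c) ^+ 2) * (1 + cos b).
  have dF e (x : R) : is_derive x 1 (F e) ((1 + e * r * (x - c)) * (1 + cos (a * x + b))).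
    apply: (is_derive_eq (is_derive1_mul (is_derive1_quadratic x (e * r / 2) c) (is_derive1_cst (1 + cos b) x))).
    by rewrite u0 mul0r add0r; field.
  rewrite (@integral_itv_is_derive (F 1) _ (c - r^-1) c _ (dF 1) (cf 1)); last by rewrite gtrBl.
  rewrite (@integral_itv_is_derive (F (-1)) _ c (c + r^-1) _ (dF (-1)) (cf (-1))); last by rewrite ltrDl.
  rewrite -EFinD; congr (_%:E).
  rewrite /F /ktri u0 eqxx mul0r add0r.
  by field.
(* One antiderivative for both sides of the triangle, whose slopes are [e * r] with [e = 1] and
   [e = -1]; the last two summands come from an integration by parts. *)
pose F (e v : R) := v + e * r / 2 * (v - c) ^+ 2
  + (1 + e * r * (v - c)) * (a^-1 * sin (a * v + b)) + e * r / a ^+ 2 * cos (a * v + b).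
have dF e (x : R) : is_derive x 1 (F e) ((1 + e * r * (x - c)) * (1 + cos (a * x + b))).
  apply: (is_derive_eq (is_derive1_add (is_derive1_add (is_derive1_quadratic x (e * r / 2) c)
    (is_derive1_mul (is_derive1_add (is_derive1_cst 1 x) (is_derive1_mul (is_derive1_cst (e * r) x) (is_derive1_shift x c)))
      (is_derive1_mul (is_derive1_cst a^-1 x) (is_derive1_sin_affine x a b)))) (is_derive1_mul (is_derive1_cst (e * r / a ^+ 2) x) (is_derive1_cos_affine x a b)))).
  by field.
rewrite (@integral_itv_is_derive (F 1) _ (c - r^-1) c _ (dF 1) (cf 1)); last by rewrite gtrBl.
rewrite (@integral_itv_is_derive (F (-1)) _ c (c + r^-1) _ (dF (-1)) (cf (-1))); last by rewrite ltrDl.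
rewrite -EFinD; congr (_%:E).
rewrite /F /ktri (negbTE a0).
have -> : a * (c - r^-1) + b = (a * c + b) - a / r by ring.
have -> : a * (c + r^-1) + b = (a * c + b) + a / r by ring.
move: (a * c + b) (a / r) => y z.
rewrite cosB cosD sinB sinD.
by field; rewrite a0 rn0.
Qed.

Lemma integral_tri (r c : R) : 0 < r ->
  (\int[leb]_v (tri r c v)%:E = (r^-1)%:E)%E.
Proof.
move=> r0; have := @integral_tri_cos r c 0 (pi / 2) r0.
rewrite mul0r add0r cos_pihalf mulr0 addr0 => <-; apply: eq_integral => v _.
by rewrite mul0r add0r cos_pihalf addr0 mulr1.
Qed.

Lemma ktri_ge0 r a : 0 < r -> 0 <= ktri r a.
Proof.
move=> r0; rewrite /ktri; case: ifPn => _; first by rewrite invr_ge0 ltW.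
by rewrite divr_ge0 ?sqr_ge0// !mulr_ge0 ?subr_ge0 ?cos_le1 ?ltW.
Qed.

Lemma ktri_le r a : 0 < r -> ktri r a <= r^-1.
Proof.
move=> r0; suff : ((r^-1 + ktri r a)%:E <= (r^-1 + r^-1)%:E)%E by rewrite lee_fin lerD2l.
have := @integral_tri_cos r 0 a 0 r0; rewrite mulr0 add0r cos0 mulr1 => <-.
have := @integral_tri_cos r 0 0 0 r0; rewrite mulr0 add0r cos0 mulr1 /ktri eqxx => <-.
have mf : forall a', measurable_fun setT (fun v => (tri r 0 v * (1 + cos (a' * v + 0)))%:E).
  move=> a'; apply: measurableT_comp => //; apply: measurable_funM; first exact: measurable_tri.
  apply: continuous_measurable_fun.
  exact: (is_derive_continuous (fun v => is_derive1_add (is_derive1_cst 1 v) (is_derive1_cos_affine v _ 0))).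
apply: ge0_le_integral => //.
- by move=> v _; rewrite lee_fin mulr_ge0// tri_ge0.
- exact: mf.
- exact: mf.
move=> v _; rewrite lee_fin ler_wpM2l ?tri_ge0// lerD2l mul0r add0r cos0.
exact: cos_le1.
Qed.

(** After multiplying out, [ktri] contributes at most [r^-1] and
    [ktri * (a / r)^2 = 2 (1 - cos) / r] at most [4 r^-1], whence 5. *)
Lemma ktri_ub r a : 0 < r -> ktri r a <= 5 * r^-1 / (1 + (a / r) ^+ 2).
Proof.
move=> r0; have k1 := ktri_le a r0.
have h0 : 0 < r^-1 by rewrite invr_gt0.
rewrite ler_pdivlMr; last by have := sqr_ge0 (a / r); lra.
rewrite mulrDr mulr1 (_ : 5 = 1 + 4)// mulrDl mul1r lerD//.
rewrite /ktri; case: ifPn => [/eqP ->|a0].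
  by rewrite mul0r expr0n mulr0 mulr_ge0// ltW.
have -> : 2 * r * (1 - cos (a / r)) / a ^+ 2 * (a / r) ^+ 2 = 2 * (1 - cos (a / r)) * r^-1.
  by field; rewrite a0 gt_eqF.
by apply: ler_wpM2r; [exact: ltW|have := cos_geN1 (a / r); lra].
Qed.

(* Close to the origin [ktri r] is comparable to its maximum [1 / r]. *)
Lemma ktri_lb : exists2 e : R, 0 < e &
  forall r a, 0 < r -> `|a| <= e * r -> r^-1 / 2 <= ktri r a.
Proof.
have : \forall y \near (0 : R), 1 / 2 < cos y.
  have := @continuous_cos R 0; rewrite /continuous_at cos0 => /cvgr_gt; apply.
  by lra.
move=> /nbhs_ballP[e /= e0 he].
exists (e / 2); first by lra.
move=> r a r0 ha.
have h0 : 0 < r^-1 by rewrite invr_gt0.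
suff : ((r^-1 + r^-1 / 2)%:E <= (r^-1 + ktri r a)%:E)%E by rewrite lee_fin lerD2l.
have := @integral_tri_cos r 0 a 0 r0; rewrite mulr0 add0r cos0 mulr1 => <-.
(* Where the triangle is positive, [a * v] stays in the neighbourhood of 0 on which [cos] exceeds
   [1 / 2], so [1 + cos] is at least [3 / 2]. *)
have -> : (r^-1 + r^-1 / 2)%:E = (\int[leb]_v ((3 / 2)%:E * (tri r 0 v)%:E))%E.
  rewrite ge0_integralZl_EFin ?divr_ge0//.
  - by rewrite integral_tri// -EFinM; congr (_%:E); field; rewrite gt_eqF.
  - by move=> v _; rewrite lee_fin tri_ge0.
  - by apply: measurableT_comp => //; exact: measurable_tri.
apply: ge0_le_integral => //.
- by move=> v _; rewrite -EFinM lee_fin mulr_ge0// tri_ge0.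
- by apply: emeasurable_funM => //; apply: measurableT_comp => //; exact: measurable_tri.
- apply: measurableT_comp => //; apply: measurable_funM; first exact: measurable_tri.
  apply: continuous_measurable_fun.
  exact: (is_derive_continuous (fun v => is_derive1_add (is_derive1_cst 1 v) (is_derive1_cos_affine v _ 0))).
move=> v _; rewrite -EFinM lee_fin mulrC.
have [rv|rv] := leP 1 (r * `|v|).
  by rewrite /tri subr0 max_l ?mul0r// subr_le0.
rewrite ler_wpM2l ?tri_ge0// addr0.
suff : 1 / 2 < cos (a * v) by lra.
apply: he; rewrite /ball/= sub0r normrN normrM.
apply: (@le_lt_trans _ _ (e / 2 * (r * `|v|))).
  by rewrite mulrA ler_wpM2r.
have : e / 2 * (r * `|v|) <= e / 2 * 1 by rewrite ler_wpM2l ?ltW//; lra.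
lra.
Qed.

End triangle.

(** * Triangular kernels and Fourier transforms *)

Section fourier_fubini.
Variable R : realType.
Local Notation leb := (@lebesgue_measure R).

Definition trid d (r : R) (c : 'rV[R]_d) (w : borelRV R d) : R :=
  \prod_(i < d) tri r (c ord0 i) ((w : 'rV[R]_d) ord0 i).

Definition ktrid d (r : R) (x : 'rV[R]_d) : R :=
  \prod_(i < d) ktri r (2 * pi * x ord0 i).

Lemma trid_ge0 d r c (w : borelRV R d) : 0 <= trid r c w.
Proof. by apply: prodr_ge0 => i _; exact: tri_ge0. Qed.

Lemma trid_le1 d r c (w : borelRV R d) : 0 <= r -> trid r c w <= 1.
Proof.
by move=> r0; apply: prodr_ile1 => i _; rewrite tri_ge0 tri_le1.
Qed.

Lemma measurable_trid d r c : measurable_fun setT (@trid d r c).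
Proof.
apply: (@measurable_prod_coord _ _ (fun i => tri r (c ord0 i))) => i.
exact: measurable_tri.
Qed.

Lemma ktrid_ge0 d r (x : 'rV[R]_d) : 0 < r -> 0 <= ktrid r x.
Proof. by move=> r0; apply: prodr_ge0 => i _; exact: ktri_ge0. Qed.

Lemma ktrid_le d r (x : 'rV[R]_d) : 0 < r -> ktrid r x <= r^-1 ^+ d.
Proof.
move=> r0; rewrite -[d in leRHS]card_ord -prodr_const.
by apply: ler_prod => i _; rewrite ktri_ge0// ktri_le.
Qed.

Lemma measurable_ktri r : measurable_fun setT (@ktri R r).
Proof.
rewrite /ktri; apply: measurable_fun_ifT => //=.
  by apply: measurable_fun_eqr.
apply: measurable_funM => //.
  apply: measurable_funM => //; apply: measurable_funB => //.
  apply: measurableT_comp; first exact: measurable_cos.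
  exact: measurable_funM.
have -> : (fun a : R => (a ^+ 2)^-1) = (fun a => (a ^+ 2) `^ (-1)).
  by apply/funext => a; rewrite powR_inv1// sqr_ge0.
by apply: (measurableT_comp (measurable_powR _)); exact: measurable_funX.
Qed.

Lemma integral_trid_cos d r (c x : 'rV[R]_d) b : 0 < r ->
  (\int[@lebRV R d]_w (trid r c w * (1 + cos (2 * pi * dotv w x + b)))%:E =
   (r^-1 ^+ d + ktrid r x * cos (2 * pi * dotv c x + b))%:E)%E.
Proof.
move=> r0.
rewrite (@integral_lebRV_prod_cos _ _ (fun i => tri r (c ord0 i)) (fun=> r^-1)
  (fun i => ktri r (2 * pi * x ord0 i)) (fun i => 2 * pi * x ord0 i * c ord0 i)).
- rewrite prodr_const card_ord; congr (_ + _ * cos (_ + _))%:E.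
  by rewrite /dotv mulr_sumr; apply: eq_bigr => i _; ring.
- by move=> i; exact: measurable_tri.
- by move=> i v; exact: tri_ge0.
- by move=> i; exact: integral_tri.
- by move=> i; rewrite ktri_ge0// ktri_le.
move=> i e.
have := integral_tri_cos (c ord0 i) (2 * pi * x ord0 i) e r0 => <-.
by apply: eq_integral => v _; do 4 f_equal; ring.
Qed.

Lemma integral_trid d r (c : 'rV[R]_d) : 0 < r ->
  (\int[@lebRV R d]_w (trid r c w)%:E = (r^-1 ^+ d)%:E)%E.
Proof.
move=> r0; rewrite (@ge0_integral_lebRV_prod _ _ (fun i => tri r (c ord0 i)) (fun=> r^-1)).
- by rewrite prodr_const card_ord.
- by move=> i; exact: measurable_tri.
- by move=> i v; exact: tri_ge0.
- by move=> i; exact: integral_tri.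
Qed.

Section dual.
Context dT (T : measurableType dT).
Variables (P : {sigma_finite_measure set T -> \bar R}) (M : R).
Hypothesis PM : P setT = M%:E.

Lemma integrable_bounded (f : T -> R) K : measurable_fun setT f ->
  (forall t, `|f t| <= K) -> P.-integrable setT (EFin \o f).
Proof.
move=> mf fK; apply: measurable_bounded_integrable => //; first by move: PM => /= ->; rewrite ltry.
by exists K; split; [exact: num_real|move=> x Kx y _ /=; exact: le_trans (fK y) (ltW Kx)].
Qed.

Lemma integral_1D (f : T -> R) : measurable_fun setT f ->
  (forall t, `|f t| <= 1) ->
  (\int[P]_t (1 + f t)%:E = (M + \int[P]_t f t)%:E)%E.
Proof.
move=> mf f1.
have if1 : P.-integrable setT (EFin \o f) by exact: (integrable_bounded mf f1).
under eq_integral do rewrite EFinD.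
rewrite integralD//; last first.
  by apply: (@integrable_bounded (cst 1) 1) => // t; rewrite normr1.
rewrite EFinD; congr (_ + _)%E; first by rewrite integral_cst// mul1e; exact: PM.
by rewrite fineK//; exact: integrable_fin_num.
Qed.

Variables (d : nat) (h : T -> 'rV[R]_d).
Hypothesis mh : forall i, measurable_fun setT (fun t => h t ord0 i).

(** The phases [b = 0] and [b = pi / 2] give the real and imaginary parts of the transform of the
    image of [P] under [h]. It serves twice: for [mu] with [h] the identity, and for the product of
    [mu] with itself with [h] the difference of the two points. *)
Definition fcos (w : 'rV[R]_d) b := (\int[P]_t cos (2 * pi * dotv w (h t) + b))%R.

Lemma measurable_cos_dotv (w : 'rV[R]_d) b :
  measurable_fun setT (fun t => cos (2 * pi * dotv w (h t) + b)).
Proof.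
apply: measurableT_comp; first exact: measurable_cos.
apply: measurable_funD => //; apply: measurable_funM => //.
exact: measurable_dotv.
Qed.

Lemma integral_1Dcos (w : 'rV[R]_d) b :
  (\int[P]_t (1 + cos (2 * pi * dotv w (h t) + b))%:E = (M + fcos w b)%:E)%E.
Proof.
rewrite integral_1D//; first exact: measurable_cos_dotv.
by move=> t; rewrite ler_norml cos_geN1 cos_le1.
Qed.

Lemma measurable_1Dcos b : measurable_fun setT (fun p : borelRV R d * T =>
  1 + cos (2 * pi * dotv p.1 (h p.2) + b)).
Proof.
apply: measurable_funD => //.
apply: measurableT_comp; first exact: measurable_cos.
apply: measurable_funD => //; apply: measurable_funM => //.
apply: measurable_sum => i; apply: measurable_funM.
  by apply: (measurableT_comp (f := fun x : borelRV R d => (x : 'rV[R]_d) ord0 i)); [exact: measurable_coord|].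
exact: (measurableT_comp (mh i) measurable_snd).
Qed.

Lemma measurable_fcos b :
  measurable_fun setT (fun w : borelRV R d => fcos w b).
Proof.
have : measurable_fun setT (fun w : borelRV R d => M + fcos w b).
  apply/measurable_EFinP.
  have -> : EFin \o (fun w : borelRV R d => M + fcos w b) =
     fubini_F P (fun p : borelRV R d * T => (1 + cos (2 * pi * dotv p.1 (h p.2) + b))%:E).
    by apply/funext => w; rewrite /fubini_F /= integral_1Dcos.
  apply: measurable_fun_fubini_tonelli_F.
    by apply/measurable_EFinP; exact: measurable_1Dcos.
  by move=> t; rewrite lee_fin; have := cos_geN1 (2 * pi * dotv t.1 (h t.2) + b); lra.
move=> /(measurable_funB (g := cst M)) /(_ (measurable_cst _)) H.
rewrite (_ : (fun _ => _) = (fun w : borelRV R d => M + fcos w b - M)) //.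
by apply/funext => w; rewrite addrC addKr.
Qed.

(** Tonelli for [trid * (1 + cos)]. The summands [M] and [r^-1 ^+ d] are the traces of the added 1
    and are cancelled where the lemma is applied. *)
Lemma trid_fubini r (c : 'rV[R]_d) b : 0 < r ->
  (\int[@lebRV R d]_w (trid r c w * (M + fcos w b))%:E =
   \int[P]_t (r^-1 ^+ d + ktrid r (h t) * cos (2 * pi * dotv c (h t) + b))%:E)%E.
Proof.
move=> r0.
pose f (p : borelRV R d * T) :=
  (trid r c p.1 * (1 + cos (2 * pi * dotv p.1 (h p.2) + b)))%:E.
have f0 p : (0 <= f p)%E.
  apply: mulr_ge0; first exact: trid_ge0.
  by have := cos_geN1 (2 * pi * dotv p.1 (h p.2) + b); lra.
have mf : measurable_fun setT f.
  apply/measurable_EFinP; apply: measurable_funM; last exact: measurable_1Dcos.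
  by apply: measurableT_comp => //; exact: measurable_trid.
transitivity (\int[@lebRV R d]_w \int[P]_t f (w, t))%E.
  apply: eq_integral => w _; rewrite /f/=.
  transitivity (\int[P]_t ((trid r c w)%:E * (1 + cos (2 * pi * dotv w (h t) + b))%:E))%E; last first.
    by apply: eq_integral => t _; rewrite -EFinM.
  rewrite ge0_integralZl_EFin//.
  + by rewrite integral_1Dcos.
  + by apply/measurable_EFinP; apply: measurable_funD => //; exact: measurable_cos_dotv.
  + exact: trid_ge0.
transitivity (\int[P]_t \int[@lebRV R d]_w f (w, t))%E; last first.
  by apply: eq_integral => t _; rewrite -integral_trid_cos.
exact: (@sfinite_Fubini _ _ _ _ _ (@lebRV R d) P f f0 mf).
Qed.

Lemma measurable_ktrid r : measurable_fun setT (fun t => ktrid r (h t)).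
Proof.
apply: measurable_prod => i _.
apply: measurableT_comp; first exact: measurable_ktri.
by apply: measurable_funM => //; exact: mh.
Qed.

End dual.
End fourier_fubini.

(** * Measures with a bounded density and the modulus of the transform *)

Section density.
Context dT (T : measurableType dT) (R : realType).
Variables (mu : {finite_measure set T -> \bar R}) (phi : T -> R) (K : R).

(* The proofs are arguments so that the measure structure can be inferred. *)
Definition mden (mphi : measurable_fun setT phi)
    (phi0 : forall x, 0 <= phi x <= K) (A : set T) : \bar R :=
  (\int[mu]_(x in A) (phi x)%:E)%E.

Variables (mphi : measurable_fun setT phi) (phi0 : forall x, 0 <= phi x <= K).
Local Notation nu := (mden mphi phi0).

Let mphiE D : measurable_fun D (EFin \o phi).
Proof. by apply/measurable_EFinP; exact: measurable_funTS. Qed.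

Let phi_ge0 x : 0 <= phi x. Proof. by have /andP[] := phi0 x. Qed.
Let phi_leK x : phi x <= K. Proof. by have /andP[] := phi0 x. Qed.

Let mden0 : nu set0 = 0%E.
Proof. by rewrite /mden integral_set0. Qed.

Let mden_ge0 A : (0 <= nu A)%E.
Proof. by apply: integral_ge0 => x _; rewrite lee_fin. Qed.

Let mden_sigma_additive : semi_sigma_additive nu.
Proof.
move=> F mF tF mUF; rewrite /mden ge0_integral_bigcup//.
- by apply: is_cvg_nneseries => n _ _; apply: integral_ge0 => x _; rewrite lee_fin.
- by move=> x _; rewrite lee_fin.
Qed.

HB.instance Definition _ := isMeasure.Build _ _ _ nu
  mden0 mden_ge0 mden_sigma_additive.

Lemma mden_le A : measurable A -> (nu A <= K%:E * mu A)%E.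
Proof.
move=> mA; rewrite -integral_cst//; apply: ge0_le_integral => //.
- by move=> x _; rewrite lee_fin.
- by move=> x _; rewrite lee_fin.
Qed.

Let mden_fin : fin_num_fun nu.
Proof.
move=> A mA; rewrite ge0_fin_numE//; apply: le_lt_trans (mden_le mA) _.
by rewrite ltey_eq fin_numM// fin_num_measure.
Qed.

HB.instance Definition _ := Measure_isFinite.Build _ _ _ nu mden_fin.

Lemma mden_dom : nu `<< mu.
Proof.
apply/null_content_dominatesP => A mA muA0.
apply/eqP; rewrite eq_le measure_ge0 andbT.
by apply: le_trans (mden_le mA) _; rewrite muA0 mule0.
Qed.

(** [phi] agrees almost everywhere with the Radon-Nikodym derivative of the new measure, so the
    change of variables for dominated measures applies. *)
Lemma integral_mden (f : T -> R) L : measurable_fun setT f ->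
  (forall x, `|f x| <= L) ->
  (\int[nu]_x (f x)%:E = \int[mu]_x (f x * phi x)%:E)%E.
Proof.
move=> mf fL.
rewrite -(Radon_Nikodym_change_of_variables mden_dom)//; last first.
  apply: measurable_bounded_integrable => //; first by rewrite ltey_eq fin_num_measure.
  by exists L; split; [exact: num_real|move=> x Lx y _ /=; exact: le_trans (fL y) (ltW Lx)].
under [RHS]eq_integral do rewrite EFinM.
apply: ae_eq_integral => //.
- apply: emeasurable_funM; first exact/measurable_EFinP.
  by apply: (measurable_int mu); apply: Radon_Nikodym_integrable; exact: mden_dom.
- by apply: emeasurable_funM => //; exact/measurable_EFinP.
- apply: ae_eqe_mul2l => /=.
  apply: integral_ae_eq => //.
  + by apply: Radon_Nikodym_integrable; exact: mden_dom.
  + by move=> E _ mE; rewrite -Radon_Nikodym_integral//; exact: mden_dom.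
Qed.

End density.

Section fourier_norm.
Variables (R : realType) (d : nat).
Implicit Types (mu nu : {finite_measure set (borelRV R d) -> \bar R}).
Implicit Types (z w : 'rV[R]_d).

Definition mass mu : R := fine (mu setT).

Lemma massE mu : mu setT = (mass mu)%:E.
Proof. by rewrite /mass fineK// fin_num_measure. Qed.

Lemma mass_ge0 mu : 0 <= mass mu.
Proof. by rewrite /mass fine_ge0. Qed.

Definition nfourier mu z : R := Normc.normc (fourier mu z).

Definition cosI mu z : R := \int[mu]_x cos (2 * pi * dotv z x).
Definition sinI mu z : R := \int[mu]_x sin (2 * pi * dotv z x).

Lemma nfourierE mu z : nfourier mu z = Num.sqrt (cosI mu z ^+ 2 + sinI mu z ^+ 2).
Proof. by rewrite /nfourier /fourier /= sqrrN. Qed.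

Lemma nfourier_ge0 mu z : 0 <= nfourier mu z.
Proof. by rewrite nfourierE sqrtr_ge0. Qed.

Lemma sqr_nfourier mu z : nfourier mu z ^+ 2 = cosI mu z ^+ 2 + sinI mu z ^+ 2.
Proof. by rewrite nfourierE sqr_sqrtr// addr_ge0 ?sqr_ge0. Qed.

Local Notation fc mu := (fcos mu (fun x : borelRV R d => (x : 'rV[R]_d))).

Lemma fcosE mu z b : fc mu z b = cos b * cosI mu z - sin b * sinI mu z.
Proof.
have ma : measurable_fun setT (fun x : borelRV R d => 2 * pi * dotv z (x : 'rV[R]_d)).
  by apply: measurable_funM => //; apply: measurable_dotv => i; exact: measurable_coord.
have ic : mu.-integrable setT (EFin \o (fun x : borelRV R d => cos (2 * pi * dotv z (x : 'rV[R]_d)))).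
  apply: (integrable_bounded (massE mu) (K := 1)) => [|t].
    by apply: measurableT_comp => //; exact: measurable_cos.
  by rewrite ler_norml cos_geN1 cos_le1.
have is_ : mu.-integrable setT (EFin \o (fun x : borelRV R d => sin (2 * pi * dotv z (x : 'rV[R]_d)))).
  apply: (integrable_bounded (massE mu) (K := 1)) => [|t].
    by apply: measurableT_comp => //; exact: measurable_sin.
  by rewrite ler_norml sin_geN1 sin_le1.
rewrite /fcos /cosI /sinI -!RintegralZl//= -RintegralB//.
- by apply: eq_Rintegral => x _; rewrite cosD; ring.
- by have := integrableZl measurableT (cos b) ic; apply: eq_integrable => // x _ /=; rewrite EFinM.
- by have := integrableZl measurableT (sin b) is_; apply: eq_integrable => // x _ /=; rewrite EFinM.
Qed.

Lemma le_fcos_nfourier mu z b : `|fc mu z b| <= nfourier mu z.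
Proof.
rewrite -(@ler_pXn2r _ 2)// ?nnegrE ?nfourier_ge0//.
rewrite sqr_nfourier -normrX ger0_norm ?sqr_ge0// fcosE.
have := cos2Dsin2 b; set c := cos b; set s := sin b => e.
(* This square is the defect in the Cauchy-Schwarz inequality, by Lagrange's identity. *)
have : 0 <= (c * sinI mu z + s * cosI mu z) ^+ 2 by exact: sqr_ge0.
have -> : cosI mu z ^+ 2 + sinI mu z ^+ 2 = (c ^+ 2 + s ^+ 2) * (cosI mu z ^+ 2 + sinI mu z ^+ 2).
  by rewrite e mul1r.
by nra.
Qed.

Lemma nfourier_le_cosI_sinI mu z : nfourier mu z <= `|cosI mu z| + `|sinI mu z|.
Proof.
rewrite -(@ler_pXn2r _ 2)// ?nnegrE ?nfourier_ge0 ?addr_ge0//.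
rewrite sqr_nfourier sqrrD !real_normK ?num_real// addrAC lerDl.
by rewrite mulrn_wge0// mulr_ge0.
Qed.

(** Two phases, picked by the signs of the two integrals, replace the argument of a complex number.
    They are the source of the factor 2 in [nfourier_le_mass] and [nfourier_mden]. *)
Lemma nfourier_le_fcos mu z :
  exists b b', nfourier mu z <= fc mu z b + fc mu z b'.
Proof.
pose b : R := if 0 <= cosI mu z then 0 else pi.
pose b' : R := if 0 <= sinI mu z then - (pi / 2) else pi / 2.
exists b, b'; apply: le_trans (nfourier_le_cosI_sinI mu z) _.
apply: lerD; rewrite fcosE /b /b'; case: ifPn => h.
- by rewrite cos0 sin0 ger0_norm//; lra.
- by rewrite cospi sinpi ltr0_norm ?ltNge//; lra.
- by rewrite cosN sinN cos_pihalf sin_pihalf ger0_norm//; lra.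
- by rewrite cos_pihalf sin_pihalf ltr0_norm ?ltNge//; lra.
Qed.

Lemma nfourier_le_mass mu z : nfourier mu z <= 2 * mass mu.
Proof.
have [b [b' h]] := nfourier_le_fcos mu z.
suff H c : fc mu z c <= mass mu by apply: le_trans h _; have := H b; have := H b'; lra.
rewrite -lee_fin -massE; have mh (i : 'I_d) := @measurable_coord R d i.
(* Shifting the phase by [pi] turns the lower bound [1 + cos >= 0] into an upper bound for
   [fcos]. *)
have := integral_1Dcos (massE mu) mh z (c + pi).
have -> : fc mu z (c + pi) = - fc mu z c.
  by rewrite !fcosE cosDpi sinDpi; ring.
move=> e; have : (0 <= (mass mu + - fc mu z c)%:E)%E.
  rewrite -e; apply: integral_ge0 => x _; rewrite lee_fin.
  by have := cos_geN1 (2 * pi * dotv z x + (c + pi)); lra.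
by rewrite massE !lee_fin; lra.
Qed.

Lemma nfourier0 mu : nfourier mu 0 = mass mu.
Proof.
have e x : dotv (0 : 'rV[R]_d) x = 0.
  by rewrite /dotv big1// => i _; rewrite mxE mul0r.
rewrite nfourierE.
have -> : cosI mu 0 = mass mu.
  rewrite /cosI; under eq_Rintegral do rewrite e mulr0 cos0.
  by rewrite Rintegral_cst// mul1r.
have -> : sinI mu 0 = 0.
  rewrite /sinI; under eq_Rintegral do rewrite e mulr0 sin0.
  by rewrite Rintegral_cst// mul0r.
by rewrite expr0n addr0 sqrtr_sqr ger0_norm// mass_ge0.
Qed.

Lemma measurable_nfourier mu :
  measurable_fun setT (fun z : borelRV R d => nfourier mu z).
Proof.
have mh (i : 'I_d) := @measurable_coord R d i.
have e : (fun z : borelRV R d => nfourier mu z) =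
    (fun z : borelRV R d => Num.sqrt (fc mu z 0 ^+ 2 + fc mu z (pi / 2) ^+ 2)).
  apply/funext => z; rewrite nfourierE !fcosE cos0 sin0 cos_pihalf sin_pihalf.
  by congr Num.sqrt; ring.
rewrite e; apply: (measurableT_comp (f := @Num.sqrt R)).
  by apply: continuous_measurable_fun; exact: sqrt_continuous.
by apply: measurable_funD; apply: measurable_funX; exact: (measurable_fcos (massE mu) mh).
Qed.

(* Fourier inversion for the explicit pair [trid], [ktrid]. *)
Lemma nfourier_mden mu r (phiK : forall x : borelRV R d, 0 <= ktrid r (x : 'rV[R]_d) <= r^-1 ^+ d)
    (mphi : measurable_fun setT (fun x : borelRV R d => ktrid r (x : 'rV[R]_d))) z : 0 < r ->
  ((nfourier (mden mu mphi phiK) z)%:E <=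
   2%:E * \int[@lebRV R d]_w (trid r z w * nfourier mu w)%:E)%E.
Proof.
move=> r0; have mh (i : 'I_d) := @measurable_coord R d i.
set nu := mden mu mphi phiK.
pose I := (\int[@lebRV R d]_w (trid r z w * nfourier mu w)%:E)%E.
have mtn : measurable_fun setT (fun w : borelRV R d => (trid r z w * nfourier mu w)%:E).
  apply/measurable_EFinP; apply: measurable_funM; first exact: measurable_trid.
  exact: measurable_nfourier.
have tn0 (w : borelRV R d) : 0 <= trid r z w * nfourier mu w by rewrite mulr_ge0 ?trid_ge0 ?nfourier_ge0.
have key b : ((fc nu z b)%:E <= I)%E.
  have Ifin : (fc nu z b)%:E = (\int[mu]_x (ktrid r (x : 'rV[R]_d) * cos (2 * pi * dotv z x + b))%:E)%E.
    rewrite /fcos /Rintegral fineK; last first.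
      apply: integrable_fin_num => //; apply: (integrable_bounded (massE nu) (K := 1)).
        exact: measurable_cos_dotv.
      by move=> t; rewrite ler_norml cos_geN1 cos_le1.
    rewrite (@integral_mden _ _ _ mu _ _ mphi phiK _ 1).
    - by apply: eq_integral => x _; rewrite mulrC.
    - exact: measurable_cos_dotv.
    - by move=> t; rewrite ler_norml cos_geN1 cos_le1.
  have E := trid_fubini (massE mu) mh z b r0.
  have ik : mu.-integrable setT (EFin \o (fun x : borelRV R d => ktrid r (x : 'rV[R]_d) * cos (2 * pi * dotv z (x : 'rV[R]_d) + b))).
    apply: (integrable_bounded (massE mu) (K := r^-1 ^+ d)).
      by apply: measurable_funM => //; exact: measurable_cos_dotv.
    move=> t; rewrite normrM; have /andP[k0 k1] := phiK t.
    rewrite ger0_norm// -[leRHS]mulr1 ler_pM//.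
    by rewrite ler_norml cos_geN1 cos_le1.
  have ic : mu.-integrable setT (EFin \o (fun x : borelRV R d => r^-1 ^+ d)).
    by apply: (integrable_bounded (massE mu) (K := `|r^-1 ^+ d|)).
  have E2 : (\int[mu]_x (r^-1 ^+ d + ktrid r (x : 'rV[R]_d) * cos (2 * pi * dotv z x + b))%:E = (r^-1 ^+ d * mass mu)%:E + (fc nu z b)%:E)%E.
    under eq_integral do rewrite EFinD.
    rewrite integralD// Ifin; congr (_ + _)%E.
    by rewrite integral_cst// EFinM; congr (_ * _)%E; exact: massE.
  (* By [E] and [E2] the left side is [r^-1 ^+ d * mass mu] plus the quantity to be bounded; the
     finite constant cancels. *)
  have E3 : (\int[@lebRV R d]_w (trid r z w * (mass mu + fc mu w b))%:E <=
      (r^-1 ^+ d * mass mu)%:E + I)%E.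
    have -> : (r^-1 ^+ d * mass mu)%:E = (\int[@lebRV R d]_w ((mass mu)%:E * (trid r z w)%:E))%E.
      rewrite ge0_integralZl_EFin ?mass_ge0//.
      - by rewrite integral_trid// -EFinM mulrC.
      - by move=> w _; rewrite lee_fin trid_ge0.
      - by apply/measurable_EFinP; exact: measurable_trid.
    rewrite /I -ge0_integralD//; last 3 first.
    - by move=> w _; rewrite -EFinM lee_fin mulr_ge0 ?mass_ge0 ?trid_ge0.
    - by apply: emeasurable_funM => //; apply/measurable_EFinP; exact: measurable_trid.
    - by move=> w _; rewrite lee_fin.
    apply: ge0_le_integral => //.
    - move=> w _; rewrite lee_fin mulr_ge0 ?trid_ge0//.
      rewrite -lee_fin -(integral_1Dcos (massE mu) mh).
      apply: integral_ge0 => x _; rewrite lee_fin.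
      by have := cos_geN1 (2 * pi * dotv w x + b); lra.
    - apply/measurable_EFinP; apply: measurable_funM; first exact: measurable_trid.
      by apply: measurable_funD => //; exact: (measurable_fcos (massE mu) mh).
    - apply: emeasurable_funD => //.
      by apply: emeasurable_funM => //; apply/measurable_EFinP; exact: measurable_trid.
    move=> w _; rewrite -EFinM -EFinD lee_fin mulrDr [mass mu * _]mulrC lerD2l.
    rewrite ler_wpM2l ?trid_ge0//.
    exact: le_trans (ler_norm _) (le_fcos_nfourier _ _ _).
  by move: E3; rewrite E E2 leeD2lE.
have [b [b' h]] := nfourier_le_fcos nu z.
apply: (@le_trans _ _ ((fc nu z b)%:E + (fc nu z b')%:E)%E).
  by rewrite -EFinD lee_fin.
by rewrite mule_natl mule2n; apply: leeD; exact: key.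
Qed.

End fourier_norm.

(** * Squared transforms and pairs of points *)

Section energy.
Variables (R : realType) (d : nat) (mu : {finite_measure set (borelRV R d) -> \bar R}).
Local Notation T := (borelRV R d).
Local Notation M := (mass mu).

Definition prodm : set (T * T)%type -> \bar R := (mu \x mu)%E.

HB.instance Definition _ := Measure.on prodm.

Lemma mass_prod : prodm setT = (M ^+ 2)%:E.
Proof.
by rewrite -setXTT /prodm product_measure1E// expr2 EFinM -massE.
Qed.

Let prodm_fin : fin_num_fun prodm.
Proof.
move=> A mA; rewrite ge0_fin_numE//.
apply: (@le_lt_trans _ _ (prodm setT)); last by rewrite mass_prod ltry.
by apply: le_measure; rewrite ?inE.
Qed.

HB.instance Definition _ := Measure_isFinite.Build _ _ _ prodm prodm_fin.

Definition subpair (p : T * T) : 'rV[R]_d := (p.1 : 'rV[R]_d) - (p.2 : 'rV[R]_d).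

Lemma measurable_subpair (i : 'I_d) : measurable_fun setT (fun p => subpair p ord0 i).
Proof.
have -> : (fun p => subpair p ord0 i) =
    (fun p : T * T => (p.1 : 'rV[R]_d) ord0 i - (p.2 : 'rV[R]_d) ord0 i).
  by apply/funext => p; rewrite /subpair !mxE.
apply: measurable_funB.
- exact: (measurableT_comp (@measurable_coord R d i) measurable_fst).
- exact: (measurableT_comp (@measurable_coord R d i) measurable_snd).
Qed.

Lemma dotv_subpair w p : dotv w (subpair p) = dotv w (p.1 : 'rV[R]_d) - dotv w (p.2 : 'rV[R]_d).
Proof.
by rewrite /dotv -sumrB; apply: eq_bigr => i _; rewrite /subpair !mxE mulrBr.
Qed.

(** The addition formula for the cosine of a difference splits the double integral into
    [cosI^2 + sinI^2]. *)
Lemma sqr_nfourier_fcos w : fcos prodm subpair w 0 = nfourier mu w ^+ 2.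
Proof.
have mh (i : 'I_d) := @measurable_coord R d i.
have := integral_1Dcos mass_prod measurable_subpair w 0.
rewrite fubini_tonelli1; last 2 first.
- apply/measurable_EFinP; apply: measurable_funD => //.
  exact: (measurable_cos_dotv measurable_subpair).
- by move=> p; rewrite lee_fin; have := cos_geN1 (2 * pi * dotv w (subpair p) + 0); lra.
move=> /esym e.
suff : (M ^+ 2 + fcos prodm subpair w 0)%:E = (M ^+ 2 + nfourier mu w ^+ 2)%:E.
  by move=> [/addrI].
rewrite e /fubini_F.
have ma : measurable_fun setT (fun x : T => 2 * pi * dotv w (x : 'rV[R]_d)).
  by apply: measurable_funM => //; exact: measurable_dotv.
have ic : mu.-integrable setT (EFin \o (fun x : T => cos (2 * pi * dotv w (x : 'rV[R]_d)))).
  apply: (integrable_bounded (massE mu) (K := 1)) => [|t].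
    by apply: measurableT_comp => //; exact: measurable_cos.
  by rewrite ler_norml cos_geN1 cos_le1.
have is_ : mu.-integrable setT (EFin \o (fun x : T => sin (2 * pi * dotv w (x : 'rV[R]_d)))).
  apply: (integrable_bounded (massE mu) (K := 1)) => [|t].
    by apply: measurableT_comp => //; exact: measurable_sin.
  by rewrite ler_norml sin_geN1 sin_le1.
transitivity (\int[mu]_x ((M%:E + ((cosI mu w)%:E * (cos (2 * pi * dotv w (x : 'rV[R]_d)))%:E +
    (sinI mu w)%:E * (sin (2 * pi * dotv w (x : 'rV[R]_d)))%:E))))%E.
  apply: eq_integral => x _.
  transitivity (\int[mu]_y (1 + cos (2 * pi * dotv w (y : 'rV[R]_d) + - (2 * pi * dotv w (x : 'rV[R]_d))))%:E)%E.
    apply: eq_integral => y _; congr (1 + _)%:E.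
    by rewrite dotv_subpair/= -cosN; congr cos; ring.
  rewrite (integral_1Dcos (massE mu) mh) fcosE cosN sinN -!EFinM -!EFinD.
  by congr (_%:E); ring.
have ic' : mu.-integrable setT (fun x : T => (cosI mu w)%:E * (cos (2 * pi * dotv w (x : 'rV[R]_d)))%:E)%E.
  exact: (integrableZl measurableT (cosI mu w) ic).
have is' : mu.-integrable setT (fun x : T => (sinI mu w)%:E * (sin (2 * pi * dotv w (x : 'rV[R]_d)))%:E)%E.
  exact: (integrableZl measurableT (sinI mu w) is_).
rewrite integralD//; last 2 first.
- by apply: (integrable_bounded (massE mu) (f := cst M) (K := `|M|)).
- exact: integrableD.
rewrite integralD//.
rewrite (integralZl measurableT ic) (integralZl measurableT is_).
rewrite sqr_nfourier expr2 [in RHS]EFinD EFinM; congr (_ + _)%E.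
  by rewrite integral_cst//; congr (_ * _)%E; exact: massE.
rewrite [RHS]EFinD; congr (_ + _)%E; rewrite expr2 EFinM; congr (_ * _)%E.
- by rewrite /cosI /Rintegral fineK//; exact: integrable_fin_num.
- by rewrite /sinI /Rintegral fineK//; exact: integrable_fin_num.
Qed.

(** Stands in for the formula relating [J_{s,1}] to the Riesz energy, one scale at a time:
    frequencies up to [1 / r] are weighed against pairs of points at distance of order [r]. Both
    inequalities at [theta = 1] go through it. *)
Lemma energy_trid r : 0 < r ->
  (\int[@lebRV R d]_w (trid r 0 w * nfourier mu w ^+ 2)%:E =
   \int[prodm]_p (ktrid r (subpair p))%:E)%E.
Proof.
move=> r0.
have e0 x : dotv (0 : 'rV[R]_d) x = 0.
  by rewrite /dotv big1// => i _; rewrite mxE mul0r.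
have mt : measurable_fun setT (fun w : T => (trid r 0 w)%:E).
  by apply/measurable_EFinP; exact: measurable_trid.
have M20 : 0 <= M ^+ 2 by exact: sqr_ge0.
have := trid_fubini mass_prod measurable_subpair 0 0 r0.
have -> : (\int[@lebRV R d]_w (trid r 0 w * (M ^+ 2 + fcos prodm subpair w 0))%:E =
   (M ^+ 2 * r^-1 ^+ d)%:E + \int[@lebRV R d]_w (trid r 0 w * nfourier mu w ^+ 2)%:E)%E.
  transitivity (\int[@lebRV R d]_w ((M ^+ 2)%:E * (trid r 0 w)%:E + (trid r 0 w * nfourier mu w ^+ 2)%:E))%E.
    apply: eq_integral => w _; rewrite -EFinM -EFinD sqr_nfourier_fcos; congr (_%:E); ring.
  rewrite ge0_integralD//.
  - congr (_ + _)%E; rewrite ge0_integralZl_EFin//.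
    + by rewrite integral_trid// -EFinM.
    + by move=> w _; rewrite lee_fin trid_ge0.
  - by move=> w _; rewrite -EFinM lee_fin mulr_ge0// trid_ge0.
  - exact: emeasurable_funM.
  - by move=> w _; rewrite lee_fin mulr_ge0 ?trid_ge0 ?sqr_ge0.
  - apply/measurable_EFinP; apply: measurable_funM; first exact: measurable_trid.
    by apply: measurable_funX; exact: measurable_nfourier.
have -> : (\int[prodm]_p (r^-1 ^+ d + ktrid r (subpair p) * cos (2 * pi * dotv 0%R (subpair p) + 0))%:E
    = (M ^+ 2 * r^-1 ^+ d)%:E + \int[prodm]_p (ktrid r (subpair p))%:E)%E.
  transitivity (\int[prodm]_p ((r^-1 ^+ d)%:E + (ktrid r (subpair p))%:E))%E.
    by apply: eq_integral => p _; rewrite e0 mulr0 addr0 cos0 mulr1 EFinD.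
  rewrite ge0_integralD//.
  - congr (_ + _)%E; rewrite integral_cst// mulrC EFinM; congr (_ * _)%E.
    exact: mass_prod.
  - by move=> p _; rewrite lee_fin exprn_ge0// invr_ge0 ltW.
  - by move=> p _; rewrite lee_fin ktrid_ge0.
  - by apply/measurable_EFinP; exact: (measurable_ktrid measurable_subpair).
by move=> e; apply/eqP; rewrite eq_le; apply/andP; split; rewrite -(@leeD2lE _ (M ^+ 2 * r^-1 ^+ d)%:E)// e.
Qed.

End energy.

Section enorm.
Variables (R : realType) (d : nat).
Implicit Types (z : 'rV[R]_d).

Lemma coord_le_norm z i : `|z ord0 i| <= `|z|.
Proof.
by rewrite [leRHS]mx_normrE; apply: (le_bigmax _ (fun k : 'I_1 * 'I_d => `|z k.1 k.2|) (ord0, i)).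
Qed.

Lemma norm_le_coord z r : 0 <= r -> (forall i, `|z ord0 i| <= r) -> `|z| <= r.
Proof.
move=> r0 zr; rewrite [leLHS]mx_normrE; apply: bigmax_le => // -[i j] _ /=.
by rewrite (ord1 i).
Qed.

Lemma cubeP (c z : 'rV[R]_d) r : 0 <= r -> cube c r z <-> `|z - c| <= r.
Proof.
move=> r0; split=> [h|h i]; first by apply: norm_le_coord => // i; rewrite !mxE.
by have := coord_le_norm (z - c) i; rewrite !mxE => /le_trans; apply.
Qed.

Lemma cube0P z r : 0 <= r -> cube 0 r z <-> `|z| <= r.
Proof. by move=> r0; rewrite cubeP// subr0. Qed.

Lemma coord_le_enorm z i : `|z ord0 i| <= enorm z.
Proof.
rewrite -sqrtr_sqr /enorm ler_wsqrtr// /dotv (bigD1 i)//= -expr2 lerDl.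
by apply: sumr_ge0 => j _; rewrite -expr2 sqr_ge0.
Qed.

Lemma enorm_ge0 z : 0 <= enorm z. Proof. exact: sqrtr_ge0. Qed.

Lemma norm_le_enorm z : `|z| <= enorm z.
Proof. by apply: norm_le_coord; [exact: enorm_ge0|move=> i; exact: coord_le_enorm]. Qed.

Lemma enorm_le_norm z : enorm z <= d%:R * `|z|.
Proof.
have h0 : 0 <= d%:R * `|z| by rewrite mulr_ge0.
rewrite -(ger0_norm h0) -sqrtr_sqr /enorm ler_wsqrtr//.
apply: (@le_trans _ _ (d%:R * `|z| ^+ 2)).
  have -> : d%:R * `|z| ^+ 2 = \sum_(i < d) `|z| ^+ 2 by rewrite sumr_const card_ord mulr_natl.
  apply: ler_sum => i _; rewrite -expr2 -real_normK ?num_real//.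
  by rewrite lerXn2r ?nnegrE// coord_le_norm.
rewrite exprMn ler_wpM2r ?sqr_ge0//.
by rewrite -natrX ler_nat; case: (d) => // n; rewrite expnS leq_pmulr.
Qed.

Lemma enorm0 : enorm (0 : 'rV[R]_d) = 0.
Proof.
by rewrite /enorm /dotv big1 ?sqrtr0// => i _; rewrite mxE mul0r.
Qed.

Lemma enorm_gt0 z : z != 0 -> 0 < enorm z.
Proof. by move=> z0; apply: lt_le_trans (norm_le_enorm z); rewrite normr_gt0. Qed.

Lemma measurable_enorm : measurable_fun setT (fun z : borelRV R d => enorm (z : 'rV[R]_d)).
Proof.
apply: (measurableT_comp (f := @Num.sqrt R)).
  by apply: continuous_measurable_fun; exact: sqrt_continuous.
by apply: measurable_sum => i; apply: measurable_funM; exact: measurable_coord.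
Qed.

End enorm.

(** * Powers of the norm integrated over dyadic shells *)

Section growth.
Variable R : realType.

Lemma nneseries_geometric_lty (C q : R) : 0 <= C -> 0 <= q -> q < 1 ->
  (\sum_(0 <= k <oo) (C * q ^+ k)%:E < +oo)%E.
Proof.
move=> C0 q0 q1.
apply: (@le_lt_trans _ _ (C / (1 - q))%:E); last exact: ltry.
apply: lime_le.
  by apply: is_cvg_nneseries => n _ _; rewrite lee_fin mulr_ge0// exprn_ge0.
apply: nearW => n; rewrite sumEFin lee_fin -mulr_sumr ler_wpM2l//.
rewrite -[leRHS]mul1r ler_pdivlMr ?subr_gt0//.
have -> : (\sum_(0 <= i < n) q ^+ i) * (1 - q) = 1 - q ^+ n.
  by rewrite -[1 - q ^+ n]opprB subrX1 -mulNr opprB mulrC big_mkord.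
by rewrite gerBl exprn_ge0.
Qed.

Lemma ge0_le_nneseries_term (u : nat -> \bar R) k :
  (forall n, 0 <= u n)%E -> (u k <= \sum_(0 <= n <oo) u n)%E.
Proof.
move=> u0; apply: le_trans (nneseries_lim_ge k.+1 _) => //.
by rewrite big_nat_recr//= leeDr// sume_ge0.
Qed.

Lemma powR_pow2 (x : R) k : (2 ^+ k) `^ x = (2 `^ x) ^+ k.
Proof.
elim: k => [|k IH]; first by rewrite !expr0 powR1.
by rewrite !exprS powRM ?exprn_ge0// IH.
Qed.

Lemma ltr_pow2 (x y : R) : (2 `^ x < 2 `^ y) = (x < y).
Proof. by rewrite /powR pnatr_eq0/= ltr_expR ltr_pM2r// ln_gt0// ltr1n. Qed.

Lemma exists_dyadic_shell (x : R) : 1 < x -> exists k, 2 ^+ k < x <= 2 ^+ k.+1.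
Proof.
move=> x1.
have ex : exists n, x <= 2 ^+ n.
  exists (Num.truncn x).+1; apply/ltW; apply: lt_le_trans (truncnS_gt _) _.
  by rewrite -natrX ler_nat ltnW// ltn_expl.
pose n := ex_minn ex.
have [] := ex_minnP ex; case=> [|m] xm min; first by rewrite expr0 leNgt x1 in xm.
exists m; rewrite xm andbT ltNge; apply/negP => /min.
by rewrite ltnn.
Qed.

Variable d : nat.
Local Notation T := (borelRV R d).

(** On the shell [2^k < |z| <= 2^(k+1)] the weight is at most [q^k] with [q = 2^-b], so the integral
    is dominated by a geometric series of ratio [A * q < 1]. *)
Lemma integral_shell_lty (f : T -> R) (C A b : R) :
  measurable_fun setT f -> (forall z, 0 <= f z) -> 0 <= b -> 0 <= C -> 0 <= A ->
  A < 2 `^ b ->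
  (forall k, \int[@lebRV R d]_(z in cube 0 (2 ^+ k)) (f z)%:E <= (C * A ^+ k)%:E)%E ->
  (\int[@lebRV R d]_(z in ~` cube 0 1) (f z * enorm (z : 'rV[R]_d) `^ (- b))%:E < +oo)%E.
Proof.
move=> mf f0 b0 C0 A0 Ab hf.
pose q : R := 2 `^ (- b).
have q0 : 0 <= q by exact: powR_ge0.
have Aq : A * q < 1 by rewrite /q powRN -ltr_pdivlMr ?invr_gt0 ?powR_gt0// invrK mul1r.
pose g k (z : T) : \bar R := ((q ^+ k * f z) * \1_(cube 0 (2 ^+ k.+1)) z)%:E.
have mg k : measurable_fun setT (g k).
  apply/measurable_EFinP; apply: measurable_funM; first exact: measurable_funM.
  by apply: measurable_indic; exact: measurable_cube.
have g0 k z : (0 <= g k z)%E by rewrite lee_fin !mulr_ge0 ?exprn_ge0.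
have mcube r : measurable (cube (0 : 'rV[R]_d) r) by exact: measurable_cube.
apply: (@le_lt_trans _ _ (\int[@lebRV R d]_z \sum_(0 <= k <oo) g k z)%E).
  rewrite integral_mkcond; apply: ge0_le_integral => //.
  - by move=> z _; apply: erestrict_ge0 => y _; rewrite lee_fin mulr_ge0// powR_ge0.
  - apply/measurable_restrict; [exact: measurableC|exact: measurableT|].
    rewrite setTI; apply: measurable_funTS; apply/measurable_EFinP.
    apply: measurable_funM => //.
    by apply: (measurableT_comp (measurable_powR _)); exact: measurable_enorm.
  - by apply: ge0_emeasurable_sum => // k _; exact: mg.
  move=> z _; rewrite patchE; case: ifPn => [|_]; last exact: nneseries_ge0.
  rewrite inE/= cube0P// => /negP; rewrite -ltNge => z1.
  have [k /andP[k1 k2]] := exists_dyadic_shell z1.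
  apply: le_trans (ge0_le_nneseries_term k _) => //.
  rewrite /g indicE mem_set; last by apply/cube0P => //; rewrite exprn_ge0.
  rewrite mulr1 lee_fin mulrC ler_wpM2r// /q -powR_pow2.
  rewrite !powRN lef_pV2 ?posrE ?powR_gt0 ?exprn_gt0//; last first.
    by apply: lt_le_trans (norm_le_enorm _); apply: le_lt_trans z1.
  rewrite ge0_ler_powR ?nnegrE ?exprn_ge0 ?enorm_ge0//.
  by apply: ltW; apply: lt_le_trans k1 (norm_le_enorm _).
rewrite integral_nneseries//.
apply: (@le_lt_trans _ _ (\sum_(0 <= k <oo) ((C * A) * (A * q) ^+ k)%:E)%E); last first.
  by apply: nneseries_geometric_lty => //; rewrite mulr_ge0.
apply: lee_nneseries => // k _; first by move=> _; exact: integral_ge0.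
have -> : (\int[@lebRV R d]_z g k z =
    (q ^+ k)%:E * \int[@lebRV R d]_(z in cube 0%R (2 ^+ k.+1)) (f z)%:E)%E.
  rewrite -ge0_integralZl_EFin ?exprn_ge0//; last 2 first.
  - by move=> z _; rewrite lee_fin.
  - by apply/measurable_EFinP; exact: measurable_funTS.
  rewrite [RHS]integral_mkcond; apply: eq_integral => z _.
  rewrite patchE /g indicE; case: (z \in _); last by rewrite mulr0.
  by rewrite mulr1.
apply: (@le_trans _ _ ((q ^+ k)%:E * (C * A ^+ k.+1)%:E)%E).
  by rewrite lee_wpmul2l// lee_fin exprn_ge0.
by rewrite -EFinM lee_fin exprMn exprS; rewrite le_eqVlt; apply/orP; left; apply/eqP; ring.
Qed.

Lemma integral_origin_lty (e : R) : (0 < d)%N -> 0 < e ->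
  (\int[@lebRV R d]_(z in cube 0%R 1%R) (enorm (z : 'rV[R]_d) `^ (e - d%:R))%:E < +oo)%E.
Proof.
move=> d0 e0.
have dR0 : 0 < d%:R :> R by rewrite ltr0n.
(* Since [e' < d], the power [e' - d] is largest at the inner radius of a shell; the excess power
   [e - e'] is bounded on the cube and goes into [c]. The maximum with 1 in [c] covers the origin,
   where the power is 1 if [e = d] and 0 otherwise. *)
pose e' := Num.min e (d%:R / 2).
have e'0 : 0 < e' by rewrite lt_min e0 divr_gt0.
have e'e : e' <= e by rewrite ge_min lexx.
have e'd : e' < d%:R by rewrite gt_min; apply/orP; right; lra.
pose c : R := Num.max 1 (d%:R `^ (e - e') * 2 `^ (d%:R - e')).
have c1 : 1 <= c by rewrite le_max lexx.
pose Q : R := 2 `^ (d%:R - e').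
have Q0 : 0 <= Q by exact: powR_ge0.
pose g k (z : T) : \bar R := ((c * Q ^+ k) * \1_(cube 0 (2^-1 ^+ k)) z)%:E.
have mcube r : measurable (cube (0 : 'rV[R]_d) r) by exact: measurable_cube.
have mg k : measurable_fun setT (g k).
  by apply/measurable_EFinP; apply: measurable_funM.
have c0 : 0 <= c by apply: le_trans c1.
have g0 k z : (0 <= g k z)%E by rewrite lee_fin !mulr_ge0 ?exprn_ge0.
apply: (@le_lt_trans _ _ (\int[@lebRV R d]_z \sum_(0 <= k <oo) g k z)%E).
  rewrite integral_mkcond; apply: ge0_le_integral => //.
  - by move=> z _; apply: erestrict_ge0 => y _; rewrite lee_fin powR_ge0.
  - apply/measurable_restrict; [by []|exact: measurableT|].
    rewrite setTI; apply: measurable_funTS; apply/measurable_EFinP.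
    by apply: (measurableT_comp (measurable_powR _)); exact: measurable_enorm.
  - by apply: ge0_emeasurable_sum => // k _; exact: mg.
  move=> z _; rewrite patchE; case: ifPn => [|_]; last exact: nneseries_ge0.
  rewrite inE/= cube0P// => z1.
  have [z0|z0] := eqVneq (z : 'rV[R]_d) 0.
    apply: le_trans (ge0_le_nneseries_term 0 _) => //.
    rewrite /g !expr0 mulr1 indicE mem_set; last by apply/cube0P.
    rewrite mulr1 lee_fin z0 enorm0; apply: le_trans c1.
    have [->|h] := eqVneq (e - d%:R) 0; first by rewrite powRr0.
    by rewrite powR0.
  have nz0 : 0 < `|z : 'rV[R]_d| by rewrite normr_gt0.
  have [k /andP[k1 k2]] : exists k, 2^-1 ^+ k.+1 <= `|z : 'rV[R]_d| <= 2^-1 ^+ k.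
    have := @exists_dyadic_shell (2 / `|z : 'rV[R]_d|).
    rewrite ltr_pdivlMr// mul1r => /(_ _)[]; first by lra.
    move=> k; rewrite ltr_pdivlMr// ler_pdivrMr// => /andP[h1 h2].
    case: k h1 h2 => [|k] h1 h2; [exists 0%N|exists k].
      by rewrite expr1 expr0 z1 andbT; move: h2; rewrite expr1; lra.
    rewrite !exprVn; apply/andP; split.
      rewrite -[leLHS]mul1r ler_pdivrMr ?exprn_gt0// mulrC.
      by move: h2; rewrite exprS -mulrA -[leLHS]mulr1 ler_pM2l.
    rewrite -[leRHS]mul1r ler_pdivlMr ?exprn_gt0// mulrC.
    by move: h1; rewrite exprS -mulrA -[ltRHS]mulr1 ltr_pM2l// => /ltW.
  apply: le_trans (ge0_le_nneseries_term k _) => //.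
  rewrite /g indicE mem_set; last by apply/cube0P => //; rewrite exprn_ge0.
  rewrite mulr1 lee_fin.
  have en0 : 0 < enorm (z : 'rV[R]_d) by exact: enorm_gt0.
  have -> : e - d%:R = (e - e') + - (d%:R - e') by ring.
  rewrite powRD; last by apply/implyP => _; rewrite gt_eqF.
  apply: (@le_trans _ _ (d%:R `^ (e - e') * (2 `^ (d%:R - e') * Q ^+ k))); last first.
    rewrite mulrA ler_wpM2r ?exprn_ge0//.
    by rewrite le_max lexx orbT.
  apply: ler_pM; rewrite ?powR_ge0//.
    rewrite ge0_ler_powR ?nnegrE ?subr_ge0 ?enorm_ge0//.
    by apply: le_trans (enorm_le_norm _) _; rewrite ler_piMr.
  rewrite -/Q -exprS /Q -powR_pow2 powRN -[leLHS]mul1r ler_pdivrMr ?powR_gt0//.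
  rewrite -powRM ?exprn_ge0 ?enorm_ge0// -[leLHS](congr1 (@^~ (d%:R - e')) (@powR1 R)).
  rewrite ge0_ler_powR ?nnegrE ?subr_ge0 ?mulr_ge0 ?enorm_ge0 ?exprn_ge0//; first exact: ltW.
  rewrite mulrC -ler_pdivrMr ?exprn_gt0// mul1r -exprVn.
  exact: le_trans k1 (norm_le_enorm _).
rewrite integral_nneseries//.
apply: (@le_lt_trans _ _ (\sum_(0 <= k <oo) ((c * 2 ^+ d) * (Q * 2^-1 ^+ d) ^+ k)%:E)%E); last first.
  apply: nneseries_geometric_lty; rewrite ?mulr_ge0 ?exprn_ge0//.
  rewrite exprVn ltr_pdivrMr ?exprn_gt0// mul1r /Q -powR_mulrn//.
  by rewrite ltr_pow2 //; lra.
apply: lee_nneseries => // k _; first by move=> _; exact: integral_ge0.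
rewrite /g; under eq_integral do rewrite EFinM.
rewrite ge0_integralZl_EFin ?mulr_ge0 ?exprn_ge0//; last first.
  by apply/measurable_EFinP; exact: measurable_indic.
have -> : (\int[@lebRV R d]_x (\1_(cube 0%R (2^-1 ^+ k)) x)%:E = ((2 * 2^-1 ^+ k) ^+ d)%:E)%E.
  by rewrite integral_indic// setIT; apply: lebRV_cube; rewrite exprn_ge0.
rewrite -EFinM lee_fin !exprMn -!exprM; rewrite le_eqVlt; apply/orP; left; apply/eqP.
rewrite [(k * d)%N]mulnC; ring.
Qed.

End growth.

Lemma le_powR (R : realType) (p x y : R) : 0 <= p -> 0 <= x -> x <= y -> x `^ p <= y `^ p.
Proof.
by move=> p0 x0 xy; rewrite ge0_ler_powR ?nnegrE//; apply: le_trans xy.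
Qed.

(** * Dependence of the spectrum on theta *)

Section finiteness.
Variables (R : realType) (d : nat).
Hypothesis d0 : (0 < d)%N.
Local Notation T := (borelRV R d).
Implicit Types (mu nu : {finite_measure set T -> \bar R}).

Definition Jfun mu (s theta : R) (z : T) : R :=
  nfourier mu z `^ (2 / theta) * enorm (z : 'rV[R]_d) `^ (s / theta - d%:R).

Lemma Jfun_ge0 mu s theta z : 0 <= Jfun mu s theta z.
Proof. by rewrite mulr_ge0 ?powR_ge0. Qed.

Lemma measurable_Jfun mu s theta : measurable_fun setT (Jfun mu s theta).
Proof.
apply: measurable_funM.
  by apply: (measurableT_comp (measurable_powR _)); exact: measurable_nfourier.
by apply: (measurableT_comp (measurable_powR _)); exact: measurable_enorm.
Qed.

Lemma fourier_energyE mu s theta : 0 < theta ->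
  (fourier_energy mu s theta < +oo)%E <->
  (\int[@lebRV R d]_z (Jfun mu s theta z)%:E < +oo)%E.
Proof.
move=> t0; rewrite /fourier_energy gt_eqF//.
rewrite -[integral _ _ _]/(\int[@lebRV R d]_z (Jfun mu s theta z)%:E)%E.
have : (0 <= \int[@lebRV R d]_z (Jfun mu s theta z)%:E)%E.
  by apply: integral_ge0 => z _; rewrite lee_fin Jfun_ge0.
case: (\int[_]_z _)%E => [x| |]// x0; split => //.
- by move=> _; exact: ltry.
- by move=> _; rewrite poweR_EFin ltry.
- by rewrite poweRyr ?gt_eqF.
Qed.

(** Near the origin there is nothing to fear: the transform is bounded by [2 * mass mu], and
    [|z|^(s / theta - d)] is locally integrable because [s > 0]. *)
Lemma Jfun_far mu s theta : 0 < theta -> 0 < s ->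
  (\int[@lebRV R d]_(z in ~` cube 0%R 1%R) (Jfun mu s theta z)%:E < +oo)%E ->
  (\int[@lebRV R d]_z (Jfun mu s theta z)%:E < +oo)%E.
Proof.
move=> t0 s0 far.
have mc : measurable (cube (0 : 'rV[R]_d) 1) by exact: measurable_cube.
rewrite -(setUv (cube (0 : 'rV[R]_d) 1)) ge0_integral_setU//.
- apply: lte_add_pinfty => //.
  pose K := (2 * mass mu) `^ (2 / theta).
  apply: (@le_lt_trans _ _ (K%:E * \int[@lebRV R d]_(z in cube 0%R 1%R)
      (enorm (z : 'rV[R]_d) `^ (s / theta - d%:R))%:E)%E).
    have me : measurable_fun (cube (0 : 'rV[R]_d) 1) (fun z : T => (enorm (z : 'rV[R]_d) `^ (s / theta - d%:R))%:E).
      apply: measurable_funTS; apply/measurable_EFinP.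
      by apply: (measurableT_comp (measurable_powR _)); exact: measurable_enorm.
    rewrite -ge0_integralZl_EFin ?powR_ge0//; last first.
      by move=> z _; rewrite lee_fin powR_ge0.
    apply: ge0_le_integral => //.
    - by move=> z _; rewrite lee_fin Jfun_ge0.
    - by apply: measurable_funTS; apply/measurable_EFinP; exact: measurable_Jfun.
    - exact: emeasurable_funM.
    move=> z _; rewrite -EFinM lee_fin ler_wpM2r ?powR_ge0//.
    apply: le_powR; [by rewrite divr_ge0 ?ltW|exact: nfourier_ge0|exact: nfourier_le_mass].
  apply: lte_mul_pinfty; rewrite ?lee_fin ?powR_ge0//.
  by apply: integral_origin_lty => //; rewrite divr_gt0.
- exact: measurableC.
- by rewrite setUv; apply/measurable_EFinP; exact: measurable_Jfun.
- by move=> z _; rewrite lee_fin Jfun_ge0.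
- by rewrite disj_set2E setICr.
Qed.

Lemma far_enorm_ge1 z : (~` cube (0 : 'rV[R]_d) 1) z -> 1 < `|z| /\ 1 < enorm z.
Proof.
move=> /= /(contra_not (cube0P z ler01).2) /negP; rewrite -ltNge => z1.
by split => //; apply: lt_le_trans z1 (norm_le_enorm _).
Qed.

Lemma integral_far_lty (e : R) : 0 < e ->
  (\int[@lebRV R d]_(z in ~` cube 0%R 1%R) (enorm (z : 'rV[R]_d) `^ (- (d%:R + e)))%:E < +oo)%E.
Proof.
move=> e0.
rewrite (_ : integral _ _ _ = \int[@lebRV R d]_(z in ~` cube 0%R 1%R) (cst 1 z * enorm (z : 'rV[R]_d) `^ (- (d%:R + e)))%:E)%E; last first.
  by apply: eq_integral => z _; rewrite mul1r.
apply: (@integral_shell_lty R d (cst 1) (2 ^+ d) (2 ^+ d)) => //.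
- by rewrite addr_ge0// ltW.
- by rewrite -powR_mulrn// ltr_pow2; lra.
move=> k.
have -> : (\int[@lebRV R d]_(z in cube 0%R (2 ^+ k)%R) (cst 1 z)%:E = ((2 * 2 ^+ k) ^+ d)%:E)%E.
  rewrite (_ : integral _ _ _ = \int[@lebRV R d]_(z in cube 0%R (2 ^+ k)%R) cst 1%E z)%E//.
  rewrite integral_cst; last exact: measurable_cube.
  by rewrite mul1e; apply: lebRV_cube; rewrite exprn_ge0.
by rewrite lee_fin exprMn -!exprM mulnC.
Qed.

Lemma far_le_lty (f g : T -> R) : measurable_fun setT f -> measurable_fun setT g ->
  (forall z, 0 <= f z) -> (forall z, (~` cube (0 : 'rV[R]_d) 1) z -> f z <= g z) ->
  (\int[@lebRV R d]_(z in ~` cube 0%R 1%R) (g z)%:E < +oo)%E ->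
  (\int[@lebRV R d]_(z in ~` cube 0%R 1%R) (f z)%:E < +oo)%E.
Proof.
move=> mf mg f0 fg; apply: le_lt_trans.
have mc : measurable (~` cube (0 : 'rV[R]_d) 1).
  by apply: measurableC; exact: measurable_cube.
apply: ge0_le_integral => //.
- by move=> z _; rewrite lee_fin.
- by apply: measurable_funTS; exact/measurable_EFinP.
- by apply: measurable_funTS; exact/measurable_EFinP.
Qed.

Lemma measurable_enorm_pow a : measurable_fun setT (fun z : T => enorm (z : 'rV[R]_d) `^ a).
Proof. by apply: (measurableT_comp (measurable_powR _)); exact: measurable_enorm. Qed.

Lemma Jfun_mono_theta mu s s' th th' : 0 < th -> th < th' -> 0 < s' -> s' < s ->
  (\int[@lebRV R d]_z (Jfun mu s th z)%:E < +oo)%E ->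
  (\int[@lebRV R d]_z (Jfun mu s' th' z)%:E < +oo)%E.
Proof.
move=> t0 tt s0 ss J.
have t'0 : 0 < th' by apply: lt_trans tt.
apply: Jfun_far; [exact: t'0|exact: s0|].
pose e := (s - s') / th'.
have e0 : 0 < e by rewrite divr_gt0// subr_gt0.
apply: (@far_le_lty _ (fun z => Jfun mu s th z + enorm (z : 'rV[R]_d) `^ (- (d%:R + e)))).
- exact: measurable_Jfun.
- by apply: measurable_funD; [exact: measurable_Jfun|exact: measurable_enorm_pow].
- exact: Jfun_ge0.
- move=> z /far_enorm_ge1[_ z1].
  have n0 : 0 <= nfourier mu z by exact: nfourier_ge0.
  rewrite /Jfun; set E := enorm _ in z1 *; set N := nfourier mu z in n0 *.
  have E0 : 0 < E by apply: lt_trans z1.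
  have E00 : E != 0 by rewrite gt_eqF.
  pose A := N `^ (2 / th') * E `^ (s / th').
  have A0 : 0 <= A by rewrite mulr_ge0 ?powR_ge0.
  have -> : N `^ (2 / th') * E `^ (s' / th' - d%:R) = A * E `^ (- (d%:R + e)).
    rewrite /A -mulrA -powRD ?E00 ?implybT//; congr (_ * _ `^ _).
    by rewrite /e; field; rewrite gt_eqF.
  have -> : N `^ (2 / th) * E `^ (s / th - d%:R) = A `^ (th' / th) * E `^ (- d%:R).
    rewrite /A powRM ?powR_ge0// -!powRrM -mulrA -powRD ?E00 ?implybT//.
    by congr (_ `^ _ * _ `^ _); field; rewrite !gt_eqF.
  have [A1|A1] := leP A 1.
    apply: (@le_trans _ _ (1 * E `^ (- (d%:R + e)))); first by rewrite ler_wpM2r ?powR_ge0.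
    by rewrite mul1r lerDr mulr_ge0 ?powR_ge0.
  apply: (@le_trans _ _ (A `^ (th' / th) * E `^ (- d%:R))); last by rewrite lerDl powR_ge0.
  apply: ler_pM; rewrite ?powR_ge0//.
    by apply: le1r_powR; [exact: ltW|rewrite ler_pdivlMr// mul1r ltW].
  by apply: ler_powR; [exact: ltW|lra].
- have mc : measurable (~` cube (0 : 'rV[R]_d) 1).
    by apply: measurableC; exact: measurable_cube.
  under eq_integral do rewrite EFinD.
  rewrite ge0_integralD//.
  + apply: lte_add_pinfty; last exact: integral_far_lty.
    apply: le_lt_trans J; apply: ge0_subset_integral => //.
    * by apply/measurable_EFinP; exact: measurable_Jfun.
    * by move=> z _; rewrite lee_fin Jfun_ge0.
  + by move=> z _; rewrite lee_fin Jfun_ge0.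
  + by apply: measurable_funTS; apply/measurable_EFinP; exact: measurable_Jfun.
  + by move=> z _; rewrite lee_fin powR_ge0.
  + by apply: measurable_funTS; apply/measurable_EFinP; exact: measurable_enorm_pow.
Qed.

Lemma Jfun_mono_s mu s s' th : 0 < th -> 0 < s' -> s' <= s ->
  (\int[@lebRV R d]_z (Jfun mu s th z)%:E < +oo)%E ->
  (\int[@lebRV R d]_z (Jfun mu s' th z)%:E < +oo)%E.
Proof.
move=> t0 s0 ss J; apply: Jfun_far; [exact: t0|exact: s0|].
have mc : measurable (~` cube (0 : 'rV[R]_d) 1).
  by apply: measurableC; exact: measurable_cube.
apply: (@far_le_lty _ (Jfun mu s th)).
- exact: measurable_Jfun.
- exact: measurable_Jfun.
- exact: Jfun_ge0.
- move=> z /far_enorm_ge1[_ z1]; rewrite ler_wpM2l ?powR_ge0//.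
  rewrite ler_powR; [by []|exact: ltW|].
  by rewrite lerD2r ler_pM2r ?invr_gt0.
- apply: le_lt_trans J; apply: ge0_subset_integral => //.
  + by apply/measurable_EFinP; exact: measurable_Jfun.
  + by move=> z _; rewrite lee_fin Jfun_ge0.
Qed.

(** The passage from [theta = 0], where finiteness is pointwise decay, to positive values: the
    surplus [s - s'] makes the remaining power of [|z|] integrable at infinity. *)
Lemma Jfun_decay mu s s' K th : 0 < th -> 0 < s' -> s' < s -> 0 <= K ->
  (forall z : 'rV[R]_d, nfourier mu z ^+ 2 * enorm z `^ s <= K) ->
  (\int[@lebRV R d]_z (Jfun mu s' th z)%:E < +oo)%E.
Proof.
move=> t0 s0 ss K0 dec; apply: Jfun_far => //.
pose e := (s - s') / th.
have e0 : 0 < e by rewrite divr_gt0// subr_gt0.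
have mc : measurable (~` cube (0 : 'rV[R]_d) 1).
  by apply: measurableC; exact: measurable_cube.
apply: (@far_le_lty _ (fun z => K `^ th^-1 * enorm (z : 'rV[R]_d) `^ (- (d%:R + e)))).
- exact: measurable_Jfun.
- by apply: measurable_funM => //; exact: measurable_enorm_pow.
- exact: Jfun_ge0.
- move=> z /far_enorm_ge1[_ z1].
  have n0 : 0 <= nfourier mu z by exact: nfourier_ge0.
  have := dec z; rewrite /Jfun; set E := enorm _ in z1 *; set N := nfourier mu z in n0 *.
  have E0 : 0 < E by apply: lt_trans z1.
  have E00 : E != 0 by rewrite gt_eqF.
  move=> NK.
  have -> : N `^ (2 / th) * E `^ (s' / th - d%:R) =
      (N ^+ 2 * E `^ s) `^ th^-1 * E `^ (- (d%:R + e)).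
    rewrite powRM ?powR_ge0 ?sqr_ge0// -powR_mulrn// -!powRrM -mulrA -powRD ?E00 ?implybT//.
    by congr (_ `^ _ * _ `^ _); rewrite /e; field; rewrite gt_eqF.
  apply: ler_wpM2r; first exact: powR_ge0.
  apply: le_powR => //; first by rewrite invr_ge0 ltW.
  by rewrite mulr_ge0 ?powR_ge0 ?sqr_ge0.
under eq_integral do rewrite EFinM.
rewrite ge0_integralZl_EFin ?powR_ge0//.
- apply: lte_mul_pinfty; rewrite ?lee_fin ?powR_ge0//; exact: integral_far_lty.
- by move=> z _; rewrite lee_fin powR_ge0.
- by apply: measurable_funTS; apply/measurable_EFinP; exact: measurable_enorm_pow.
Qed.

End finiteness.

(** * Averages of transforms over small cubes *)

Section averaging.
Variables (R : realType) (d : nat).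
Hypothesis d0 : (0 < d)%N.
Local Notation T := (borelRV R d).
Implicit Types (mu nu : {finite_measure set T -> \bar R}).

Lemma tridC r (z w : T) : trid r (z : 'rV[R]_d) w = trid r (w : 'rV[R]_d) z.
Proof. by apply: eq_bigr => i _; rewrite /tri distrC. Qed.

Lemma measurable_trid2 r : measurable_fun setT (fun p : T * T => trid r (p.1 : 'rV[R]_d) p.2).
Proof.
have -> : (fun p : T * T => trid r (p.1 : 'rV[R]_d) p.2) =
    (fun p => \prod_(i < d) tri r 0 (subpair p ord0 i)).
  apply/funext => p; apply: eq_bigr => i _.
  by rewrite /tri subr0 /subpair !mxE distrC.
apply: measurable_prod => i _; apply: measurableT_comp; first exact: measurable_tri.
exact: measurable_subpair.
Qed.

Lemma trid_near r (z w : T) : 2 <= r -> 0 < trid r (z : 'rV[R]_d) w ->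
  `|(w : 'rV[R]_d) - (z : 'rV[R]_d)| <= 2^-1.
Proof.
move=> r2 t0; apply: norm_le_coord => // i; rewrite !mxE leNgt; apply/negP => h.
move: t0; suff -> : trid r (z : 'rV[R]_d) w = 0 by rewrite ltxx.
apply/eqP; rewrite /trid prodf_seq_eq0; apply/hasP; exists i; first exact: mem_index_enum.
apply/eqP; rewrite /= /tri max_l// subr_le0.
set x := `|_| in h *.
have : r * 2^-1 <= r * x by rewrite ler_wpM2l ?(ltW h)//; lra.
lra.
Qed.

(* [f <= c + f^p c^(1-p)], integrated at half the average of [f], replaces Jensen's inequality. *)
Lemma trid_jensen r (z : 'rV[R]_d) (f : T -> R) (p A X : R) : 0 < r -> 1 <= p ->
  measurable_fun setT f -> (forall w, 0 <= f w) ->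
  (\int[@lebRV R d]_w (trid r z w * f w)%:E = A%:E)%E ->
  (\int[@lebRV R d]_w (trid r z w * f w `^ p)%:E <= X%:E)%E ->
  (A / 2) `^ p <= (r^-1 ^+ d) `^ (p - 1) * X.
Proof.
move=> r0 p1 mf f0 fA fX.
set m := r^-1 ^+ d.
have m0 : 0 < m by rewrite exprn_gt0// invr_gt0.
have mt : measurable_fun setT (fun w : T => trid r z w) by exact: measurable_trid.
have mfp : measurable_fun setT (fun w => f w `^ p).
  by apply: (measurableT_comp (measurable_powR _)).
have A0 : 0 <= A.
  by rewrite -lee_fin -fA; apply: integral_ge0 => w _; rewrite lee_fin mulr_ge0// trid_ge0.
have X0 : 0 <= X.
  rewrite -lee_fin; apply: le_trans fX; apply: integral_ge0 => w _.
  by rewrite lee_fin mulr_ge0 ?trid_ge0 ?powR_ge0.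
move: A0; rewrite le_eqVlt => /predU1P[<-|A0].
  by rewrite mul0r powR0 ?gt_eqF//; [rewrite mulr_ge0 ?powR_ge0|lra].
pose c := A / 2 / m.
have c0 : 0 < c by rewrite !divr_gt0.
have key w : f w <= c + f w `^ p * c `^ (1 - p).
  have [fc|fc] := leP (f w) c.
    by apply: le_trans fc _; rewrite lerDl mulr_ge0 ?powR_ge0.
  apply: (@le_trans _ _ (f w `^ p * c `^ (1 - p))); last by rewrite lerDr ltW.
  have fw0 : 0 < f w by apply: lt_trans fc.
  rewrite -[leLHS]powRr1 ?(ltW fw0)//; have {1}-> : 1 = p + (1 - p) by ring.
  rewrite powRD; last by rewrite (gt_eqF fw0) implybT.
  apply: ler_wpM2l; first exact: powR_ge0.
  have -> : 1 - p = - (p - 1) by ring.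
  rewrite !powRN lef_pV2 ?posrE ?powR_gt0//.
  by apply: le_powR; [lra|exact: ltW|exact: ltW].
have : (A%:E <= (m * c + c `^ (1 - p) * X)%:E)%E.
  rewrite -fA.
  apply: (@le_trans _ _ (\int[@lebRV R d]_w (c%:E * (trid r z w)%:E + (c `^ (1 - p))%:E * (trid r z w * f w `^ p)%:E))%E).
    apply: ge0_le_integral => //.
    - by move=> w _; rewrite lee_fin mulr_ge0// trid_ge0.
    - by apply/measurable_EFinP; exact: measurable_funM.
    - by apply: emeasurable_funD; apply: emeasurable_funM => //; apply/measurable_EFinP => //; exact: measurable_funM.
    move=> w _; rewrite -!EFinM -EFinD lee_fin.
    have -> : c * trid r z w + c `^ (1 - p) * (trid r z w * f w `^ p) =
       trid r z w * (c + f w `^ p * c `^ (1 - p)) by ring.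
    by rewrite ler_wpM2l// trid_ge0.
  rewrite ge0_integralD//.
  - rewrite EFinD; apply: leeD.
      rewrite ge0_integralZl_EFin ?(ltW c0)//.
      + by rewrite integral_trid// -EFinM mulrC.
      + by move=> w _; rewrite lee_fin trid_ge0.
      + exact/measurable_EFinP.
    rewrite ge0_integralZl_EFin ?powR_ge0//.
    + by rewrite EFinM lee_wpmul2l// lee_fin powR_ge0.
    + by move=> w _; rewrite lee_fin mulr_ge0 ?trid_ge0 ?powR_ge0.
    + by apply/measurable_EFinP; exact: measurable_funM.
  - by move=> w _; rewrite -EFinM lee_fin mulr_ge0 ?trid_ge0 ?ltW.
  - by apply: emeasurable_funM => //; exact/measurable_EFinP.
  - by move=> w _; rewrite -EFinM lee_fin !mulr_ge0 ?trid_ge0 ?powR_ge0.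
  - by apply: emeasurable_funM => //; apply/measurable_EFinP; exact: measurable_funM.
rewrite lee_fin => h.
have h2 : A / 2 <= c `^ (1 - p) * X.
  have : m * c = A / 2 by rewrite /c; field; rewrite gt_eqF.
  lra.
have A20 : 0 < A / 2 by rewrite divr_gt0.
have -> : (A / 2) `^ p = m `^ (p - 1) * (A / 2 * c `^ (p - 1)).
  rewrite {2}(_ : A / 2 = (A / 2) `^ 1); last by rewrite powRr1// ltW.
  rewrite mulrCA -powRM ?(ltW m0) ?(ltW c0)// (_ : m * c = A / 2); last first.
    by rewrite /c; field; rewrite gt_eqF.
  rewrite -powRD; last by rewrite (gt_eqF A20) implybT.
  by congr (_ `^ _); ring.
apply: ler_wpM2l; first exact: powR_ge0.
rewrite (_ : c `^ (p - 1) = (c `^ (1 - p))^-1); last by rewrite -powRN opprB.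
by rewrite ler_pdivrMr ?powR_gt0// [X * _]mulrC.
Qed.

Lemma powR_ratio (D x y a : R) : 1 <= D -> 0 < x -> 0 < y -> x <= D * y -> y <= D * x ->
  x `^ a <= D `^ `|a| * y `^ a.
Proof.
move=> D1 x0 y0 xy yx; have D0 : 0 <= D by lra.
have [a0|a0] := leP 0 a.
  rewrite ger0_norm// -powRM ?(ltW y0)//.
  by apply: le_powR => //; exact: ltW.
have [b b0 ->] : exists2 b, 0 <= b & a = - b by exists (- a); [lra|rewrite opprK].
rewrite normrN ger0_norm// [x `^ _]powRN [y `^ _]powRN.
rewrite ler_pdivlMr ?powR_gt0// mulrC ler_pdivrMr ?powR_gt0//.
rewrite -powRM ?(ltW x0)//.
by apply: le_powR => //; exact: ltW.
Qed.

(** Where the weight is positive, [|w - z| <= 1 / 2 < |z| / 2], so the sup norms of [z] and [w]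
    agree up to a factor 2; passing to Euclidean norms costs a factor [d]. *)
Lemma trid_enorm_ratio r (z w : T) a : 2 <= r -> 1 < `|z : 'rV[R]_d| ->
  trid r (z : 'rV[R]_d) w * enorm (z : 'rV[R]_d) `^ a <=
  (2 * d%:R) `^ `|a| * (trid r (z : 'rV[R]_d) w * enorm (w : 'rV[R]_d) `^ a).
Proof.
move=> r2 z1.
have := trid_ge0 r (z : 'rV[R]_d) w; rewrite le_eqVlt => /predU1P[<-|t0].
  by rewrite !mul0r mulr0.
rewrite mulrCA ler_wpM2l ?(ltW t0)//.
have zw := trid_near r2 t0.
have d1 : 1 <= d%:R :> R by rewrite ler1n.
have dR : 0 <= d%:R :> R by [].
have wz : `|z : 'rV[R]_d| <= 2 * `|w : 'rV[R]_d|.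
  have : `|z : 'rV[R]_d| <= `|(w : 'rV[R]_d) - (z : 'rV[R]_d)| + `|w : 'rV[R]_d|.
    by have := ler_distD (w : 'rV[R]_d) (z : 'rV[R]_d) 0; rewrite !subr0 distrC.
  lra.
have zw' : `|w : 'rV[R]_d| <= 2 * `|z : 'rV[R]_d|.
  have : `|w : 'rV[R]_d| <= `|(w : 'rV[R]_d) - (z : 'rV[R]_d)| + `|z : 'rV[R]_d|.
    by have := ler_distD (z : 'rV[R]_d) (w : 'rV[R]_d) 0; rewrite !subr0.
  lra.
have ez : 0 < enorm (z : 'rV[R]_d) by apply: lt_le_trans (norm_le_enorm _); lra.
have ew : 0 < enorm (w : 'rV[R]_d) by apply: lt_le_trans (norm_le_enorm _); lra.
apply: powR_ratio => //; first lra.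
- apply: le_trans (enorm_le_norm _) _; rewrite [2 * _]mulrC -mulrA ler_wpM2l//.
  by apply: le_trans wz _; rewrite ler_wpM2l// norm_le_enorm.
- apply: le_trans (enorm_le_norm _) _; rewrite [2 * _]mulrC -mulrA ler_wpM2l//.
  by apply: le_trans zw' _; rewrite ler_wpM2l// norm_le_enorm.
Qed.

Lemma nfourier_le2mass_trid r mu z : 0 < r ->
  (\int[@lebRV R d]_w (trid r z w * nfourier mu w)%:E < +oo)%E.
Proof.
move=> r0.
apply: (@le_lt_trans _ _ (\int[@lebRV R d]_w ((2 * mass mu)%:E * (trid r z w)%:E))%E).
  apply: ge0_le_integral => //.
  - by move=> w _; rewrite lee_fin mulr_ge0 ?trid_ge0 ?nfourier_ge0.
  - apply/measurable_EFinP; apply: measurable_funM; first exact: measurable_trid.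
    exact: measurable_nfourier.
  - by apply: emeasurable_funM => //; apply/measurable_EFinP; exact: measurable_trid.
  move=> w _; rewrite -EFinM lee_fin mulrC ler_wpM2r ?trid_ge0//.
  exact: nfourier_le_mass.
rewrite ge0_integralZl_EFin ?mulr_ge0 ?mass_ge0//.
- by rewrite integral_trid// ltry.
- by move=> w _; rewrite lee_fin trid_ge0.
- by apply/measurable_EFinP; exact: measurable_trid.
Qed.

Section averaged.
Variables (mu : {finite_measure set T -> \bar R}) (r t th' : R).
Hypotheses (r2 : 2 <= r) (th'0 : 0 < th') (th'1 : th' <= 1).
Hypothesis J : (\int[@lebRV R d]_z (Jfun mu t th' z)%:E < +oo)%E.

Definition Javg (z : T) : \bar R :=
  (\int[@lebRV R d]_w (trid r (z : 'rV[R]_d) w * Jfun mu t th' w)%:E)%E.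

Let r0 : 0 < r. Proof. by apply: lt_le_trans r2. Qed.

Let mJ := measurable_Jfun mu t th'.

Lemma Javg_ge0 z : (0 <= Javg z)%E.
Proof.
by apply: integral_ge0 => w _; rewrite lee_fin mulr_ge0 ?trid_ge0 ?Jfun_ge0.
Qed.

Lemma Javg_le z : (Javg z <= \int[@lebRV R d]_z (Jfun mu t th' z)%:E)%E.
Proof.
apply: ge0_le_integral => //.
- by move=> w _; rewrite lee_fin mulr_ge0 ?trid_ge0 ?Jfun_ge0.
- by apply/measurable_EFinP; apply: measurable_funM => //; exact: measurable_trid.
- exact/measurable_EFinP.
move=> w _; rewrite lee_fin ler_piMl ?Jfun_ge0//.
by apply: trid_le1; exact: ltW.
Qed.

Lemma Javg_fin z : Javg z \is a fin_num.
Proof. by rewrite ge0_fin_numE ?Javg_ge0//; apply: le_lt_trans (Javg_le z) J. Qed.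

Let mtJ : measurable_fun setT
  (fun p : T * T => (trid r (p.1 : 'rV[R]_d) p.2 * Jfun mu t th' p.2)%:E).
Proof.
apply/measurable_EFinP; apply: measurable_funM; first exact: measurable_trid2.
exact: (measurableT_comp mJ measurable_snd).
Qed.

Let tJ0 (p : T * T) : (0 <= (trid r (p.1 : 'rV[R]_d) p.2 * Jfun mu t th' p.2)%:E)%E.
Proof. by rewrite lee_fin mulr_ge0 ?trid_ge0 ?Jfun_ge0. Qed.

Lemma measurable_Javg : measurable_fun setT Javg.
Proof. exact: (@measurable_fun_fubini_tonelli_F _ _ T T R (@lebRV R d) _ mtJ tJ0). Qed.

(** [trid] is symmetric in its centre and its argument, so after Tonelli the weight is integrated
    first and gives [r^-1 ^+ d]. *)
Lemma integral_Javg :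
  (\int[@lebRV R d]_z Javg z = (r^-1 ^+ d)%:E * \int[@lebRV R d]_z (Jfun mu t th' z)%:E)%E.
Proof.
rewrite -[LHS]/(\int[@lebRV R d]_z \int[@lebRV R d]_w
  (fun p : T * T => (trid r (p.1 : 'rV[R]_d) p.2 * Jfun mu t th' p.2)%:E) (z, w))%E.
rewrite (@sfinite_Fubini _ _ _ _ _ (@lebRV R d) (@lebRV R d) _ tJ0 mtJ)/=.
rewrite -ge0_integralZl_EFin ?exprn_ge0 ?invr_ge0 ?(ltW r0)//; last 2 first.
- by move=> z _; rewrite lee_fin Jfun_ge0.
- exact/measurable_EFinP.
apply: eq_integral => w _.
transitivity (\int[@lebRV R d]_z ((Jfun mu t th' w)%:E * (trid r (w : 'rV[R]_d) z)%:E))%E.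
  by apply: eq_integral => z _; rewrite tridC -EFinM mulrC.
rewrite ge0_integralZl_EFin ?Jfun_ge0//.
- by rewrite integral_trid// muleC.
- by move=> z _; rewrite lee_fin trid_ge0.
- by apply/measurable_EFinP; exact: measurable_trid.
Qed.

Variables (phiK : forall x : T, 0 <= ktrid r (x : 'rV[R]_d) <= r^-1 ^+ d)
  (mphi : measurable_fun setT (fun x : T => ktrid r (x : 'rV[R]_d))).
Local Notation nu := (mden mu mphi phiK).
Local Notation a := (t / th' - d%:R).

(** [nfourier_mden] bounds the left transform by twice an average [A] of that of [mu]; [trid_jensen]
    applies with [p = 2 / th'], which is at least 1 because [th' <= 1]; [trid_enorm_ratio] then
    trades the weight at [w] for the weight at [z]. The 4 in [K] comes from [2 A = 4 (A / 2)]. *)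
Lemma nfourier_averaged : exists2 K, 0 <= K & forall z : T, 1 < `|z : 'rV[R]_d| ->
  nfourier nu z `^ (2 / th') <= K * enorm (z : 'rV[R]_d) `^ (- a) * fine (Javg z).
Proof.
pose p := 2 / th'.
have p1 : 1 <= p by rewrite ler_pdivlMr// mul1r; apply: le_trans th'1 _; rewrite ler1n.
have p0 : 0 <= p by lra.
pose m := r^-1 ^+ d.
have m0 : 0 <= m by rewrite exprn_ge0// invr_ge0 ltW.
pose K := 4 `^ p * (m `^ (p - 1) * (2 * d%:R) `^ `|a|).
exists K; first by rewrite !mulr_ge0 ?powR_ge0.
move=> z z1.
have ez : 0 < enorm (z : 'rV[R]_d) by apply: lt_le_trans (norm_le_enorm _); lra.
have mn : measurable_fun setT (fun w : T => nfourier mu w) by exact: measurable_nfourier.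
have [A AE] : exists A, (\int[@lebRV R d]_w (trid r (z : 'rV[R]_d) w * nfourier mu w)%:E = A%:E)%E.
  exists (fine (\int[@lebRV R d]_w (trid r (z : 'rV[R]_d) w * nfourier mu w)%:E)%E).
  rewrite fineK// ge0_fin_numE; first exact: nfourier_le2mass_trid.
  by apply: integral_ge0 => w _; rewrite lee_fin mulr_ge0 ?trid_ge0 ?nfourier_ge0.
have A0 : 0 <= A.
  by rewrite -lee_fin -AE; apply: integral_ge0 => w _; rewrite lee_fin mulr_ge0 ?trid_ge0 ?nfourier_ge0.
have nA : nfourier nu z <= 2 * A.
  by rewrite -lee_fin EFinM -AE; exact: nfourier_mden.
pose X := (2 * d%:R) `^ `|a| * enorm (z : 'rV[R]_d) `^ (- a) * fine (Javg z).
have fX : (\int[@lebRV R d]_w (trid r (z : 'rV[R]_d) w * nfourier mu w `^ p)%:E <= X%:E)%E.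
  rewrite /X EFinM fineK ?Javg_fin// /Javg.
  rewrite -ge0_integralZl_EFin ?mulr_ge0 ?powR_ge0//; last 2 first.
  - by move=> w _; rewrite lee_fin mulr_ge0 ?trid_ge0 ?Jfun_ge0.
  - by apply/measurable_EFinP; apply: measurable_funM => //; exact: measurable_trid.
  apply: ge0_le_integral => //.
  - by move=> w _; rewrite lee_fin mulr_ge0 ?trid_ge0 ?powR_ge0.
  - apply/measurable_EFinP; apply: measurable_funM; first exact: measurable_trid.
    exact: (measurableT_comp (measurable_powR _) mn).
  - apply: emeasurable_funM => //; apply/measurable_EFinP; apply: measurable_funM => //.
    exact: measurable_trid.
  move=> w _; rewrite -EFinM lee_fin /Jfun -/p.
  have := @trid_enorm_ratio r z w a r2 z1.
  rewrite powRN; set E := enorm (z : 'rV[R]_d) `^ a; set D := (2 * _) `^ _.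
  set t1 := trid _ _ _; set W := enorm _ `^ _; set N := _ `^ p.
  have E0 : 0 < E by rewrite powR_gt0.
  have N0 : 0 <= N by exact: powR_ge0.
  move=> h; have -> : D / E * (t1 * (N * W)) = (D * (t1 * W)) * N / E by field; rewrite gt_eqF.
  by rewrite ler_pdivlMr; [rewrite mulrAC; exact: ler_wpM2r|exact: E0].
have := trid_jensen r0 p1 mn (nfourier_ge0 mu) AE fX.
rewrite -/m -/p => h.
apply: (@le_trans _ _ ((4 * (A / 2)) `^ p)).
  apply: le_powR => //; first exact: nfourier_ge0.
  by apply: le_trans nA _; lra.
rewrite powRM ?divr_ge0// /K -!mulrA ler_wpM2l ?powR_ge0//.
by apply: le_trans h _; rewrite /X !mulrA.
Qed.

(** [Javg] never exceeds the total integral, so the power [th'] of [nfourier_averaged] is a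
    pointwise decay for [|z| > 1]; closer to the origin the trivial bound suffices. *)
Lemma averaged_decay : 0 <= t - d%:R * th' ->
  exists2 K, 0 <= K & forall z : 'rV[R]_d,
    nfourier nu z ^+ 2 * enorm z `^ (t - d%:R * th') <= K.
Proof.
move=> s0; have [K K0 hK] := nfourier_averaged.
pose Jr := fine (\int[@lebRV R d]_z (Jfun mu t th' z)%:E)%E.
have J0 : (0 <= \int[@lebRV R d]_z (Jfun mu t th' z)%:E)%E.
  by apply: integral_ge0 => w _; rewrite lee_fin Jfun_ge0.
have Jr0 : 0 <= Jr by rewrite fine_ge0.
have GJ z : fine (Javg z) <= Jr.
  by rewrite fine_le ?Javg_fin ?Javg_le// ge0_fin_numE.
have KJ0 : 0 <= K * Jr by rewrite mulr_ge0.
pose B := (2 * mass nu) ^+ 2 * d%:R `^ (t - d%:R * th').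
have B0 : 0 <= B by rewrite mulr_ge0 ?powR_ge0 ?sqr_ge0.
exists (B + (K * Jr) `^ th'); first by rewrite addr_ge0 ?powR_ge0.
move=> z; have [z1|z1] := leP `|z| 1.
  apply: (@le_trans _ _ B); last by rewrite lerDl powR_ge0.
  apply: ler_pM; rewrite ?sqr_ge0 ?powR_ge0//.
    by rewrite lerXn2r ?nnegrE ?mulr_ge0 ?mass_ge0 ?nfourier_ge0 ?nfourier_le_mass.
  apply: le_powR => //; first exact: enorm_ge0.
  by apply: le_trans (enorm_le_norm _) _; rewrite ler_piMr.
apply: (@le_trans _ _ ((K * Jr) `^ th')); last by rewrite lerDr.
have ez : 0 < enorm z by apply: lt_le_trans (norm_le_enorm _); lra.
have N0 := nfourier_ge0 nu z.
have -> : nfourier nu z ^+ 2 * enorm z `^ (t - d%:R * th') =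
    (nfourier nu z `^ (2 / th') * enorm z `^ a) `^ th'.
  rewrite powRM ?powR_ge0// -!powRrM -powR_mulrn//.
  by congr (_ `^ _ * _ `^ _); field; rewrite gt_eqF.
apply: le_powR; [exact: ltW|by rewrite mulr_ge0 ?powR_ge0|].
have ea : 0 < enorm z `^ a by rewrite powR_gt0.
apply: (@le_trans _ _ (K * enorm z `^ (- a) * fine (Javg z) * enorm z `^ a)).
  by rewrite ler_wpM2r ?(ltW ea)//; exact: hK.
rewrite powRN (_ : _ * _ = K * fine (Javg z)); first by rewrite ler_wpM2l.
by field; rewrite gt_eqF.
Qed.

(** The power [q = th' / th] of [nfourier_averaged] contains [Javg^q]: one factor is kept for its
    integrability, the other [q - 1] are bounded by the total integral. The exponent
    [t - d (th' - th)] is the one for which the powers of [|z|] cancel exactly. *)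
Lemma averaged_energy th : 0 < th -> th < th' -> 0 < t - d%:R * (th' - th) ->
  (\int[@lebRV R d]_z (Jfun nu (t - d%:R * (th' - th)) th z)%:E < +oo)%E.
Proof.
move=> th0 tt s0; apply: Jfun_far; [exact: d0|exact: th0|exact: s0|].
have [K K0 hK] := nfourier_averaged.
pose Jr := fine (\int[@lebRV R d]_z (Jfun mu t th' z)%:E)%E.
have J0 : (0 <= \int[@lebRV R d]_z (Jfun mu t th' z)%:E)%E.
  by apply: integral_ge0 => w _; rewrite lee_fin Jfun_ge0.
have Jr0 : 0 <= Jr by rewrite fine_ge0.
have GJ z : fine (Javg z) <= Jr.
  by rewrite fine_le ?Javg_fin ?Javg_le// ge0_fin_numE.
have G0 z : 0 <= fine (Javg z) by rewrite fine_ge0// Javg_ge0.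
pose q := th' / th.
have q1 : 1 <= q by rewrite ler_pdivlMr// mul1r ltW.
pose K' := K `^ q * Jr `^ (q - 1).
have K'0 : 0 <= K' by rewrite mulr_ge0 ?powR_ge0.
have mG : measurable_fun setT (fun z => fine (Javg z)).
  by apply: measurableT_comp => //; exact: measurable_Javg.
apply: (@far_le_lty _ _ _ (fun z => K' * fine (Javg z))).
- exact: measurable_Jfun.
- exact: measurable_funM.
- exact: Jfun_ge0.
- move=> z /far_enorm_ge1[z1 ez1].
  have ez : 0 < enorm (z : 'rV[R]_d) by lra.
  have ezn : enorm (z : 'rV[R]_d) != 0 by rewrite gt_eqF.
  rewrite /Jfun; set E := enorm _ in ez ezn *.
  have -> : nfourier nu z `^ (2 / th) = (nfourier nu z `^ (2 / th')) `^ q.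
    by rewrite -powRrM; congr (_ `^ _); rewrite /q; field; rewrite !gt_eqF.
  apply: (@le_trans _ _ ((K * E `^ (- a) * fine (Javg z)) `^ q * E `^ ((t - d%:R * (th' - th)) / th - d%:R))).
    apply: ler_wpM2r; first exact: powR_ge0.
    by apply: le_powR; [lra|exact: powR_ge0|exact: hK].
  rewrite powRM ?mulr_ge0 ?powR_ge0// powRM ?powR_ge0// -powRrM.
  have -> : fine (Javg z) `^ q = fine (Javg z) * fine (Javg z) `^ (q - 1).
    by rewrite mulr_powRB1//; lra.
  have -> : K `^ q * E `^ (- a * q) * (fine (Javg z) * fine (Javg z) `^ (q - 1)) *
     E `^ ((t - d%:R * (th' - th)) / th - d%:R) =
     K `^ q * fine (Javg z) `^ (q - 1) * fine (Javg z) *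
     (E `^ (- a * q) * E `^ ((t - d%:R * (th' - th)) / th - d%:R)) by ring.
  rewrite -powRD ?ezn ?implybT//.
  have -> : - a * q + ((t - d%:R * (th' - th)) / th - d%:R) = 0.
    by rewrite /q; field; rewrite !gt_eqF.
  rewrite powRr0 mulr1; apply: ler_wpM2r; first exact: G0.
  apply: ler_wpM2l; first exact: powR_ge0.
  by apply: le_powR => //; lra.
have mc : measurable (~` cube (0 : 'rV[R]_d) 1).
  by apply: measurableC; exact: measurable_cube.
apply: (@le_lt_trans _ _ (\int[@lebRV R d]_z (K'%:E * Javg z))%E).
  under eq_integral do rewrite EFinM fineK ?Javg_fin//.
  apply: ge0_subset_integral => //.
  - by apply: emeasurable_funM => //; exact: measurable_Javg.
  - by move=> z _; rewrite mule_ge0 ?Javg_ge0.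
rewrite ge0_integralZl_EFin//; last 2 first.
- by move=> z _; exact: Javg_ge0.
- exact: measurable_Javg.
rewrite integral_Javg; apply: lte_mul_pinfty => //.
apply: lte_mul_pinfty => //.
by rewrite lee_fin exprn_ge0// invr_ge0 ltW.
Qed.

End averaged.
End averaging.

(** * From measures to sets *)

Section set_level.
Variables (R : realType) (d : nat).
Local Notation T := (borelRV R d).
Implicit Types (mu nu : {finite_measure set T -> \bar R}) (X : set 'rV[R]_d).

Lemma fourier_energy0_lty mu s :
  (fourier_energy mu s 0 < +oo)%E <->
  exists2 K, 0 <= K & forall z : 'rV[R]_d, nfourier mu z ^+ 2 * enorm z `^ s <= K.
Proof.
rewrite /fourier_energy eqxx; split=> [h|[K K0 hK]].
  set S := [set _ | _ in _] in h.
  have ub z : ((nfourier mu z ^+ 2 * enorm z `^ s)%:E <= ereal_sup S)%E.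
    by apply: ereal_sup_ubound; exists z.
  have S0 : (0 <= ereal_sup S)%E.
    apply: le_trans (ub 0); rewrite lee_fin mulr_ge0 ?powR_ge0 ?sqr_ge0//.
  exists (fine (ereal_sup S)); first exact: fine_ge0.
  by move=> z; rewrite -lee_fin fineK ?ge0_fin_numE.
apply: (@le_lt_trans _ _ K%:E); last exact: ltry.
by apply: ge_ereal_sup => _ [z _ <-]; rewrite lee_fin; exact: hK.
Qed.

Lemma fourier_spectrum0 mu : fourier_spectrum mu 0 = fourier_dim mu.
Proof.
rewrite /fourier_spectrum /fourier_dim; congr ereal_sup.
apply/seteqP; split=> [_ [->|[s [s0 /fourier_energy0_lty[K K0 hK]] <-]]|].
- exists 0 => //; split => //.
  exists (2 * mass mu + 1); first by have := mass_ge0 mu; lra.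
  move=> z z0; rewrite oppr0 mul0r powRr0 mulr1.
  by apply: le_trans (nfourier_le_mass mu z) _; rewrite lerDl.
- exists s => //; split => //; exists (Num.sqrt K + 1).
    by have := sqrtr_ge0 K; lra.
  move=> z z0; have ez := enorm_gt0 z0.
  apply: (@le_trans _ _ (Num.sqrt K * enorm z `^ (- s / 2))); last first.
    by rewrite ler_wpM2r ?powR_ge0// lerDl.
  rewrite -[Normc.normc _]/(nfourier mu z).
  rewrite -(@ler_pXn2r _ 2)// ?nnegrE ?mulr_ge0 ?sqrtr_ge0 ?powR_ge0 ?nfourier_ge0//.
  rewrite [leRHS]exprMn (sqr_sqrtr K0) -[X in _ <= _ * X]powR_mulrn ?powR_ge0// -powRrM.
  have -> : - s / 2 * 2%:R = - s by field.
  by rewrite powRN ler_pdivlMr ?powR_gt0//; exact: hK.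
move=> _ [s [s0 [c c0 hc]] <-]; right; exists s => //; split => //.
apply/fourier_energy0_lty.
exists (c ^+ 2 + (2 * mass mu) ^+ 2); first by rewrite addr_ge0 ?sqr_ge0.
move=> z; have [->|z0] := eqVneq z 0.
  rewrite nfourier0 enorm0.
  apply: (@le_trans _ _ (mass mu ^+ 2)).
    rewrite ler_piMr ?sqr_ge0//.
    by have [->|h] := eqVneq s 0; rewrite ?powRr0// powR0.
  by rewrite exprMn; have := sqr_ge0 (mass mu); have := sqr_ge0 c; lra.
have ez := enorm_gt0 z0.
apply: (@le_trans _ _ (c ^+ 2)); last by rewrite lerDl sqr_ge0.
rewrite -ler_pdivlMr ?powR_gt0// -powRN.
have -> : c ^+ 2 * enorm z `^ (- s) = (c * enorm z `^ (- s / 2)) ^+ 2.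
  rewrite [RHS]exprMn -[X in _ = _ * X]powR_mulrn ?powR_ge0// -powRrM; congr (_ * _ `^ _).
  by field.
rewrite lerXn2r ?nnegrE ?mulr_ge0 ?powR_ge0 ?(ltW c0) ?nfourier_ge0//.
exact: hc.
Qed.

Lemma set_fourier_spectrum0 X : set_fourier_spectrum X 0 = set_fourier_dim X.
Proof.
rewrite /set_fourier_spectrum /set_fourier_dim; congr ereal_sup.
by apply: eq_imagel => mu _; rewrite fourier_spectrum0.
Qed.

(** Some cube around 0 has positive mass; if [r] is large compared with its side, every Fejer factor
    is there at least half its maximum, so the new measure is not zero. A density cannot enlarge the
    support. *)
Lemma carried_mden X mu : carried X mu -> exists r,
  [/\ 2 <= r & exists (phiK : forall x : T, 0 <= ktrid r (x : 'rV[R]_d) <= r^-1 ^+ d)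
    (mphi : measurable_fun setT (fun x : T => ktrid r (x : 'rV[R]_d))),
    carried X (mden mu mphi phiK)].
Proof.
case=> mu0 muX.
have [e e0 he] := @ktri_lb R.
have [n [n0 mun]] : exists n : nat, (0 < n)%N /\ (0 < mu (cube (0 : 'rV[R]_d) n%:R))%E.
  apply: contrapT => h.
  have mu_null n : mu (cube (0 : 'rV[R]_d) n.+1%:R) = 0%E.
    apply/eqP; rewrite eq_le measure_ge0 andbT leNgt; apply/negP => mun.
    by apply: h; exists n.+1.
  have : mu (\bigcup_n cube (0 : 'rV[R]_d) n.+1%:R) = 0%E.
    apply/eqP; rewrite eq_le measure_ge0 andbT.
    apply: le_trans (measure_sigma_subadditive _ _ _ (@subset_refl _ _)) _.
    - by move=> n; exact: measurable_cube.
    - by apply: bigcupT_measurable => n; exact: measurable_cube.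
    - by rewrite eseries0 // => n _ _; apply: mu_null.
  have -> : \bigcup_n cube (0 : 'rV[R]_d) n.+1%:R = setT.
    rewrite -subTset => x _; exists (Num.truncn `|x : 'rV[R]_d|) => //.
    by apply/cube0P => //; exact/ltW/truncnS_gt.
  by move=> h0; rewrite h0 ltxx in mu0.
pose r := Num.max 2 (2 * pi * n%:R / e).
have r2 : 2 <= r by rewrite le_max lexx.
have r0 : 0 < r by apply: lt_le_trans r2.
exists r; split => //.
have phiK (x : T) : 0 <= ktrid r (x : 'rV[R]_d) <= r^-1 ^+ d by rewrite ktrid_ge0// ktrid_le.
have mphi : measurable_fun setT (fun x : T => ktrid r (x : 'rV[R]_d)).
  by apply: (@measurable_ktrid _ _ T d (fun x : T => (x : 'rV[R]_d))) => i; exact: measurable_coord.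
exists phiK, mphi; split.
  have mc : measurable (cube (0 : 'rV[R]_d) n%:R) by exact: measurable_cube.
  rewrite /= /mden.
  apply: (@lt_le_trans _ _ (\int[mu]_(x in cube 0%R n%:R) (cst ((r^-1 / 2) ^+ d)%:E x))%E).
    rewrite integral_cst// mule_gt0// lte_fin exprn_gt0// divr_gt0// invr_gt0//.
  apply: (@le_trans _ _ (\int[mu]_(x in cube 0%R n%:R) (ktrid r (x : 'rV[R]_d))%:E)%E).
    apply: ge0_le_integral => //.
    - by move=> x _; rewrite lee_fin exprn_ge0// divr_ge0// invr_ge0 ltW.
    - by apply: measurable_funTS; exact/measurable_EFinP.
    move=> x xc; rewrite lee_fin /ktrid.
    have -> : (r^-1 / 2) ^+ d = \prod_(i < d) (r^-1 / 2) by rewrite prodr_const card_ord.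
    apply: ler_prod => i _; rewrite divr_ge0 ?invr_ge0 ?(ltW r0)//=.
    apply: he => //; rewrite normrM ger0_norm; last by rewrite mulr_ge0// pi_ge0.
    apply: (@le_trans _ _ (2 * pi * n%:R)).
      rewrite ler_wpM2l//; first by rewrite mulr_ge0// pi_ge0.
      by have := xc i; rewrite mxE subr0.
    by rewrite [e * r]mulrC -ler_pdivrMr// /r le_max lexx orbT.
  apply: ge0_subset_integral => //.
  - exact/measurable_EFinP.
  - by move=> x _; rewrite lee_fin ktrid_ge0.
apply: subset_trans muX => x xs U oU Ux.
rewrite lt_neqAle measure_ge0 andbT; apply/negP => /eqP U0.
have := xs U oU Ux.
have mU : measurable (U : set T) by exact: sub_sigma_algebra.
have := mden_le mu mphi phiK mU.
by rewrite -U0 mule0 => h1 h2; have := lt_le_trans h2 h1; rewrite ltxx.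
Qed.

Lemma fourier_spectrum_mono mu th th' : (0 < d)%N -> 0 <= th -> th < th' ->
  (fourier_spectrum mu th <= fourier_spectrum mu th')%E.
Proof.
move=> d0 th0 tt; have th'0 : 0 < th' by apply: le_lt_trans tt.
have F0 := fourier_spectrum_ge0 mu th'.
apply: ge_ereal_sup => _ [->//|[s [s0 sE] <-]].
rewrite leNgt; apply/negP => Fs.
have [v vE] : exists v, fourier_spectrum mu th' = v%:E.
  exists (fine (fourier_spectrum mu th')); rewrite fineK// ge0_fin_numE//.
  exact: lt_trans Fs (ltry _).
move: F0 Fs; rewrite vE lee_fin lte_fin => v0 vs.
(* Going from [th] to [th'] costs an arbitrarily small part of the exponent; the midpoint leaves
   room for it. *)
pose s' := (v + s) / 2.
have s'0 : 0 < s' by rewrite /s'; lra.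
have s's : s' < s by rewrite /s'; lra.
suff : (s'%:E <= fourier_spectrum mu th')%E by rewrite vE lee_fin /s'; lra.
apply: ereal_sup_ubound; right; exists s' => //; split; first exact: ltW.
apply/fourier_energyE => //.
move: th0; rewrite le_eqVlt => /predU1P[h|th0].
  move: sE; rewrite -h => /fourier_energy0_lty[K K0 hK].
  exact: (Jfun_decay d0 th'0 s'0 s's K0 hK).
move/fourier_energyE : sE => /(_ th0).
exact: Jfun_mono_theta.
Qed.

Lemma set_fourier_spectrum_ge0 X th : X !=set0 -> (0 <= set_fourier_spectrum X th)%E.
Proof.
case=> x Xx; apply: le_trans (ereal_sup_ubound _); last first.
  by exists (@dirac _ (borelRV R d) x R) => //; exact: carried_dirac.
by rewrite le_min fourier_spectrum_ge0/= lee_fin ler0n.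
Qed.

Lemma set_fourier_spectrum_le X th : (set_fourier_spectrum X th <= d%:R%:E)%E.
Proof. by apply: ge_ereal_sup => _ [mu _ <-]; rewrite ge_min lexx orbT. Qed.

Lemma set_fourier_spectrum_mono X th th' : X !=set0 -> 0 <= th -> th <= th' ->
  (set_fourier_spectrum X th <= set_fourier_spectrum X th')%E.
Proof.
move=> X0 th0; rewrite le_eqVlt => /predU1P[->//|tt].
have [d0|d0] := posnP d.
  apply: le_trans (set_fourier_spectrum_le X th) _.
  by move: (set_fourier_spectrum_ge0 th' X0); rewrite {2}d0.
apply: ge_ereal_sup => _ [mu muX <-].
apply: le_trans (ereal_sup_ubound _); last by exists mu.
by rewrite le_min !ge_min lexx orbT andbT fourier_spectrum_mono.
Qed.

Lemma set_fourier_spectrum_lip X th th' : X !=set0 -> 0 <= th -> th <= th' -> th' <= 1 ->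
  (set_fourier_spectrum X th' <= set_fourier_spectrum X th + (d%:R * (th' - th))%:E)%E.
Proof.
move=> X0 th0; rewrite le_eqVlt => /predU1P[->|tt] th'1.
  by rewrite subrr mulr0 adde0.
have [d0|d0] := posnP d.
  apply: (@le_trans _ _ 0%E).
    by apply: le_trans (set_fourier_spectrum_le X th') _; rewrite d0.
  by rewrite adde_ge0 ?set_fourier_spectrum_ge0// lee_fin mulr_ge0// subr_ge0 ltW.
have th'0 : 0 < th' by apply: le_lt_trans tt.
pose D := d%:R * (th' - th).
have D0 : 0 <= D by rewrite mulr_ge0// subr_ge0 ltW.
have [v vE] : exists v, set_fourier_spectrum X th = v%:E.
  by exists (fine (set_fourier_spectrum X th)); rewrite fineK// set_fourier_spectrum_fin_num.
have v0 : 0 <= v by rewrite -lee_fin -vE set_fourier_spectrum_ge0.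
rewrite vE -EFinD -/D; apply: ge_ereal_sup => _ [mu muX <-].
rewrite leNgt; apply/negP; rewrite lt_min => /andP[vmu vd].
have [_ [->|[s [s0 /fourier_energyE sE] <-]]] := ereal_sup_gt vmu.
  by rewrite lte_fin; lra.
rewrite lte_fin => vs.
have {sE} := sE th'0 => J.
have [r [r2 [phiK [mphi nuX]]]] := carried_mden muX.
have sD0 : 0 < s - D by lra.
(* The averaged measure is admissible for [X] and has spectrum at least [s - D > v] at [th]. The
   minimum cannot be [d] either, since [v + D < d]. *)
have : (mine (s - D)%:E d%:R%:E <= v%:E)%E.
  rewrite -vE; apply: le_trans (ereal_sup_ubound _); last by exists (mden mu mphi phiK).
  rewrite le_min !ge_min lexx orbT andbT; apply/orP; left.
  apply: ereal_sup_ubound; right; exists (s - D) => //; split; first exact: ltW.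
  move: th0; rewrite le_eqVlt => /predU1P[h|th0].
    rewrite /D -h subr0; apply/fourier_energy0_lty.
    by apply: (averaged_decay d0 r2 th'0 th'1 J); move: sD0; rewrite /D -h subr0 => /ltW.
  apply/fourier_energyE; first exact: th0.
  exact: (averaged_energy d0 r2 th'0 th'1 J).
rewrite ge_min !lee_fin; move: vd; rewrite lte_fin => vd /orP[]; lra.
Qed.

End set_level.

(** * The closed support of a finite measure *)

Section support.
Variables (R : realType) (d : nat).
Local Notation T := (borelRV R d).

Lemma open_rational_ball (U : set 'rV[R]_d) y : open U -> U y ->
  exists k : 'rV[rat]_d * nat,
    let B := ball (map_mx ratr k.1 : 'rV[R]_d) k.2.+1%:R^-1 in B y /\ B `<=` U.
Proof.
move=> oU Uy.
have : nbhs y U by exact: open_nbhs_nbhs.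
rewrite -nbhs_ballE => -[e /= e0 eU].
have [n ne] : exists n : nat, n.+1%:R^-1 + n.+1%:R^-1 < e.
  have e20 : 0 < e / 2 by rewrite divr_gt0.
  have := near_infty_natSinv_lt (PosNum e20).
  case=> n _ /(_ n (leqnn n))/= h; exists n.
  by rewrite (splitr e) ltrD.
have n0 : 0 < n.+1%:R^-1 :> R by rewrite invr_gt0.
have hq j : exists q : rat, ball (ratr q : R) n.+1%:R^-1 (y ord0 j).
  move: (y ord0 j) => x.
  have /rat_in_itvoo[q] : x - n.+1%:R^-1 < x + n.+1%:R^-1 by rewrite ltrD2l gtrN.
  rewrite in_itv/= => /andP[h1 h2]; exists q.
  by rewrite /ball/= ltr_distl h1.
have [q qP] := choice hq.
have By : ball (map_mx ratr (\row_j q j) : 'rV[R]_d) n.+1%:R^-1 y.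
  by apply/ball_rVP; split=> [//|j]; rewrite !mxE; exact: qP.
exists (\row_j q j, n); split=> //= x Bx; apply: eU.
apply: (@le_ball _ _ _ (n.+1%:R^-1 + n.+1%:R^-1)); first exact: ltW.
exact: ball_triangle (ball_sym By) Bx.
Qed.

Variable mu : {finite_measure set T -> \bar R}.

(** The complement of the support is the union of the null balls with rational centre and radius
    [1 / (n + 1)], and there are countably many of them. *)
Lemma msupport_negligible : measurable (msupport mu : set T) /\
  mu (~` (msupport mu : set T)) = 0%E.
Proof.
pose B (k : 'rV[rat]_d * nat) : set T := ball (map_mx ratr k.1 : 'rV[R]_d) k.2.+1%:R^-1.
have mB k : measurable (B k) by apply: sub_sigma_algebra; exact: ball_open.
pose D := [set k | mu (B k) = 0%E].
pose B' k : set T := if k \in D then B k else set0.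
have E : ~` (msupport mu : set T) = \bigcup_k B' k.
  apply/seteqP; split => x.
    rewrite /msupport /= => /existsNP[U] /not_implyP[oU] /not_implyP[Ux] /negP.
    rewrite -leNgt => U0.
    have [k /= [kx kU]] := open_rational_ball oU Ux.
    have mU : measurable (U : set T) by exact: sub_sigma_algebra.
    exists k => //; rewrite /B' mem_set//.
    apply/eqP; rewrite eq_le measure_ge0 andbT; apply: le_trans U0.
    by apply: le_measure; rewrite ?inE.
  case=> k _; rewrite /B'; case: ifPn => //; rewrite inE => Dk Bx /(_ (B k)).
  move: Dk; rewrite /D/= => Dk /(_ (ball_open _ _) Bx).
  by rewrite Dk ltxx.
have mB' k : measurable (B' k) by rewrite /B'; case: ifPn.
have mE : measurable (\bigcup_k B' k).
  by apply: countable_bigcupT_measurable => //; exact: countableP.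
split.
  by rewrite -[X in measurable X]setCK E; exact: measurableC.
rewrite E.
have -> : \bigcup_k B' k = \bigcup_n (if unpickle n is Some k then B' k else set0).
  apply/seteqP; split => [x [k _ kx]|x [n _]].
    by exists (pickle k) => //; rewrite pickleK.
  by case: (unpickle n) => // k kx; exists k.
apply/eqP; rewrite eq_le measure_ge0 andbT.
apply: le_trans (measure_sigma_subadditive _ _ _ (@subset_refl _ _)) _.
- by move=> n; case: (unpickle n) => // k; exact: mB'.
- by apply: bigcupT_measurable => n; case: (unpickle n) => // k; exact: mB'.
- rewrite eseries0 // => n _ _; case: (unpickle n) => [k|]; last exact: measure0.
  by rewrite /B'; case: ifPn => [|_]; [rewrite inE|rewrite measure0].
Qed.

End support.

(** * Energies and Hausdorff measures *)

Section mass_distribution.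
Variables (R : realType) (d : nat).
Hypothesis d0 : (0 < d)%N.
Local Notation T := (borelRV R d).
Variable mu : {finite_measure set T -> \bar R}.

Definition close_pairs (rho : R) : set (T * T) := [set p | `|subpair p| <= rho].

Lemma close_pairsE rho : 0 <= rho -> close_pairs rho =
  \bigcap_(i in [set: 'I_d]) ((fun p => subpair p ord0 i) @^-1` `[- rho, rho]).
Proof.
move=> r0; apply/seteqP; split=> [p /= h i _ /=|p h].
  by rewrite in_itv/= -ler_norml; exact: le_trans (coord_le_norm _ _) h.
apply: norm_le_coord => // i; have := h i I.
by rewrite /= in_itv/= -ler_norml.
Qed.

Lemma measurable_close_pairs rho : 0 <= rho -> measurable (close_pairs rho).
Proof.
move=> r0; rewrite close_pairsE//; apply: fin_bigcap_measurable => // i _.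
rewrite -[X in measurable X]setTI.
by apply: measurable_subpair => //; exact: measurable_itv.
Qed.

Lemma xsection_close_pairs rho x : 0 <= rho ->
  xsection (close_pairs rho) x = cube (x : 'rV[R]_d) rho.
Proof.
move=> r0; rewrite /xsection; apply/seteqP; split=> y /=; rewrite inE.
  by rewrite /close_pairs /= => h; apply/(cubeP _ _ r0); rewrite distrC.
by move/(cubeP _ _ r0); rewrite /close_pairs /= /subpair/= distrC.
Qed.

Lemma measurable_mu_cube rho : 0 <= rho ->
  measurable_fun setT (fun x : T => mu (cube (x : 'rV[R]_d) rho)).
Proof.
move=> r0.
have := measurable_fun_xsection mu (measurable_close_pairs r0).
have -> // : mu \o xsection (close_pairs rho) = (fun x : T => mu (cube (x : 'rV[R]_d) rho)).
by apply/funext => x /=; rewrite xsection_close_pairs.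
Qed.

Lemma prodm_close_pairs rho : 0 <= rho ->
  prodm mu (close_pairs rho) = (\int[mu]_x mu (cube (x : 'rV[R]_d) rho))%E.
Proof.
by move=> r0; rewrite /prodm /product_measure1; apply: eq_integral => x _ /=; rewrite xsection_close_pairs.
Qed.

(** With [r = c * rho], where [c] is such that [ktri_lb] applies, the kernel [ktrid r] is at least
    [(1 / 2r)^d] on close pairs. [energy_trid] moves its integral to frequencies of norm at most
    [d / r], where [|w|^(s - d)] is bounded below because [s <= d]. *)
Lemma close_pairs_le s : 0 < s -> s <= d%:R ->
  (\int[@lebRV R d]_z (Jfun mu s 1 z)%:E < +oo)%E ->
  exists2 C, 0 <= C & forall rho, 0 < rho ->
    (prodm mu (close_pairs rho) <= (C * rho `^ s)%:E)%E.
Proof.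
move=> s0 sd J; have [e e0 he] := @ktri_lb R.
pose Jr := fine (\int[@lebRV R d]_z (Jfun mu s 1 z)%:E)%E.
have J0 : (0 <= \int[@lebRV R d]_z (Jfun mu s 1 z)%:E)%E.
  by apply: integral_ge0 => w _; rewrite lee_fin Jfun_ge0.
have JrE : (\int[@lebRV R d]_z (Jfun mu s 1 z)%:E = Jr%:E)%E.
  by rewrite fineK// ge0_fin_numE.
have Jr0 : 0 <= Jr by rewrite fine_ge0.
have pi0 := pi_gt0 R.
pose c := 2 * pi / e.
have c0 : 0 < c by rewrite divr_gt0// mulr_gt0.
exists (2 ^+ d * d%:R `^ (d%:R - s) * c `^ s * Jr).
  by rewrite !mulr_ge0 ?powR_ge0 ?exprn_ge0.
move=> rho rho0; pose r := c * rho.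
have r0 : 0 < r by rewrite mulr_gt0.
have r10 : 0 <= r^-1 / 2 by rewrite divr_ge0 ?invr_ge0 ?(ltW r0).
have mclose := measurable_close_pairs (ltW rho0).
have mk : measurable_fun setT (fun p => (ktrid r (@subpair R d p))%:E).
  by apply/measurable_EFinP; exact: (measurable_ktrid (@measurable_subpair R d)).
have E1 : (((r^-1 / 2) ^+ d)%:E * prodm mu (close_pairs rho) <=
    \int[prodm mu]_p (ktrid r (subpair p))%:E)%E.
  rewrite -integral_cst//.
  apply: (@le_trans _ _ (\int[prodm mu]_(p in close_pairs rho) (ktrid r (subpair p))%:E)%E).
    apply: ge0_le_integral => //.
    - by move=> p _; rewrite lee_fin exprn_ge0.
    - exact: measurable_funTS.
    move=> p pc; rewrite lee_fin /ktrid.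
    have -> : (r^-1 / 2) ^+ d = \prod_(i < d) (r^-1 / 2) by rewrite prodr_const card_ord.
    apply: ler_prod => i _; rewrite r10/=.
    apply: he => //; rewrite normrM ger0_norm; last by rewrite mulr_ge0// ltW.
    have -> : e * r = 2 * pi * rho by rewrite /r /c; field; rewrite gt_eqF.
    rewrite ler_wpM2l//; first by rewrite mulr_ge0// ltW.
    by apply: le_trans (coord_le_norm _ _) _.
  apply: ge0_subset_integral => //.
  by move=> p _; rewrite lee_fin ktrid_ge0.
have dr0 : 0 <= d%:R / r by rewrite divr_ge0// ltW.
have E2 : (\int[@lebRV R d]_w (trid r 0 w * nfourier mu w ^+ 2)%:E <=
    ((d%:R / r) `^ (d%:R - s) * Jr)%:E)%E.
  pose M2 := (2 * mass mu) ^+ 2.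
  have M20 : 0 <= M2 by exact: sqr_ge0.
  have mc0 : measurable (cube (0 : 'rV[R]_d) 0) by exact: measurable_cube.
  have mJ := measurable_Jfun mu s 1.
  (* The second summand covers [w = 0], where [Jfun] vanishes for [s < d] by the convention for
     powers of 0 although the transform does not. The degenerate cube is null because [d > 0]. *)
  apply: (@le_trans _ _ (\int[@lebRV R d]_w (((d%:R / r) `^ (d%:R - s))%:E * (Jfun mu s 1 w)%:E +
      M2%:E * (\1_(cube (0 : 'rV[R]_d) 0) w)%:E))%E).
    apply: ge0_le_integral => //.
    - by move=> w _; rewrite lee_fin mulr_ge0 ?trid_ge0 ?sqr_ge0.
    - apply/measurable_EFinP; apply: measurable_funM; first exact: measurable_trid.
      by apply: measurable_funX; exact: measurable_nfourier.
    - apply: emeasurable_funD; apply: emeasurable_funM => //.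
        exact/measurable_EFinP.
      by apply/measurable_EFinP; exact: measurable_indic.
    move=> w _; rewrite -!EFinM -EFinD lee_fin.
    have [w0|w0] := eqVneq (w : 'rV[R]_d) 0.
      rewrite indicE mem_set; last by rewrite w0; apply/cube0P; rewrite ?normr0.
      rewrite mulr1 -[leLHS]add0r lerD//.
        by rewrite mulr_ge0 ?powR_ge0 ?Jfun_ge0.
      rewrite -[leRHS]mul1r ler_pM ?trid_ge0 ?sqr_ge0 ?trid_le1 ?(ltW r0)//.
      by rewrite lerXn2r ?nnegrE ?mulr_ge0 ?mass_ge0 ?nfourier_ge0 ?nfourier_le_mass.
    rewrite -[leLHS]addr0; apply: lerD; last exact: mulr_ge0.
    have ew := enorm_gt0 w0.
    have := trid_ge0 r 0 w; rewrite le_eqVlt => /predU1P[<-|t0].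
      by rewrite mul0r mulr_ge0 ?powR_ge0 ?Jfun_ge0.
    have wr : enorm (w : 'rV[R]_d) <= d%:R / r.
      apply: le_trans (enorm_le_norm _) _; rewrite ler_wpM2l//.
      apply: norm_le_coord; first by rewrite invr_ge0 ltW.
      move=> i; rewrite leNgt; apply/negP => h.
      move: t0; suff -> : trid r 0 w = 0 by rewrite ltxx.
      apply/eqP; rewrite /trid prodf_seq_eq0; apply/hasP; exists i; first exact: mem_index_enum.
      apply/eqP; rewrite /= /tri mxE subr0 max_l// subr_le0.
      by rewrite -ler_pdivrMl// mulr1 ltW.
    rewrite /Jfun !divr1 powR_mulrn ?nfourier_ge0//.
    apply: (@le_trans _ _ (nfourier mu w ^+ 2)).
      by rewrite ler_piMl ?sqr_ge0// trid_le1// ltW.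
    rewrite mulrCA -[leLHS]mulr1 ler_wpM2l ?sqr_ge0//.
    have -> : s - d%:R = - (d%:R - s) by ring.
    rewrite powRN ler_pdivlMr ?powR_gt0// mul1r.
    by apply: le_powR => //; [rewrite subr_ge0|exact: ltW].
  rewrite ge0_integralD//.
  - rewrite ge0_integralZl_EFin ?powR_ge0//; last 2 first.
    + by move=> w _; rewrite lee_fin Jfun_ge0.
    + exact/measurable_EFinP.
    have mi : measurable_fun setT (fun w : T => (\1_(cube (0%R : 'rV[R]_d) 0%R) w)%:E : \bar R).
      by apply/measurable_EFinP; exact: measurable_indic.
    rewrite ge0_integralZl_EFin//.
    have -> : (\int[@lebRV R d]_w (\1_(cube (0%R : 'rV[R]_d) 0%R) w)%:E = 0)%E.
      rewrite integral_indic// setIT; apply: etrans (lebRV_cube 0 (lexx 0)) _.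
      by rewrite mulr0 expr0n gtn_eqF.
    by rewrite mule0 adde0 JrE EFinM.
  - by move=> w _; rewrite -EFinM lee_fin mulr_ge0 ?powR_ge0 ?Jfun_ge0.
  - by apply: emeasurable_funM => //; exact/measurable_EFinP.
  - by move=> w _; rewrite -EFinM lee_fin; exact: mulr_ge0.
  - by apply: emeasurable_funM => //; apply/measurable_EFinP; exact: measurable_indic.
have := E1; rewrite -energy_trid// => /le_trans /(_ E2).
have r1d : 0 < (r^-1 / 2) ^+ d by rewrite exprn_gt0// divr_gt0// invr_gt0.
rewrite -lee_pdivlMl// => /le_trans; apply.
rewrite -EFinM lee_fin le_eqVlt; apply/orP; left; apply/eqP.
have rn : r != 0 by rewrite gt_eqF.
have -> : ((r^-1 / 2) ^+ d)^-1 = 2 ^+ d * r ^+ d by rewrite -exprVn invfM !invrK mulrC exprMn.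
have -> : (d%:R / r) `^ (d%:R - s) = d%:R `^ (d%:R - s) * (r `^ s / r ^+ d).
  rewrite powRM ?invr_ge0 ?(ltW r0)//; congr (_ * _).
  rewrite -(powR_inv1 (ltW r0)) -powRrM mulN1r opprB powRB; last by rewrite rn implybT.
  by rewrite powR_mulrn// ltW.
have rs : r `^ s = c `^ s * rho `^ s by rewrite /r powRM ?(ltW c0) ?(ltW rho0).
rewrite rs.
have : r ^+ d != 0 by rewrite expf_neq0.
move: (r ^+ d) (rho `^ s) (c `^ s) (d%:R `^ _) => A B C D A0.
by field; rewrite A0.
Qed.

(** The series of [2^(k t) mu (cube x 2^-k)] has a finite integral, its terms having integrals of
    order [2^(k (t - s))] by [close_pairs_le]. It is thus finite almost everywhere, and at most some
    [N] on a set of positive measure; there [N] bounds each term. *)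
Lemma exists_upper_regular_subset t s : 0 <= t -> t < s -> s <= d%:R -> (0 < mu setT)%E ->
  (\int[@lebRV R d]_z (Jfun mu s 1 z)%:E < +oo)%E ->
  exists N, [/\ 0 <= N & exists A : set T, [/\ measurable A, (0 < mu A)%E &
    forall x, A x -> forall k, (mu (cube (x : 'rV[R]_d) (2^-1 ^+ k)) <= (N * (2^-1 ^+ k) `^ t)%:E)%E]].
Proof.
move=> t0 ts sd muT J; have s0 : 0 < s by apply: le_lt_trans ts.
have [C C0 hC] := close_pairs_le s0 sd J.
pose a : R := 2 `^ t; pose b : R := 2 `^ s.
have a0 : 0 < a by rewrite powR_gt0.
have b0 : 0 < b by rewrite powR_gt0.
have ab : a < b by rewrite ltr_pow2.
have pk u k : (2^-1 ^+ k) `^ u = (2 `^ u)^-1 ^+ k :> R.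
  by rewrite -powR_mulrn ?invr_ge0// powRAC powR_mulrn ?powR_ge0// -powR_inv1// powRAC powR_inv1 ?powR_ge0.
have h2 k : 0 < 2^-1 ^+ k :> R by rewrite exprn_gt0// invr_gt0.
pose g k (x : T) := ((a ^+ k)%:E * mu (cube (x : 'rV[R]_d) (2^-1 ^+ k)))%E.
have mg k : measurable_fun setT (g k).
  by apply: emeasurable_funM => //; apply: measurable_mu_cube; exact: ltW.
have g0 k x : (0 <= g k x)%E by rewrite mule_ge0// lee_fin exprn_ge0// ltW.
pose h (x : T) := (\sum_(0 <= k <oo) g k x)%E.
have mh : measurable_fun setT h.
  by apply: ge0_emeasurable_sum => // k _; exact: mg.
have hfin : (\int[mu]_x h x < +oo)%E.
  rewrite /h integral_nneseries//.
  apply: (@le_lt_trans _ _ (\sum_(0 <= k <oo) (C * (a / b) ^+ k)%:E)%E); last first.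
    apply: nneseries_geometric_lty => //; first by rewrite divr_ge0 ?(ltW a0) ?(ltW b0).
    by rewrite ltr_pdivrMr// mul1r.
  apply: lee_nneseries => // k _; first by move=> _; exact: integral_ge0.
  rewrite /g ge0_integralZl_EFin ?exprn_ge0 ?(ltW a0)//; last first.
    by apply: measurable_mu_cube; exact: ltW.
  rewrite -prodm_close_pairs; last exact: ltW.
  apply: (@le_trans _ _ ((a ^+ k)%:E * (C * (2^-1 ^+ k) `^ s)%:E)%E).
    by rewrite lee_wpmul2l ?hC// lee_fin exprn_ge0// ltW.
  by rewrite -EFinM lee_fin pk -/b exprMn mulrCA.
have [N muN] : exists N : nat, (0 < mu [set x | (h x <= N%:R%:E)%E])%E.
  apply: contrapT => hN.
  have mE N : measurable [set x | (h x <= N%:R%:E)%E].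
    by rewrite -[X in measurable X]setTI; exact: emeasurable_fun_infty_c.
  have h0 x : (0 <= h x)%E by exact: nneseries_ge0.
  have null N : mu [set x | (h x <= N%:R%:E)%E] = 0%E.
    apply/eqP; rewrite eq_le measure_ge0 andbT leNgt; apply/negP => muN.
    by apply: hN; exists N.
  have ih : mu.-integrable setT h.
    apply/integrableP; split => //.
    by under eq_integral => x _ do rewrite gee0_abs//.
  have [A [mA A0 hA]] := integrable_ae measurableT ih.
  suff : (mu setT <= 0)%E by rewrite leNgt muT.
  apply: (@le_trans _ _ (mu (A `|` \bigcup_N [set x | (h x <= N%:R%:E)%E]))).
    apply: le_measure; rewrite ?inE//.
      by apply: measurableU => //; exact: bigcupT_measurable.
    move=> x _; have [hx|hx] := boolP (h x \is a fin_num).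
      right; exists (Num.truncn (fine (h x))).+1 => //=.
      by rewrite -(fineK hx) lee_fin; exact/ltW/truncnS_gt.
    by left; apply: hA => /= /(_ I); exact/negP.
  apply: le_trans (measureU2 _ _ _) _ => //; first exact: bigcupT_measurable.
  rewrite -[leRHS]adde0; apply: leeD; first by rewrite -A0.
  apply: le_trans (measure_sigma_subadditive _ _ _ (@subset_refl _ _)) _ => //.
  - exact: bigcupT_measurable.
  - by rewrite eseries0 // => n _ _; exact: null.
exists N%:R; split => //; exists [set x | (h x <= N%:R%:E)%E]; split => //.
  by rewrite -[X in measurable X]setTI; exact: emeasurable_fun_infty_c.
move=> x hx k; rewrite pk -/a.
have : (g k x <= N%:R%:E)%E by apply: le_trans hx; exact: ge0_le_nneseries_term.
by rewrite /g => hg; rewrite [a^-1 ^+ k]exprVn EFinM muleC lee_pdivlMl ?exprn_gt0//.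
Qed.

Lemma hausdorff_measure_neq0 (X : set 'rV[R]_d) t s : 0 <= t -> t < s -> s <= d%:R ->
  carried X mu ->
  (\int[@lebRV R d]_z (Jfun mu s 1 z)%:E < +oo)%E ->
  hausdorff_measure t X <> 0%E.
Proof.
move=> t0 ts sd [muT muX] J H0.
have [N [N0 [A [mA muA hA]]]] := exists_upper_regular_subset t0 ts sd muT J.
have [mS S0] := msupport_negligible mu.
set S := msupport mu in mS S0 muX.
(* [X] is arbitrary here; the support is a measurable subset of it that carries all the mass. *)
pose E := A `&` S.
have mE : measurable (E : set T) by exact: measurableI.
have muE : (0 < mu E)%E.
  apply: lt_le_trans muA _.
  apply: (@le_trans _ _ (mu (E `|` ~` S))).
    apply: le_measure; rewrite ?inE//.
      by apply: measurableU => //; exact: measurableC.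
    by move=> x Ax; have [Sx|Sx] := pselect (S x); [left|right].
  apply: le_trans (measureU2 _ _ _) _ => //; first exact: measurableC.
  by rewrite [X in (_ + X)%E]S0 adde0.
pose c : R := N * 2 `^ t.
have c0 : 0 <= c by rewrite mulr_ge0 ?powR_ge0.
(* Rounding a radius up to a power of 2 costs the factor [2^t] in [c]. Radius 0 occurs when a
   covering set is a single point: such a point has mass 0 if [t > 0], while for [t = 0] the
   convention [0^0 = 1] makes the bound [N]. *)
have ball_le x rho : A x -> 0 <= rho -> rho <= 2^-1 ->
    (mu (cube (x : 'rV[R]_d) rho) <= (c * rho `^ t)%:E)%E.
  move=> Ax; rewrite le_eqVlt => /predU1P[<- _|r0 r2].
    have mono k : (mu (cube (x : 'rV[R]_d) 0) <= (N * (2^-1 ^+ k) `^ t)%:E)%E.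
      apply: le_trans (hA x Ax k); apply: le_measure; rewrite ?inE; try exact: measurable_cube.
      by move=> y xy i; apply: le_trans (xy i) _; rewrite exprn_ge0.
    have [t00|tn0] := eqVneq t 0.
      by move: (mono 0%N); rewrite /c t00 !powRr0 !mulr1.
    rewrite powR0// mulr0.
    apply/lee_addgt0Pr => e e0; rewrite add0e.
    have t0' : 0 < t by rewrite lt_neqAle eq_sym tn0.
    have q1 : `|(2 `^ t)^-1| < 1 :> R.
      rewrite ger0_norm ?invr_ge0 ?powR_ge0// invf_lt1 ?powR_gt0//.
      by rewrite -[ltLHS](powRr0 2) ltr_pow2.
    have /cvgrPdist_lt /(_ e e0)[k _ hk] := cvg_geometric N q1.
    apply: le_trans (mono k) _; rewrite lee_fin.
    have := hk k (leqnn k); rewrite /= sub0r normrN => /ltW; apply: le_trans.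
    apply: le_trans (ler_norm _).
    rewrite le_eqVlt; apply/orP; left; apply/eqP; congr (_ * _).
    by rewrite -powR_mulrn ?invr_ge0// powRAC powR_mulrn ?powR_ge0// -powR_inv1// powRAC powR_inv1 ?powR_ge0.
  have /exists_dyadic_shell[k /andP[k1 k2]] : 1 < rho^-1.
    by rewrite invf_gt1//; lra.
  apply: (@le_trans _ _ (mu (cube (x : 'rV[R]_d) (2^-1 ^+ k)))).
    apply: le_measure; rewrite ?inE; try exact: measurable_cube.
    move=> y xy i; apply: le_trans (xy i) _.
    by rewrite exprVn -[leLHS]invrK lef_pV2 ?posrE ?exprn_gt0 ?invr_gt0 ?(ltW k1).
  apply: le_trans (hA x Ax k) _; rewrite lee_fin /c -mulrA ler_wpM2l//.
  rewrite -powRM ?(ltW r0)//; apply: le_powR => //.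
  rewrite exprVn -[leLHS]mul1r ler_pdivrMr ?exprn_gt0// mulrAC -exprS.
  by rewrite -ler_pdivrMr// mul1r.
pose m := fine (mu E).
have mEm : mu E = m%:E by rewrite fineK// fin_num_measure.
have m0 : 0 < m by rewrite -lte_fin -mEm.
have h12 : (0 : R) < 2^-1 by [].
have content0 : (hausdorff_content t 2^-1 X <= 0)%E.
  by rewrite -H0; apply: ereal_sup_ubound; exists 2^-1.
(* With [c + 1] in the denominator [c = 0] is allowed and [c * (m / (c + 1)) < m] holds strictly. *)
have : (hausdorff_content t 2^-1 X < (m / (c + 1))%:E)%E.
  by apply: le_lt_trans content0 _; rewrite lte_fin divr_gt0//; lra.
move=> /ereal_inf_lt[_ [U [Udiam XU] <-]] sumU.
pose P n := (U n `&` E : set 'rV[R]_d).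
pose B n : set T := if pselect (P n !=set0) is left e
  then cube (projT1 (cid e)) (fine (ediam (U n))) else set0.
have mB n : measurable (B n).
  by rewrite /B; case: pselect => // e; exact: measurable_cube.
have diam_fin n : U n !=set0 -> ediam (U n) = (fine (ediam (U n)))%:E /\ 0 <= fine (ediam (U n)) <= 2^-1.
  case=> x Ux.
  have le0 : (0 <= ediam (U n))%E.
    by apply: ereal_sup_ubound; exists (x, x) => //=; rewrite subrr enorm0.
  have fin : ediam (U n) \is a fin_num.
    by rewrite ge0_fin_numE//; apply: le_lt_trans (Udiam n) (ltry _).
  rewrite fineK//; split => //; rewrite fine_ge0//=.
  by rewrite -lee_fin fineK.
have EB : E `<=` \bigcup_n B n.
  move=> x Ex; have /XU[n _ Ux] : X x by apply: muX; case: Ex.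
  exists n => //; rewrite /B; case: pselect => [e|]; last by case; exists x.
  case: (cid e) => y /= [Uy Ey].
  have [dE /andP[d00 _]] := diam_fin n (ex_intro _ x Ux).
  apply/cubeP => //; apply: le_trans (norm_le_enorm _) _.
  rewrite -lee_fin -dE; apply: ereal_sup_ubound.
  by exists (x, y).
have muB n : (mu (B n) <= c%:E * ediam_pow t (U n))%E.
  rewrite /B; case: pselect => [e|_]; last first.
    rewrite measure0 mule_ge0//; rewrite /ediam_pow; case: ifPn => // _.
    exact: poweR_ge0.
  case: (cid e) => y /= [Uy [Ay _]].
  have [dE /andP[d00 d01]] := diam_fin n (ex_intro _ y Uy).
  apply: le_trans (ball_le y _ Ay d00 d01) _.
  rewrite /ediam_pow ifF; last by apply/negbTE/set0P; exists y.
  by rewrite EFinM dE poweR_EFin.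
suff : (mu E < m%:E)%E by rewrite mEm ltxx.
apply: (@le_lt_trans _ _ (\sum_(0 <= n <oo) mu (B n))%E).
  exact: measure_sigma_subadditive.
apply: (@le_lt_trans _ _ (c%:E * \sum_(0 <= n <oo) ediam_pow t (U n))%E).
  rewrite -nneseriesZl//; last first.
    by move=> n _; rewrite /ediam_pow; case: ifPn => // _; exact: poweR_ge0.
  by apply: lee_nneseries => // n _; exact: muB.
apply: (@le_lt_trans _ _ (c%:E * (m / (c + 1))%:E)%E).
  by apply: lee_wpmul2l; [rewrite lee_fin|exact: ltW].
rewrite -EFinM lte_fin mulrA ltr_pdivrMr; last by lra.
by rewrite mulrDr mulr1 [c * m]mulrC ltrDl.
Qed.

End mass_distribution.

Lemma set_fourier_spectrum1_le (R : realType) d (X : set 'rV[R]_d) :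
  (set_fourier_spectrum X 1 <= hausdorff_dim X)%E.
Proof.
apply: le_ereal_inf_tmp => _ [u [u0 H0] <-].
apply: ge_ereal_sup => _ [mu muX <-].
rewrite leNgt; apply/negP; rewrite lt_min => /andP[us ud].
have [_ [->|[s [s0 sE] <-]]] := ereal_sup_gt us.
  by rewrite lte_fin; lra.
rewrite lte_fin in ud; rewrite lte_fin => us'.
have d0 : (0 < d)%N by rewrite -(ltr0n R); lra.
(* [hausdorff_measure_neq0] is for exponents at most [d]; lowering the exponent keeps the energy
   finite. *)
have s'0 : 0 < Num.min s d%:R by rewrite lt_min; rewrite (le_lt_trans u0 us') (le_lt_trans u0 ud).
have J : (\int[@lebRV R d]_z (Jfun mu (Num.min s d%:R) 1 z)%:E < +oo)%E.
  apply: (Jfun_mono_s d0 _ s'0 (s := s)) => //; first by rewrite ge_min lexx.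
  exact/fourier_energyE.
apply: (hausdorff_measure_neq0 d0 u0 _ _ muX J H0).
- by rewrite lt_min us' ud.
- by rewrite ge_min lexx orbT.
Qed.

(** * Contents on Cantor space *)

Section cantor_content.
Variables (R : realType) (w : nat -> R).
Hypothesis w0 : forall n, 0 <= w n.
Implicit Types (A B : set (nat -> bool)) (S U : set (seq bool)) (a : nat -> bool).

Definition pre a n : seq bool := mkseq a n.

Definition cyl p : set (nat -> bool) := [set a | pre a (size p) = p].

Definition covers S A := forall a, A a -> exists n, S (pre a n).

Definition cost S : \bar R := (\esum_(p in S) (w (size p))%:E)%E.

Definition cont A : \bar R := ereal_inf [set cost S | S in [set S | covers S A]].

Let we0 (p : seq bool) : (0 <= (w (size p))%:E)%E.
Proof. by rewrite lee_fin. Qed.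

Lemma cost_ge0 S : (0 <= cost S)%E.
Proof. exact: esum_ge0. Qed.

Lemma costID S U : cost S = (cost (S `&` U) + cost (S `&` ~` U))%E.
Proof. by rewrite /cost; apply: esumID => p _; exact: we0. Qed.

Lemma costUI S U : (cost (S `|` U) + cost (S `&` U) = cost S + cost U)%E.
Proof.
rewrite (costID (S `|` U) U) (costID S U) (setIidr (@subsetUr _ S U)).
have -> : (S `|` U) `&` ~` U = S `&` ~` U.
  by apply/seteqP; split=> x /= [h1 h2]; split=> //; [case: h1|left].
by rewrite addeC -[RHS]addeA; congr (_ + _)%E; rewrite addeC.
Qed.

Lemma costU S U : (cost (S `|` U) <= cost S + cost U)%E.
Proof. by rewrite -costUI leeDl// cost_ge0. Qed.

Lemma cost1 p : cost [set p] = (w (size p))%:E.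
Proof. by rewrite /cost esum_set1. Qed.

Lemma cont_ge0 A : (0 <= cont A)%E.
Proof. by apply: le_ereal_inf_tmp => _ [S _ <-]; exact: cost_ge0. Qed.

Lemma cont_le S A : covers S A -> (cont A <= cost S)%E.
Proof. by move=> SA; apply: ereal_inf_lbound; exists S. Qed.

Lemma cont_subset A B : A `<=` B -> (cont A <= cont B)%E.
Proof.
move=> AB; apply: le_ereal_inf_tmp => _ [S SB <-]; apply: cont_le => a Aa.
exact/SB/AB.
Qed.

Lemma cont_cyl A p : A `<=` cyl p -> (cont A <= (w (size p))%:E)%E.
Proof.
by move=> Ap; rewrite -cost1; apply: cont_le => a /Ap h; exists (size p).
Qed.

Lemma cont_fin A : cont A \is a fin_num.
Proof.
rewrite ge0_fin_numE ?cont_ge0//.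
by apply: le_lt_trans (@cont_cyl A [::] _) (ltry _).
Qed.

Lemma cont_cover A e : 0 < e -> exists S, covers S A /\ (cost S <= cont A + e%:E)%E.
Proof.
move=> e0; have : (cont A < cont A + e%:E)%E by rewrite lteDl ?cont_fin.
by move=> /ereal_inf_lt[_ [S SA <-]] /ltW h; exists S.
Qed.

Lemma contU A B : (cont (A `|` B) <= cont A + cont B)%E.
Proof.
apply/lee_addgt0Pr => e e0.
have e20 : 0 < e / 2 by rewrite divr_gt0.
have [S [SA cS]] := cont_cover A e20.
have [U [UB cU]] := cont_cover B e20.
have SU : covers (S `|` U) (A `|` B).
  by move=> a [/SA|/UB] [n h]; exists n; [left|right].
apply: le_trans (cont_le SU) _; apply: le_trans (costU _ _) _.
apply: le_trans (leeD cS cU) _.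
by rewrite addeACA -EFinD -splitr.
Qed.

(** Prefix-minimal words, that is, the cylinders maximal for inclusion. *)
Definition top S := [set p | S p /\ forall q, S q -> prefix q p -> q = p].

Lemma prefix_pre a m n : (m <= n)%N -> prefix (pre a m) (pre a n).
Proof.
move=> mn; rewrite /pre -(subnKC mn) /mkseq iotaD map_cat.
exact: prefix_prefix.
Qed.

Lemma prefix_preE a n q : prefix q (pre a n) -> q = pre a (size q) /\ (size q <= n)%N.
Proof.
move=> qa; have qn : (size q <= n)%N.
  by have := size_prefix qa; rewrite size_mkseq.
split => //; have := qa; rewrite prefixE => /eqP {1}<-.
by rewrite /pre /mkseq -map_take take_iota (minn_idPl qn).
Qed.

Lemma covers_top S A : covers S A -> covers (top S) A.
Proof.
move=> SA a /SA[n0 hn0].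
have ex : exists n, `[< S (pre a n) >] by exists n0; apply/asboolP.
have [n /asboolP Sn min] := ex_minnP ex.
exists n; split => // q Sq /prefix_preE[qE qn].
have : (n <= size q)%N by apply: min; apply/asboolP; rewrite -qE.
by move=> nq; rewrite qE; congr pre; apply/eqP; rewrite eqn_leq qn nq.
Qed.

(** A point of [A] has a prefix in [S] and one in [U]: if they coincide it is a common word,
    otherwise the longer one is not maximal. So the words dropped by [top] and the common words
    together cover [A], and what they save pays for [cont A]. *)
Lemma cost_top_submod S U A : covers S A -> covers U A ->
  (cost (top (S `|` U)) + cont A <= cost S + cost U)%E.
Proof.
move=> SA UA; set V := S `|` U.
have topV : top V `<=` V by move=> p [].
rewrite -costUI -/V (costID V (top V)) (setIidr topV) -addeA leeD2l//.
apply: le_trans (costU _ _); apply: cont_le => a Aa.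
have [m Sm] := SA a Aa; have [n Un] := UA a Aa.
have nt p q : V p -> V q -> prefix p q -> p != q -> (V `&` ~` top V) q.
  by move=> Vp Vq pq npq; split => // -[_ /(_ _ Vp pq)]; exact/eqP.
have neq k l : (k < l)%N -> pre a k != pre a l.
  by move=> kl; apply/eqP => /(congr1 size); rewrite !size_mkseq => E; rewrite E ltnn in kl.
have [mn|nm|mn] := ltngtP m n.
- exists n; left; apply: (nt (pre a m)); [by left|by right|exact/prefix_pre/ltnW|exact: neq].
- exists m; left; apply: (nt (pre a n)); [by right|by left|exact/prefix_pre/ltnW|exact: neq].
- by exists m; right; split => //; rewrite mn.
Qed.

(* The increasing sets lemma for net contents: the optimal covers of the [A n]
   are merged one after the other, keeping only their maximal cylinders. *)
Lemma cont_bigcup (A : nat -> set (nat -> bool)) (b : R) :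
  (forall m n, (m <= n)%N -> A m `<=` A n) -> (forall n, (cont (A n) <= b%:E)%E) ->
  (cont (\bigcup_n A n) <= b%:E)%E.
Proof.
move=> ndA cA; apply/lee_addgt0Pr => e e0.
have en n : 0 < e * 2^-1 ^+ n.+1 by rewrite mulr_gt0// exprn_gt0// invr_gt0.
have /choice[U hU] n := cont_cover (A n) (en n).
pose W := fix W n := if n is n'.+1 then top (W n' `|` U n) else U 0%N.
have coverW n : covers (W n) (A n).
  elim: n => [|n IH]; first exact: (hU 0%N).1.
  apply: covers_top => a Aa; have [l hl] := (hU n.+1).1 a Aa.
  by exists l; right.
(* The induction step is [cost_top_submod] after cancelling the finite [cont (A n)]; the errors
   [e 2^-(i+1)] for [i <= n] add up to the stated one. *)
have costW n : (cost (W n) <= cont (A n) + (e * (1 - 2^-1 ^+ n.+1))%:E)%E.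
  elim: n => [|n IH].
    apply: le_trans (hU 0%N).2 _; rewrite expr1 leeD2l// lee_fin; lra.
  have UA : covers (U n.+1) (A n) by move=> a Aa; apply: (hU n.+1).1; exact: ndA Aa.
  have := cost_top_submod (coverW n) UA.
  rewrite -[top _]/(W n.+1) => h.
  have := le_trans h (leeD IH (hU n.+1).2).
  have -> : (cont (A n) + (e * (1 - 2^-1 ^+ n.+1))%:E + (cont (A n.+1) + (e * 2^-1 ^+ n.+2)%:E)
    = (cont (A n.+1) + (e * (1 - 2^-1 ^+ n.+2))%:E) + cont (A n))%E.
    rewrite -(fineK (cont_fin (A n))) -(fineK (cont_fin (A n.+1))) -!EFinD.
    by congr (_%:E); rewrite (exprS _ n.+1); field.
  by rewrite leeD2rE// cont_fin.
(* The words that are eventually present. For [a] in [A m], the shortest prefix of [a] seen at any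
   stage from [m] on is one of them, since only a shorter prefix could remove it. *)
pose Wo := [set p | exists n0, forall n, (n0 <= n)%N -> W n p].
have coverWo : covers Wo (\bigcup_n A n).
  move=> a [m _ Am].
  have ex : exists l, `[< exists2 n, (m <= n)%N & W n (pre a l) >].
    have [l hl] := coverW m a Am.
    by exists l; apply/asboolP; exists m.
  have [l /asboolP[n0 mn0 Wl] min] := ex_minnP ex.
  exists l, n0; elim=> [|n IH]; first by rewrite leqn0 => /eqP n00; rewrite n00 in Wl.
  rewrite leq_eqVlt => /predU1P[<-//|]; rewrite ltnS => n0n.
  have Vl : (W n `|` U n.+1) (pre a l) by left; exact: IH.
  have : covers (W n `|` U n.+1) [set a] by move=> _ ->; exists l.
  move=> /covers_top/(_ a erefl)[l' [Vl' hl']].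
  have ll' : (l <= l')%N.
    apply: min; apply/asboolP; exists n.+1; last by split.
    exact: leq_trans mn0 (leqW n0n).
  have -> : pre a l = pre a l'; last by split.
  exact: hl' (prefix_pre _ ll').
apply: le_trans (cont_le coverWo) _.
apply: ge_ereal_sup => _ [F [finF FW] <-].
(* A finite set of words of [Wo] is present in a single [W n], so [costW] bounds every finite
   partial sum of the cost of [Wo]. *)
have [n Fn] : exists n, F `<=` W n.
  have /finite_seqP[s sE] := finF.
  suff [n hn] : exists n0, forall n, (n0 <= n)%N -> forall p, p \in s -> W n p.
    by exists n => p; rewrite sE; exact: hn.
  have : forall p, p \in s -> Wo p by move=> p ps; apply: FW; rewrite sE.
  elim: s {sE} => [_|p s IH h]; first by exists 0%N.
  have [n1 h1] : exists n0, forall n, (n0 <= n)%N -> forall p, p \in s -> W n p.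
    by apply: IH => q qs; apply: h; rewrite inE qs orbT.
  have [n2 h2] := h p (mem_head _ _).
  exists (maxn n1 n2) => n; rewrite geq_max => /andP[l1 l2] q.
  by rewrite inE => /predU1P[->|qs]; [exact: h2|exact: h1].
apply: (@le_trans _ _ (cost (W n))); first by apply: esum_ge; exists F.
apply: le_trans (costW n) _; apply: leeD => //.
by rewrite lee_fin ler_piMr ?(ltW e0)// gerBl exprn_ge0.
Qed.

End cantor_content.

(** * Borel sets are projections of closed sets *)

Section souslin.
Variables (R : realType) (d : nat).
Local Notation V := 'rV[R]_d.
Implicit Types (D : V -> (nat -> nat) -> Prop) (X : set V).

(* [D] is closed in the product of R^d and the Baire space. *)
Definition closedrel D := forall x s, ~ D x s -> exists e N, 0 < e /\
  forall y t, `|y - x| < e -> (forall i, (i < N)%N -> t i = s i) -> ~ D y t.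

Definition souslin X := exists2 D, closedrel D & forall x, X x <-> exists s, D x s.

Lemma souslin_closed X : closed X -> souslin X.
Proof.
move=> cX; exists (fun x _ => X x); last by move=> x; split=> [|[]//]; exists id.
move=> x s nXx.
have : nbhs x (~` X) by apply: open_nbhs_nbhs; split => //; exact: closed_openC.
rewrite -nbhs_ballE => -[e /= e0 eX]; exists e, 0%N; split => // y t yx _.
by apply: eX; rewrite -ball_normE /= distrC.
Qed.

(** [s 0] encodes a radius: that the ball of radius [1 / (s 0 + 1)] around [x] lies in [X] is a
    closed condition on [x]. *)
Lemma souslin_open X : open X -> souslin X.
Proof.
move=> oX; exists (fun x s => forall y, `|y - x| < (s 0%N).+1%:R^-1 -> X y).
  move=> x s /existsNP[y /not_implyP[yx nXy]].
  exists ((s 0%N).+1%:R^-1 - `|y - x|), 1%N; split; first by rewrite subr_gt0.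
  move=> z t zx ts /(_ y) h; apply/nXy/h; rewrite ts//.
  apply: le_lt_trans (ler_distD x _ _) _; rewrite [`|x - z|]distrC.
  by rewrite addrC -ltrBrDr.
move=> x; split=> [Xx|[s h]]; last by apply: h; rewrite subrr normr0 invr_gt0.
have : nbhs x X by exact: open_nbhs_nbhs.
rewrite -nbhs_ballE => -[e /= e0 eX].
have := near_infty_natSinv_lt (PosNum e0).
case=> n _ /(_ n (leqnn n))/= h; exists (fun=> n) => y yx.
by apply: eX; rewrite -ball_normE /= distrC; exact: lt_trans h.
Qed.

(** The first term of the sequence selects the index and the remaining ones are the witness. *)
Lemma souslin_bigcup (X : nat -> set V) : (forall n, souslin (X n)) ->
  souslin (\bigcup_n X n).
Proof.
move=> sX.
have /choice[D hD] n : exists D, closedrel D /\ forall x, X n x <-> exists s, D x s.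
  by have [D cD XD] := sX n; exists D.
have cD n : closedrel (D n) by case: (hD n).
have XD n x : X n x <-> exists s, D n x s by case: (hD n).
exists (fun x s => D (s 0%N) x (fun i => s i.+1)).
  move=> x s /(cD (s 0%N))[e [N [e0 h]]]; exists e, N.+1; split => // y t yx ts.
  by rewrite ts//; apply: h => // i iN; exact: ts.
move=> x; split=> [[n _ /XD[s h]]|[s h]].
  by exists (fun i => if i is j.+1 then s j else n).
by exists (s 0%N) => //; apply/XD; exists (fun i => s i.+1).
Qed.

(** One sequence carries a witness for every [n], through the coding of pairs by [pickle]; refuting
    one of them uses finitely many terms. *)
Lemma souslin_bigcap (X : nat -> set V) : (forall n, souslin (X n)) ->
  souslin (\bigcap_n X n).
Proof.
move=> sX.
have /choice[D hD] n : exists D, closedrel D /\ forall x, X n x <-> exists s, D x s.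
  by have [D cD XD] := sX n; exists D.
have cD n : closedrel (D n) by case: (hD n).
have XD n x : X n x <-> exists s, D n x s by case: (hD n).
exists (fun x s => forall n, D n x (fun i => s (pickle (n, i)))).
  move=> x s /existsNP[n /cD[e [N [e0 h]]]].
  exists e, (\max_(i < N) (pickle (n, (i : nat))).+1); split => // y t yx ts /(_ n).
  apply: h => // i iN; apply: ts.
  by have := @leq_bigmax _ (fun i : 'I_N => (pickle (n, (i : nat))).+1) (Ordinal iN).
move=> x; split=> [Xx|[s h] n _]; last by apply/XD; exists (fun i => s (pickle (n, i))).
have /choice[s hs] n : exists s, D n x s by apply/XD; exact: Xx.
exists (fun k => if unpickle k is Some (n, i) then s n i else 0%N) => n.
by have -> : (fun i => if unpickle (pickle (n, i)) is Some (m, j) then s m j else 0%N) = s n;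
  [apply/funext => i; rewrite pickleK|].
Qed.

(** The sets that are of this form together with their complements make up a sigma-algebra
    containing the open sets. *)
Lemma souslin_measurable X : measurable (X : set (borelRV R d)) -> souslin X.
Proof.
move=> mX.
pose G := [set Y : set (borelRV R d) | souslin Y /\ souslin (~` Y)].
suff : G X by case.
apply: (mX G); split; last first.
  by move=> Y oY; split; [exact: souslin_open|apply: souslin_closed; exact: open_closedC].
split.
- by split; [apply: souslin_open; exact: open0|rewrite setC0; apply: souslin_open; exact: openT].
- by move=> Y [Y1 Y2]; rewrite setTD; split => //; rewrite setCK.
move=> F hF; split; first by apply: souslin_bigcup => n; case: (hF n).
by rewrite setC_bigcup; apply: souslin_bigcap => n; case: (hF n).
Qed.

(** Konig's lemma. A prefix with property [Bad] extends to bounded witnesses at points arbitrarily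
    near [x]; its next term has at most [n l + 1] values, so one of them keeps the property. The
    resulting branch is a witness at [x] because [D] is closed. *)
Lemma closedrel_konig D (n : nat -> nat) (x : V) : closedrel D ->
  (forall k, exists y t, [/\ `|y - x| < k.+1%:R^-1, D y t &
     forall i, (i < k)%N -> (t i <= n i)%N]) ->
  exists s, D x s.
Proof.
move=> cD hx.
pose Bad (p : seq nat) := forall k, exists y t, [/\ `|y - x| < k.+1%:R^-1, D y t,
  forall i, (i < size p)%N -> t i = nth 0%N p i & forall i, (i < k)%N -> (t i <= n i)%N].
have Bad0 : Bad [::] by move=> k; have [y [t [h1 h2 h3]]] := hx k; exists y, t.
have BadS (p : {p | Bad p}) : exists j, Bad (rcons (sval p) j).
  case: p => p /= Bp; apply: contrapT => /forallNP h.
  have /choice[k hk] j : exists k, ~ exists y t, [/\ `|y - x| < k.+1%:R^-1, D y t,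
      forall i, (i < size (rcons p j))%N -> t i = nth 0%N (rcons p j) i &
      forall i, (i < k)%N -> (t i <= n i)%N].
    by apply/existsNP; exact: h.
  set l := size p.
  pose K := maxn l.+1 (\max_(j < (n l).+1) k j).
  have [y [t [h1 h2 h3 h4]]] := Bp K.
  have tl : (t l < (n l).+1)%N by rewrite ltnS; apply: h4; rewrite leq_max ltnSn.
  have kK : (k (t l) <= K)%N.
    by rewrite leq_max; apply/orP; right; exact: (@leq_bigmax _ (fun j : 'I_(n l).+1 => k j) (Ordinal tl)).
  apply: (hk (t l)); exists y, t; split => //.
  - by apply: lt_le_trans h1 _; rewrite lef_pV2 ?posrE// ler_nat ltnS.
  - move=> i; rewrite size_rcons ltnS leq_eqVlt nth_rcons => /predU1P[->|il].
      by rewrite ltnn eqxx.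
    by rewrite il h3.
  - by move=> i ik; apply: h4; exact: leq_trans kK.
have [j hj] := choice BadS.
pose next p : {p | Bad p} := exist _ _ (hj p).
pose P m : {p | Bad p} := iter m next (exist _ _ Bad0).
pose s i := j (P i).
have PE m : sval (P m) = mkseq s m.
  by elim: m => // m IH; rewrite /P iterS /= -/(P m) IH mkseqS.
exists s; apply: contrapT => /cD[e [N [e0 h]]].
have := near_infty_natSinv_lt (PosNum e0).
case=> k _ /(_ k (leqnn k))/= ke.
have [y [t [h1 h2 h3 _]]] := svalP (P N) k.
apply: (h y t) => //; first exact: lt_trans ke.
move=> i iN; rewrite h3 PE ?size_mkseq//.
by rewrite nth_mkseq.
Qed.

End souslin.

(** * An additive mass on the binary tree *)

Section tree_mass.
Variables (R : realType) (w : nat -> R) (d : nat).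
Hypothesis w0 : forall n, 0 <= w n.
Variables (psi : (nat -> bool) -> 'rV[R]_d) (D : 'rV[R]_d -> (nat -> nat) -> Prop).

Definition bounded_part (b : seq nat) : set (nat -> bool) :=
  [set a | exists2 s, D (psi a) s & forall i, (i < size b)%N -> (s i <= nth 0%N b i)%N].

Let c b p : R := fine (cont w (bounded_part b `&` cyl p)).

Let cE b p : cont w (bounded_part b `&` cyl p) = (c b p)%:E.
Proof. by rewrite fineK// cont_fin. Qed.

Let c0 b p : 0 <= c b p.
Proof. by rewrite -lee_fin -cE cont_ge0. Qed.

Let bounded_part_mono b n n' : (n <= n')%N ->
  bounded_part (rcons b n) `<=` bounded_part (rcons b n').
Proof.
move=> nn' a [s Ds hs]; exists s => // i ib.
have := hs i; rewrite !size_rcons !nth_rcons in ib * => /(_ ib).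
by case: ltnP => // _; case: eqP => // _ /leq_trans; apply.
Qed.

Let bounded_part_bigcup b :
  bounded_part b `<=` \bigcup_n bounded_part (rcons b n).
Proof.
move=> a [s Ds hs]; exists (s (size b)) => //; exists s => // i.
rewrite size_rcons ltnS leq_eqVlt nth_rcons => /predU1P[->|ib].
  by rewrite ltnn eqxx.
by rewrite ib; exact: hs.
Qed.

(** Decreases from 1 to [1 / 2]. The fraction of content kept at generation [k] is
    [gam k.+1 / gam k], so the product of all fractions stays above [1 / 2]; hence the factor 2 in
    [tree_mass]. *)
Let gam k : R := 2^-1 + 2^-1 ^+ k.+1.

Let gam_gt k : 2^-1 < gam k.
Proof. by rewrite /gam ltrDl exprn_gt0// invr_gt0. Qed.

Let gamS k : gam k.+1 < gam k.
Proof.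
rewrite /gam ltrD2l (exprS _ k.+1) gtr_pMl ?exprn_gt0 ?invr_gt0//.
by rewrite invf_lt1// ltr1n.
Qed.

(* Almost all the content of every cylinder of generation [size b] survives one more bound. *)
Let next_bound b : exists n, forall p, size p = size b ->
  gam (size b).+1 * c b p <= gam (size b) * c (rcons b n) p.
Proof.
set k := size b.
have g0 j : 0 < gam j by apply: lt_trans (gam_gt j); rewrite invr_gt0.
have H p : exists n, gam k.+1 * c b p <= gam k * c (rcons b n) p.
  have := c0 b p; rewrite le_eqVlt => /predU1P[<-|cp].
    by exists 0%N; rewrite mulr0 mulr_ge0// ltW.
  apply: contrapT => /forallNP h.
  (* If every bound lost too much, [cont_bigcup] would transfer the loss to the increasing union,
     which contains all of [bounded_part b] inside the cylinder. *)
  have : (cont w (\bigcup_n (bounded_part (rcons b n) `&` cyl p)) <= (gam k.+1 / gam k * c b p)%:E)%E.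
    apply: cont_bigcup => //.
      by move=> m n mn; apply: setSI; exact: bounded_part_mono.
    move=> n; rewrite cE lee_fin mulrAC ler_pdivlMr// mulrC.
    by have /negP := h n; rewrite -ltNge => /ltW.
  rewrite -setI_bigcupl => hle.
  have : (cont w (bounded_part b `&` cyl p) <= (gam k.+1 / gam k * c b p)%:E)%E.
    by apply: le_trans hle; apply: cont_subset; apply: setSI; exact: bounded_part_bigcup.
  rewrite cE lee_fin leNgt => /negP; apply.
  by rewrite gtr_pMl// ltr_pdivrMr// mul1r.
have [f hf] := choice H.
(* Only finitely many words have length [k], so one bound serves all. *)
exists (\max_(p : k.-tuple bool) f p) => p pk.
apply: le_trans (hf p) _; rewrite ler_pM2l// -lee_fin -!cE.
apply: cont_subset; apply: setSI; apply: bounded_part_mono.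
have pk' : size p == k by apply/eqP.
exact: (@leq_bigmax _ (fun p : k.-tuple bool => f p) (Tuple pk')).
Qed.

(** Word length and number of bounded coordinates grow together: [C p] is the content, inside
    [cyl p], of the points with a witness bounded in the first [size p] places. Mass is shared among
    children in proportion to [C], so positive mass forces positive content and hence such a
    point. *)
Lemma tree_mass (X : set 'rV[R]_d) : (forall x, X x <-> exists s, D x s) ->
  (0 < cont w (psi @^-1` X))%E ->
  exists (n : nat -> nat) (m : seq bool -> R),
    [/\ forall p, 0 <= m p, 0 < m [::],
     forall p, m p = m (rcons p false) + m (rcons p true),
     forall p, m p <= 2 * w (size p) &
     forall p, 0 < m p -> exists a s, [/\ pre a (size p) = p, D (psi a) s &
       forall i, (i < size p)%N -> (s i <= n i)%N]].
Proof.
move=> XD Xpos.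
have [f hf] := choice next_bound.
pose b := fix b k := if k is k'.+1 then rcons (b k') (f (b k')) else [::].
have sb k : size (b k) = k by elim: k => //= k IH; rewrite size_rcons IH.
pose n k := f (b k).
have nb k i : (i < k)%N -> nth 0%N (b k) i = n i.
  elim: k => // k IH; rewrite ltnS leq_eqVlt /= nth_rcons sb => /predU1P[->|ik].
    by rewrite ltnn eqxx.
  by rewrite ik IH.
pose C p := c (b (size p)) p.
have C0 p : 0 <= C p by exact: c0.
have sum0 p : 0 <= C (rcons p false) + C (rcons p true) by rewrite addr_ge0.
have Cstep p : gam (size p).+1 * C p <= gam (size p) * (C (rcons p false) + C (rcons p true)).
  have := hf (b (size p)) p (esym (sb _)); rewrite sb => /le_trans; apply.
  rewrite ler_wpM2l ?(ltW (lt_trans _ (gam_gt _))) ?invr_gt0//.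
  rewrite -lee_fin EFinD /C !size_rcons -[rcons (b _) _]/(b (size p).+1) -!cE.
  apply: le_trans (contU w0 _ _); apply: cont_subset => a [ha /= pa].
  have := mkseqS a (size p); rewrite -/(pre a _) -/(pre a _) pa.
  by case: (a (size p)) => ?; [right|left]; split; rewrite /cyl //= size_rcons.
pose rho p e := C (rcons p e) / (C (rcons p false) + C (rcons p true)).
have rho0 p e : 0 <= rho p e by rewrite divr_ge0.
pose m p := C [::] * \prod_(i < size p) rho (take i p) (nth false p i).
have mS p e : m (rcons p e) = m p * rho p e.
  rewrite /m size_rcons big_ord_recr/= mulrA; congr (_ * _ * rho _ _).
  - apply: eq_bigr => i _; rewrite nth_rcons ltn_ord.
    by rewrite -cats1 takel_cat// ltnW.
  - by rewrite -cats1 takel_cat// take_size.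
  - by rewrite nth_rcons ltnn eqxx.
have m0 p : 0 <= m p by rewrite mulr_ge0// prodr_ge0.
(* The invariant of the construction: the loss granted in [Cstep] is what turns [gam k] into
   [gam k.+1]. *)
have mle p : gam (size p) * m p <= C p.
  elim/last_ind: p => [|p e IH].
    by rewrite /m big_ord0 mulr1 /gam expr1 (_ : 2^-1 + 2^-1 = 1) ?mul1r//; lra.
  have g1 : 0 < gam (size p) by apply: lt_trans (gam_gt _); rewrite invr_gt0.
  have g2 : 0 < gam (size p).+1 by apply: lt_trans (gam_gt _); rewrite invr_gt0.
  rewrite mS size_rcons mulrA.
  have [s0|sn0] := eqVneq (C (rcons p false) + C (rcons p true)) 0.
    by rewrite /rho s0 invr0 !mulr0.
  have sp : 0 < C (rcons p false) + C (rcons p true) by rewrite lt_neqAle eq_sym sn0 sum0.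
  rewrite /rho mulrA ler_pdivrMr// mulrC ler_wpM2l//.
  rewrite -(ler_pM2l g1); apply: le_trans (Cstep p).
  by rewrite mulrCA ler_wpM2l// ltW.
exists n, m; split => //.
- rewrite /m big_ord0 mulr1 -lte_fin -cE; apply: lt_le_trans Xpos _.
  apply: cont_subset => a /XD[s Ds]; split => //.
  by exists s.
- move=> p; rewrite !mS -mulrDr.
  (* If neither child has content, the shares are 0 by the convention for inverses; additivity
     survives since [Cstep] and [mle] then force [m p = 0]. *)
  have [s0|sn0] := eqVneq (C (rcons p false) + C (rcons p true)) 0; last first.
    by rewrite /rho -mulrDl divff// mulr1.
  rewrite /rho s0 invr0 !mulr0 addr0 mulr0; apply/eqP; rewrite eq_le m0 andbT.
  have g1 : 0 < gam (size p) by apply: lt_trans (gam_gt _); rewrite invr_gt0.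
  have g2 : 0 < gam (size p).+1 by apply: lt_trans (gam_gt _); rewrite invr_gt0.
  have := Cstep p; rewrite s0 mulr0 pmulr_rle0// => Cp.
  by have := le_trans (mle p) Cp; rewrite pmulr_rle0.
- move=> p; have : C p <= w (size p).
    by rewrite -lee_fin -cE; apply: cont_cyl => [k|a []]; [exact: w0|].
  have := gam_gt (size p); have := mle p; have := m0 p.
  move: (gam _) (m p) (C p) (w _) => g x y z h1 h2 h3 h4.
  have : 2^-1 * x <= g * x by rewrite ler_wpM2r// ltW.
  lra.
move=> p mp.
have Cp : 0 < C p.
  apply: lt_le_trans (mle p); rewrite mulr_gt0//.
  by apply: lt_trans (gam_gt _); rewrite invr_gt0.
have [a [[s Ds hs] pa]] : (bounded_part (b (size p)) `&` cyl p) !=set0.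
  apply/set0P; apply/eqP => E; move: Cp; rewrite -lte_fin -cE E => h.
  suff : (cont w set0 <= 0)%E by rewrite leNgt h.
  have : covers set0 set0 by [].
  by move/(cont_le w); rewrite /cost esum_set0.
exists a, s; split => // i ip.
by have := hs i; rewrite sb nb//; apply.
Qed.

End tree_mass.

Lemma takel_rcons (U : Type) (p : seq U) e i : (i <= size p)%N ->
  take i (rcons p e) = take i p.
Proof. by move=> ip; rewrite -cats1 takel_cat. Qed.

(** * The tree mass as an image of Lebesgue measure *)

Section digits.
Variables (R : realType) (m : seq bool -> R).
Hypothesis m0 : forall p, 0 <= m p.
Hypothesis mD : forall p, m p = m (rcons p false) + m (rcons p true).
Local Notation leb := (@lebesgue_measure R).

(* Left end point of the interval of length [m p] attached to [p]; the intervals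
   of the two children of [p] are adjacent and make up that of [p]. *)
Definition ell p : R :=
  \sum_(i < size p) (if nth false p i then m (rcons (take i p) false) else 0).

Lemma ell_rcons p e : ell (rcons p e) = ell p + (if e then m (rcons p false) else 0).
Proof.
rewrite /ell size_rcons big_ord_recr/=; congr (_ + _).
  apply: eq_bigr => i _; rewrite nth_rcons ltn_ord.
  by rewrite takel_rcons// ltnW.
by rewrite nth_rcons ltnn eqxx takel_rcons// take_size.
Qed.

Fixpoint path_at (t : R) n : seq bool :=
  if n is n'.+1 then
    let p := path_at t n' in rcons p (ell p + m (rcons p false) <= t)
  else [::].

Definition digit t n : bool :=
  ell (path_at t n) + m (rcons (path_at t n) false) <= t.

Lemma pre_digit t n : pre (digit t) n = path_at t n.
Proof. by elim: n => //= n IH; rewrite /pre mkseqS -/(pre _ _) IH. Qed.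

Lemma path_at_itv t n : 0 <= t < m [::] ->
  ell (path_at t n) <= t < ell (path_at t n) + m (path_at t n).
Proof.
move=> tI; elim: n => [|n /andP[IH1 IH2]]; first by rewrite /ell big_ord0 add0r.
rewrite /= ell_rcons; have [h|h] := leP (ell (path_at t n) + m (rcons (path_at t n) false)) t.
  by rewrite /= h -addrA -mD.
by rewrite /= addr0 h IH1.
Qed.

Lemma size_path_at t n : size (path_at t n) = n.
Proof. by rewrite -pre_digit size_mkseq. Qed.

Lemma measurable_path_at n p : measurable ([set t | path_at t n = p] : set (measurableTypeR R)).
Proof.
elim: n p => [|n IH] p.
  have [->|np] := eqVneq p [::].
    by rewrite (_ : [set _ | _] = setT)//; apply/seteqP; split.
  rewrite (_ : [set _ | _] = set0)//; apply/seteqP; split => // t /= h.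
  by rewrite -h eqxx in np.
elim/last_ind: p => [|p e _].
  rewrite (_ : [set _ | _] = set0)//; apply/seteqP; split => // t /= h.
  by have := congr1 size h; rewrite size_rcons.
have -> : [set t | path_at t n.+1 = rcons p e] = [set t | path_at t n = p] `&`
    (if e then `[ell p + m (rcons p false), +oo[%classic else `]-oo, ell p + m (rcons p false)[%classic).
  apply/seteqP; split=> t /=.
    move=> /rcons_inj[pp ee]; rewrite pp in ee; split => //.
    by case: e ee; rewrite /= in_itv/= ?andbT// => /negbT; rewrite -ltNge.
  move=> [-> h]; congr rcons; case: e h => /=; rewrite in_itv/= ?andbT// => h.
  by apply/negbTE; rewrite -ltNge.
by apply: measurableI; [exact: IH|case: e; exact: measurable_itv].
Qed.

Lemma leb_path_at n p :
  (leb ([set t | path_at t n = p] `&` `[0%R, m [::][) <= (m p)%:E)%E.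
Proof.
apply: (@le_trans _ _ (leb `[ell p, ell p + m p[%classic)).
  apply: le_measure; rewrite ?inE.
  - by apply: measurableI; [exact: measurable_path_at|exact: measurable_itv].
  - exact: measurable_itv.
  move=> t [<-]; rewrite /= !in_itv/= => tI.
  exact: path_at_itv.
rewrite lebesgue_measure_itv/= lte_fin; case: ltP => _; last by rewrite lee_fin.
by rewrite -EFinB lee_fin addrC addKr.
Qed.

Lemma measurable_digit n : measurable ([set t | digit t n] : set (measurableTypeR R)).
Proof.
have -> : [set t | digit t n] = \bigcup_p ([set t | path_at t n = p] `&`
    `[ell p + m (rcons p false), +oo[%classic).
  apply/seteqP; split=> t /=.
    by move=> h; exists (path_at t n) => //; split => //=; rewrite in_itv/= andbT.
  by case=> p _ [/= <-]; rewrite in_itv/= andbT.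
apply: countable_bigcupT_measurable; first exact: countableP.
by move=> p; apply: measurableI; [exact: measurable_path_at|exact: measurable_itv].
Qed.

End digits.

(** * Binary expansions in R^d *)

Section expansion.
Variables (R : realType) (d : nat).
Hypothesis d0 : (0 < d)%N.
Implicit Types (a : nat -> bool) (k : 'rV[int]_d).

(* The digits of the [d] coordinates are interleaved. *)
Definition bin a (i : 'I_d) (q : nat) : R :=
  \sum_(j < q) (a (d * j + i)%N)%:R * 2^-1 ^+ j.+1.

(** Cantor space is sent into the closed unit cube with corner [k]; the integer translates together
    reach every point. *)
Definition psi k a : 'rV[R]_d :=
  \row_i ((k ord0 i)%:~R + limn (fun q => bin a i q)).

Lemma binS a i q : bin a i q.+1 = bin a i q + (a (d * q + i)%N)%:R * 2^-1 ^+ q.+1.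
Proof. by rewrite /bin big_ord_recr. Qed.

Lemma bin_nd a i : nondecreasing_seq (fun q => bin a i q).
Proof.
apply/nondecreasing_seqP => q; rewrite binS lerDl mulr_ge0// exprn_ge0//.
Qed.

Lemma bin_gap a i q n : (q <= n)%N -> bin a i n + 2^-1 ^+ n <= bin a i q + 2^-1 ^+ q.
Proof.
elim: n => [|n IH]; first by rewrite leqn0 => /eqP ->.
rewrite leq_eqVlt => /predU1P[->//|]; rewrite ltnS => /IH; apply: le_trans.
rewrite binS -addrA lerD2l exprS.
have h : 0 <= 2^-1 ^+ n :> R by rewrite exprn_ge0.
by case: (a _); rewrite ?mul1r ?mul0r; lra.
Qed.

Lemma is_cvg_bin a i : cvgn (fun q => bin a i q).
Proof.
apply: nondecreasing_is_cvgn; first exact: bin_nd.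
exists 1 => _ [q _ <-].
have := @bin_gap a i 0 q (leq0n _); rewrite /bin big_ord0 add0r expr0.
by apply: le_trans; rewrite lerDl exprn_ge0.
Qed.

Lemma psi_bin k a i q :
  bin a i q <= psi k a ord0 i - (k ord0 i)%:~R <= bin a i q + 2^-1 ^+ q.
Proof.
rewrite mxE addrC addKr; apply/andP; split.
  exact: nondecreasing_cvgn_le (@bin_nd a i) (@is_cvg_bin a i) q.
apply: limr_le; first exact: is_cvg_bin.
exists q => // n /= qn; apply: le_trans (bin_gap a i qn).
by rewrite lerDl exprn_ge0.
Qed.

Lemma bin_pre a a' i q : pre a (d * q) = pre a' (d * q) -> bin a i q = bin a' i q.
Proof.
move=> aa; apply: eq_bigr => j _; congr (_%:R * _).
have jq : (d * j + i < d * q)%N.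
  have : (d * j + d <= d * q)%N by rewrite addnC -mulnS leq_mul2l ltn_ord orbT.
  by apply: leq_trans; rewrite ltn_add2l.
have := congr1 (nth false ^~ (d * j + i)%N) aa.
by rewrite !nth_mkseq// => ->.
Qed.

Lemma psi_pre k a a' q : pre a (d * q) = pre a' (d * q) ->
  `|psi k a - psi k a'| <= 2^-1 ^+ q.
Proof.
move=> aa; apply: norm_le_coord; first by rewrite exprn_ge0.
move=> i; rewrite (_ : (psi k a - psi k a') ord0 i = psi k a ord0 i - psi k a' ord0 i); last by rewrite !mxE.
have /andP[h1 h2] := psi_bin k a i q; have /andP[h3 h4] := psi_bin k a' i q.
rewrite (bin_pre i aa) in h1 h2.
rewrite ler_norml; apply/andP; split; lra.
Qed.

Fixpoint natbin a (i : 'I_d) q : nat :=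
  if q is q'.+1 then (natbin a i q').*2 + a (d * q' + i)%N else 0%N.

Lemma natbinE a i q : bin a i q = (natbin a i q)%:R * 2^-1 ^+ q.
Proof.
elim: q => [|q IH]; first by rewrite /bin big_ord0 mul0r.
rewrite binS IH /= natrD -muln2 natrM mulrDl; congr (_ + _).
by rewrite exprS mulrA mulfK// pnatr_eq0.
Qed.

Lemma natbin_inj a a' q : (forall i, natbin a i q = natbin a' i q) ->
  pre a (d * q) = pre a' (d * q).
Proof.
elim: q => [|q IH] h; first by rewrite muln0.
have h2 i : natbin a i q = natbin a' i q /\ a (d * q + i)%N = a' (d * q + i)%N.
  have /= := h i; case: (a _); case: (a' _) => /= e; split => //; lia.
have aq := IH (fun i => (h2 i).1).
apply: (@eq_from_nth _ false); rewrite !size_mkseq// => l lq.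
rewrite !nth_mkseq//; have [l1|l1] := ltnP l (d * q).
  by have := congr1 (nth false ^~ l) aq; rewrite !nth_mkseq.
have ld : (l - d * q < d)%N by rewrite mulnS in lq; lia.
have := (h2 (Ordinal ld)).2; rewrite /= subnKC//.
Qed.

Lemma psi_surj (x : 'rV[R]_d) : exists a,
  psi (\row_i Num.floor (x ord0 i)) a = x.
Proof.
(* Greedy binary expansion: [r q i] is the remainder after [q] digits, rescaled to [[0, 1)]. *)
pose r := fix r q i : R := if q is q'.+1 then
  let y := 2 * r q' i in if 1 <= y then y - 1 else y
  else x ord0 i - (Num.floor (x ord0 i))%:~R.
pose a (l : nat) := 1 <= 2 * r (l %/ d)%N (Ordinal (ltn_pmod l d0)).
have aE q (i : 'I_d) : a (d * q + i)%N = (1 <= 2 * r q i).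
  rewrite /a; congr (_ <= 2 * r _ _).
    by rewrite mulnC divnMDl// divn_small// addn0.
  by apply: val_inj; rewrite /= mulnC modnMDl modn_small.
have rI q i : 0 <= r q i < 1.
  elim: q => [|q /andP[h1 h2]] /=.
    by rewrite subr_ge0 floor_le_tmp/= ltrBlDl -[X in _ + X]/(1%:~R) -intrD floorD1_gt.
  by case: ifPn => h; rewrite -?ltNge in h; apply/andP; split; lra.
have rE q i : x ord0 i - (Num.floor (x ord0 i))%:~R = bin a i q + 2^-1 ^+ q * r q i.
  elim: q => [|q IH]; first by rewrite /bin big_ord0 add0r expr0 mul1r.
  rewrite IH binS aE /= exprS -addrA; congr (_ + _).
  by case: (1 <= _); rewrite ?mul1r ?mul0r; field.
exists a; apply/rowP => i; rewrite !mxE.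
rewrite -[RHS](subrKC (Num.floor (x ord0 i))%:~R); congr (_ + _).
apply: cvg_lim => //; set y := x ord0 i - _.
have hz : (fun q => y - 2^-1 ^+ q) q @[q --> \oo] --> y.
  rewrite -[X in _ --> X]subr0; apply: cvgB; first exact: cvg_cst.
  by apply: cvg_expr; rewrite ger0_norm ?invf_lt1 ?ltr1n.
apply: (squeeze_cvgr _ hz (@cvg_cst _ y _ _ _)).
near=> q; rewrite /y (rE q i).
have /andP[h1 h2] := rI q i.
have h3 : 0 <= 2^-1 ^+ q :> R by rewrite exprn_ge0.
apply/andP; split.
  rewrite lerBlDr lerD2l; have := ler_wpM2l h3 (ltW h2); lra.
by rewrite lerDl mulr_ge0.
Unshelve. all: by end_near. Qed.

End expansion.

Lemma measurable_borelRV (R : realType) d dT (T : measurableType dT) (f : T -> borelRV R d) :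
  (forall i : 'I_d, measurable_fun setT (fun t => (f t : 'rV[R]_d) ord0 i)) ->
  measurable_fun setT f.
Proof.
move=> mf.
apply: (@measurability _ _ _ (borelRV R d) setT f (@open 'rV[R]_d) erefl).
move=> _ [U oU <-]; rewrite setTI.
pose B (k : 'rV[rat]_d * nat) : set T := if `[< ball (map_mx ratr k.1 : 'rV[R]_d) k.2.+1%:R^-1 `<=` U >]
  then \bigcap_(i in [set: 'I_d]) ((fun t => (f t : 'rV[R]_d) ord0 i) @^-1`
    `](ratr (k.1 ord0 i) - k.2.+1%:R^-1)%R, (ratr (k.1 ord0 i) + k.2.+1%:R^-1)%R[%classic)
  else set0.
have ballE (k : 'rV[rat]_d * nat) t : (forall i, ((f t : 'rV[R]_d) ord0 i) \in
     `](ratr (k.1 ord0 i) - k.2.+1%:R^-1)%R, (ratr (k.1 ord0 i) + k.2.+1%:R^-1)%R[) <->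
    ball (map_mx ratr k.1 : 'rV[R]_d) k.2.+1%:R^-1 (f t).
  split=> [h|/ball_rVP[_ h] i].
    apply/ball_rVP; split=> [|i]; first by rewrite invr_gt0.
    by have := h i; rewrite in_itv/= -ltr_distl /ball/= mxE distrC.
  by have := h i; rewrite in_itv/= -ltr_distl /ball/= mxE distrC.
have -> : f @^-1` U = \bigcup_k B k.
  apply/seteqP; split=> t.
    move=> Ut; have [k [kt kU]] := open_rational_ball oU Ut.
    exists k => //; rewrite /B asboolT// => i _ /=.
    exact: (iffRL (ballE k t) kt).
  case=> k _; rewrite /B; case: asboolP => // kU h; apply: kU.
  by apply/ballE => i; exact: (h i I).
apply: countable_bigcupT_measurable; first exact: countableP.
move=> k; rewrite /B; case: asboolP => // _.
apply: fin_bigcap_measurable => // i _.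
by rewrite -[X in measurable X]setTI; apply: mf => //; exact: measurable_itv.
Qed.

(** * Frostman measures *)

Section image_measure.
Variables (R : realType) (d : nat) (Phi : measurableTypeR R -> borelRV R d).
Local Notation leb := (@lebesgue_measure R).

Definition imleb (mPhi : measurable_fun setT Phi) (l : R) (A : set (borelRV R d)) : \bar R :=
  leb ((Phi @^-1` A) `&` `[0%R, l[%classic).

Variables (mPhi : measurable_fun setT Phi) (l : R).
Local Notation nu := (imleb mPhi l).

Let mpre A : measurable A -> measurable ((Phi @^-1` A) `&` `[0%R, l[%classic : set (measurableTypeR R)).
Proof.
move=> mA; apply: measurableI; last exact: measurable_itv.
by rewrite -[X in measurable X]setTI; exact: mPhi.
Qed.

Let nu0 : nu set0 = 0%E.
Proof. by rewrite /imleb preimage_set0 set0I measure0. Qed.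

Let nu_ge0 A : (0 <= nu A)%E.
Proof. exact: measure_ge0. Qed.

Let nu_sigma_additive : semi_sigma_additive nu.
Proof.
move=> F mF tF mUF; rewrite /imleb preimage_bigcup setI_bigcupl.
apply: measure_semi_sigma_additive.
- by move=> n; exact: mpre.
- apply/trivIsetP => i j _ _ ij; apply/seteqP; split=> // t /= [[h1 _] [h2 _]].
  have /trivIsetP/(_ i j Logic.I Logic.I ij) E := tF.
  have : (F i `&` F j) (Phi t) by [].
  by rewrite E.
- rewrite -setI_bigcupl -preimage_bigcup; exact: mpre.
Qed.

HB.instance Definition _ := isMeasure.Build _ _ _ nu nu0 nu_ge0 nu_sigma_additive.

Let nu_fin : fin_num_fun nu.
Proof.
move=> A mA; rewrite ge0_fin_numE//.
apply: (@le_lt_trans _ _ (leb `[0%R, l[%classic)).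
  by apply: le_measure; rewrite ?inE; [exact: mpre|exact: measurable_itv|].
by rewrite lebesgue_measure_itv/=; case: ifP => _; rewrite -?EFinB ltry.
Qed.

HB.instance Definition _ := Measure_isFinite.Build _ _ _ nu nu_fin.

End image_measure.

Section frostman.
Variables (R : realType) (d : nat).
Hypothesis d0 : (0 < d)%N.
Local Notation T := (borelRV R d).
Local Notation leb := (@lebesgue_measure R).

(* As digits are interleaved, a cylinder of length [n] has diameter of order 2^(-n/d). *)
Definition wgt (s : R) (n : nat) : R := 2 `^ (- (n%:R * s / d%:R)).

Lemma wgt_ge0 s n : 0 <= wgt s n. Proof. exact: powR_ge0. Qed.

Lemma wgt_mul s q : wgt s (d * q) = (2^-1 ^+ q) `^ s.
Proof.
rewrite /wgt natrM.
have -> : - (d%:R * q%:R * s / d%:R) = - q%:R * s :> R.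
  by field; rewrite pnatr_eq0 -lt0n.
by rewrite powRrM powR_invn// exprVn.
Qed.

Lemma measurable_psi_digit (m : seq bool -> R) (k : 'rV[int]_d) :
  measurable_fun setT ((fun t => psi R k (digit m t)) : measurableTypeR R -> T).
Proof.
apply: measurable_borelRV => i.
have -> : (fun t : measurableTypeR R => psi R k (digit m t) ord0 i) =
    (fun t => (k ord0 i)%:~R + limn (fun q => bin R (digit m t) i q)).
  by apply/funext => t; rewrite mxE.
apply: measurable_funD => //.
apply: (measurable_fun_cvg (h := fun q t => bin R (digit m t) i q)).
  move=> q; apply: measurable_sum => j; apply: measurable_funM => //.
  have -> : (fun t : measurableTypeR R => (digit m t (d * j + i)%N)%:R : R) =
      \1_([set t | digit m t (d * j + i)%N]).
    apply/funext => t; rewrite indicE; case: (boolP (digit m t _)) => h.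
      by rewrite mem_set.
    by rewrite memNset//= => /=; exact/negP.
  by apply: measurable_indic; exact: measurable_digit.
by move=> t _; exact: is_cvg_bin.
Qed.

Lemma frostman (X : set 'rV[R]_d) (k : 'rV[int]_d) s : souslin X ->
  (0 < cont (wgt s) (psi R k @^-1` X))%E ->
  exists2 mu : {finite_measure set T -> \bar R}, carried X mu &
    exists2 C, 0 <= C & forall (x : T) q,
      (mu (cube (x : 'rV[R]_d) (2^-1 ^+ q)) <= (C * (2^-1 ^+ q) `^ s)%:E)%E.
Proof.
move=> [D cD XD] Xpos.
have [n [m [m0 mnil mD mw hm]]] := tree_mass (@wgt_ge0 s) XD Xpos.
pose Phi : measurableTypeR R -> T := fun t => psi R k (digit m t).
have mPhi : measurable_fun setT Phi by exact: measurable_psi_digit.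
pose mu := imleb mPhi (m [::]).
have posm t q : 0 <= t < m [::] -> 0 < m (path_at m t q).
  by move=> tI; have /andP[h1 h2] := path_at_itv mD q tI; lra.
exists mu; first split.
- rewrite /= /imleb preimage_setT setTI lebesgue_measure_itv/= lte_fin mnil.
  by rewrite -EFinB subr0 lte_fin.
(* Each ball around a point [x] of the support contains some [Phi t], and the words of [t] have
   positive mass. The word of length [d * q] then yields a point [psi a] within [2^-q] of [Phi t]
   having a witness bounded in its first [K] terms. *)
- move=> x xs; apply/XD; apply: (closedrel_konig (n := n) cD) => K.
  have e0 : 0 < K.+1%:R^-1 / 2 :> R by rewrite divr_gt0.
  have : (0 < mu (ball (x : 'rV[R]_d) (K.+1%:R^-1 / 2)))%E.
    by apply: xs; [exact: ball_open|exact: ballxx].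
  move=> mupos.
  have [t [tI tx]] : exists t, 0 <= t < m [::] /\ `|x - Phi t| < K.+1%:R^-1 / 2.
    apply: contrapT => /forallNP h; move: mupos; rewrite /mu /= /imleb.
    rewrite (_ : _ `&` _ = set0) ?measure0 ?ltxx//.
    apply/seteqP; split=> // t [/= h1]; rewrite in_itv/= => h2.
    by apply: (h t); split => //; move: h1; rewrite -ball_normE.
  have [q Kq qe] : exists2 q, (K <= q)%N & 2^-1 ^+ q < K.+1%:R^-1 / 2 :> R.
    have : 2^-1 ^+ q @[q --> \oo] --> (0 : R).
      by apply: cvg_expr; rewrite ger0_norm ?invf_lt1 ?ltr1n.
    move=> /cvgrPdist_lt /(_ _ e0)[N _ hN].
    exists (maxn K N); first exact: leq_maxl.
    have := hN (maxn K N) (leq_maxr _ _).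
    by rewrite /= sub0r normrN ger0_norm// exprn_ge0.
  have [a [sg [pa Da hs]]] := hm _ (posm t (d * q)%N tI).
  rewrite size_path_at in pa hs.
  exists (psi R k a), sg; split => //.
    apply: le_lt_trans (ler_distD (Phi t) _ _) _.
    have h1 : `|psi R k a - Phi t| <= 2^-1 ^+ q.
      by apply: psi_pre; rewrite pa pre_digit.
    rewrite [ltRHS]splitr; apply: ltrD; first exact: le_lt_trans h1 qe.
    by rewrite distrC.
  move=> i iK; apply: hs; apply: leq_trans iK (leq_trans Kq _).
  by rewrite leq_pmull.
(* A cube of radius 2^-q meets at most 5 dyadic intervals of length 2^-q in each coordinate. *)
exists (\sum_(e <- finmap.enum_fset (fset_set [set: {ffun 'I_d -> 'I_5}])) 2); first exact: sumr_ge0.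
move=> x q.
pose z i : int := Num.floor (2 ^+ q * ((x : 'rV[R]_d) ord0 i - (k ord0 i)%:~R)) - 2.
pose N (t : R) (i : 'I_d) := natbin (digit m t) i q.
pose I0 : set (measurableTypeR R) := `[0, m [::][%classic.
(* The integers [N t] determine the word of length [d * q] by [natbin_inj], so each [S e] belongs to
   at most one word and [leb_path_at] bounds its measure. *)
pose S (e : {ffun 'I_d -> 'I_5}) : set (measurableTypeR R) :=
  if pselect (exists t, forall i, (N t i)%:Z = z i + (e i : nat)%:Z) is left h
  then [set t | path_at m t (d * q) = path_at m (projT1 (cid h)) (d * q)] `&` I0 else set0.
have mS e : measurable (S e).
  rewrite /S; case: pselect => // h.
  by apply: measurableI; [exact: measurable_path_at|exact: measurable_itv].
have lebS e : (leb (S e) <= (2 * (2^-1 ^+ q) `^ s)%:E)%E.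
  rewrite /S; case: pselect => [h|_]; last by rewrite measure0 lee_fin mulr_ge0 ?powR_ge0.
  apply: le_trans (leb_path_at m0 mD _ _) _.
  by rewrite lee_fin -wgt_mul; apply: le_trans (mw _) _; rewrite size_path_at.
have sub : (Phi @^-1` (cube (x : 'rV[R]_d) (2^-1 ^+ q))) `&` I0 `<=` \bigcup_e S e.
  move=> t [/= xt tI].
  have hN i : z i <= (N t i)%:Z < z i + 5.
    have /andP[h1 h2] := psi_bin R k (digit m t) i q.
    have h3 := xt i; rewrite -/(Phi t) in h1 h2.
    move: h1 h2 h3; rewrite natbinE -/(N t i).
    set y := (Phi t : 'rV[R]_d) ord0 i; set xi := (x : 'rV[R]_d) ord0 i; set ki := (k ord0 i)%:~R.
    have P0 : 0 < 2 ^+ q :> R by rewrite exprn_gt0.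
    rewrite exprVn => h1 h2 h3.
    have g1 : (N t i)%:R <= 2 ^+ q * (y - ki) by rewrite mulrC -ler_pdivrMr.
    have g2 : 2 ^+ q * (y - ki) <= (N t i)%:R + 1.
      by rewrite mulrC -ler_pdivlMr// mulrDl mul1r.
    have g3 : 2 ^+ q * `|y - xi| <= 1 by rewrite mulrC -ler_pdivlMr// mul1r.
    have g4 : 2 ^+ q * (y - ki) = 2 ^+ q * (xi - ki) + 2 ^+ q * (y - xi) by ring.
    have g5 : `|2 ^+ q * (y - xi)| <= 1 by rewrite normrM (ger0_norm (ltW P0)).
    have := g5; rewrite ler_norml => /andP[g6 g7].
    rewrite /z; set u := 2 ^+ q * (xi - ki) in g4 *.
    have f1 : (Num.floor u)%:~R <= u by exact: floor_le_tmp.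
    have f2 : u < (Num.floor u)%:~R + 1 by rewrite -[X in _ + X]/(1%:~R) -intrD floorD1_gt.
    apply/andP; split.
      rewrite -(ler_int R) rmorphB/= -pmulrn; lra.
    rewrite -(ltr_int R) rmorphD rmorphB/= -!pmulrn; lra.
  have hj i : exists j : 'I_5, (N t i)%:Z = z i + (j : nat)%:Z.
    have /andP[h1 h2] := hN i.
    have lt5 : (`|((N t i)%:Z - z i)%R|%N < 5)%N by lia.
    exists (Ordinal lt5) => /=; lia.
  have [j hj'] := choice hj.
  pose e : {ffun 'I_d -> 'I_5} := [ffun i => j i].
  exists e => //; rewrite /S; case: pselect => [h|]; last first.
    by case; exists t => i; rewrite ffunE.
  case: (cid h) => t' /= ht'; split => //=.
  rewrite -!pre_digit; apply: natbin_inj => // i.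
  have := ht' i; rewrite ffunE -hj' /N => h'; lia.
rewrite /mu /= /imleb.
apply: (@le_trans _ _ (\sum_(e \in [set: {ffun 'I_d -> 'I_5}]) leb (S e))%E).
  apply: content_sub_fsum => //.
  - exact: finite_finset.
  - apply: measurableI; last exact: measurable_itv.
    by rewrite -[X in measurable X]setTI; apply: (mPhi measurableT); exact: measurable_cube.
apply: (@le_trans _ _ (\sum_(e \in [set: {ffun 'I_d -> 'I_5}]) (2 * (2^-1 ^+ q) `^ s)%:E)%E).
  by apply: lee_fsum => [|e _]; [exact: finite_finset|exact: lebS].
rewrite fsbig_finite//=.
rewrite sumEFin lee_fin.
by rewrite mulr_suml.
Qed.

End frostman.

(** * From growth on cubes to finite energies *)

Section potential.
Variable R : realType.
Local Notation leb := (@lebesgue_measure R).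

Lemma integral_oneDsqrV : (\int[leb]_v ((oneDsqr v)^-1)%:E = pi%:E)%E.
Proof.
rewrite (@ge0_symfun_integralT R (fun v => (oneDsqr v)^-1)).
- rewrite -set_itvcy integral0y_oneDsqr -EFinM; congr (_%:E); by field.
- by move=> v; rewrite invr_ge0 (le_trans ler01).
- exact: continuous_oneDsqrV.
- by move=> v; rewrite /= /oneDsqr sqrrN.
Qed.

Variable d : nat.
Local Notation T := (borelRV R d).

Definition cauchyd (v : 'rV[R]_d) : R := \prod_(i < d) (oneDsqr (v ord0 i))^-1.

Lemma cauchyd_ge0 v : 0 <= cauchyd v.
Proof. by apply: prodr_ge0 => i _; rewrite invr_ge0 (le_trans ler01). Qed.

Lemma measurable_cauchyd : measurable_fun setT (fun v : T => cauchyd (v : 'rV[R]_d)).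
Proof.
apply: (@measurable_prod_coord _ _ (fun _ v => (oneDsqr v)^-1)) => i.
by apply: continuous_measurable_fun; exact: continuous_oneDsqrV.
Qed.

Lemma integral_cauchyd : (\int[@lebRV R d]_v (cauchyd (v : 'rV[R]_d))%:E = (pi ^+ d)%:E)%E.
Proof.
rewrite (@ge0_integral_lebRV_prod _ _ (fun _ v => (oneDsqr v)^-1) (fun=> pi)).
- by rewrite prodr_const card_ord.
- by move=> i; apply: continuous_measurable_fun; exact: continuous_oneDsqrV.
- by move=> i v; rewrite invr_ge0 (le_trans ler01).
- by move=> i; exact: integral_oneDsqrV.
Qed.

(** In each coordinate, [1 + b^2 <= 3 (1 + a^2)] as soon as [|b - a| <= 1]. *)
Lemma cauchyd_near (u v : 'rV[R]_d) : cube u 1 v -> cauchyd u <= 3 ^+ d * cauchyd v.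
Proof.
move=> uv; rewrite -[d in 3 ^+ d]card_ord -prodr_const -big_split/=.
apply: ler_prod => i _; rewrite invr_ge0 (le_trans ler01)//=.
rewrite -ler_pdivrMl// -invfM lef_pV2 ?posrE ?mulr_gt0 ?(lt_le_trans ltr01)//; last by rewrite ler1n.
have := uv i; set a := u _ _; set b := (v : 'rV[R]_d) _ _ => ab.
rewrite /oneDsqr; have : (b - a) ^+ 2 <= 1 by rewrite -real_normK ?num_real// expr_le1.
have := sqr_ge0 (b - 2 * a); nra.
Qed.

Lemma ktrid_ub r (a : 'rV[R]_d) : 0 < r ->
  ktrid r a <= (5 * r^-1) ^+ d * cauchyd (r^-1 *: a).
Proof.
move=> r0; rewrite -[d in _ ^+ d]card_ord -prodr_const -big_split/=.
apply: ler_prod => i _; rewrite ktri_ge0//=; apply: le_trans (ktri_ub _ r0) _.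
rewrite ler_wpM2l ?mulr_ge0 ?invr_ge0 ?(ltW r0)//.
rewrite lef_pV2 ?posrE ?(lt_le_trans ltr01) ?lerDl ?sqr_ge0//.
rewrite /oneDsqr lerD2l mxE.
have -> : 2 * pi * a ord0 i / r = (2 * pi) * (r^-1 * a ord0 i) by ring.
rewrite [leRHS]exprMn ler_peMl ?sqr_ge0// exprn_ege1//; have := @pi_ge2 R; lra.
Qed.

(* The kernel is at most an average over [v], with weight [cauchyd v], of indicators of
   cubes centred at [x - r v], so a bound on cubes bounds the potential. *)
Lemma integral_ktrid_le (mu : {finite_measure set T -> \bar R}) r K (x : 'rV[R]_d) :
  0 < r -> 0 <= K -> (forall c : 'rV[R]_d, mu (cube c r) <= K%:E)%E ->
  (\int[mu]_y (ktrid r (x - (y : 'rV[R]_d)))%:E <= ((15 / 2 * pi * r^-1) ^+ d * K)%:E)%E.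
Proof.
move=> r0 K0 muK.
(* Per coordinate: 5 from [ktrid_ub], 3 from [cauchyd_near], divided by the side 2 of the cube of
   radius 1 over which the average is taken. *)
pose A : R := (15 / 2 * r^-1) ^+ d.
have A0 : 0 <= A by rewrite exprn_ge0// mulr_ge0 ?invr_ge0 ?(ltW r0).
pose u (y : T) : 'rV[R]_d := r^-1 *: (x - (y : 'rV[R]_d)).
pose E : set (T * T) := [set p | cube (u p.1) 1 p.2].
have mE : measurable E.
  have -> : E = \bigcap_(i in [set: 'I_d])
     ((fun p : T * T => (p.2 : 'rV[R]_d) ord0 i - r^-1 * (x ord0 i - (p.1 : 'rV[R]_d) ord0 i)) @^-1` `[-1, 1]).
    apply/seteqP; split=> [p h i _|p h i]/=.
      by have := h i; rewrite /u !mxE in_itv/= -ler_norml.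
    by have := h i I; rewrite /= in_itv/= -ler_norml /u !mxE.
  apply: fin_bigcap_measurable => // i _; rewrite -[X in measurable X]setTI.
  have mp1 : measurable_fun setT (fun p : T * T => (p.1 : 'rV[R]_d) ord0 i).
    by apply: (measurableT_comp (f := fun x : T => (x : 'rV[R]_d) ord0 i)); [exact: measurable_coord|].
  have mp2 : measurable_fun setT (fun p : T * T => (p.2 : 'rV[R]_d) ord0 i).
    by apply: (measurableT_comp (f := fun x : T => (x : 'rV[R]_d) ord0 i)); [exact: measurable_coord|].
  apply: (measurable_funB mp2 _ measurableT); last exact: measurable_itv.
  by apply: measurable_funM => //; apply: measurable_funB.
pose g (p : T * T) : \bar R := ((A * cauchyd (p.2 : 'rV[R]_d)) * \1_E p)%:E.
have g0 p : (0 <= g p)%E by rewrite lee_fin !mulr_ge0// cauchyd_ge0.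
have mg : measurable_fun setT g.
  apply/measurable_EFinP; apply: measurable_funM; last exact: measurable_indic.
  apply: measurable_funM => //.
  by apply: (measurableT_comp (f := fun x : T => cauchyd (x : 'rV[R]_d))); [exact: measurable_cauchyd|].
have gi (y : T) : ((ktrid r (x - (y : 'rV[R]_d)))%:E <= \int[@lebRV R d]_v g (y, v))%E.
  pose B := (5 * r^-1) ^+ d * cauchyd (u y).
  have B0 : 0 <= B by rewrite mulr_ge0 ?cauchyd_ge0 ?exprn_ge0 ?mulr_ge0 ?invr_ge0 ?(ltW r0).
  apply: (@le_trans _ _ B%:E); first by rewrite lee_fin; exact: ktrid_ub.
  have mc : measurable (cube (u y) 1) by exact: measurable_cube.
  apply: (@le_trans _ _ (\int[@lebRV R d]_v ((B / 2 ^+ d) * \1_(cube (u y) 1) v)%:E)%E).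
    under eq_integral do rewrite EFinM.
    rewrite ge0_integralZl_EFin//; last 2 first.
    - by apply/measurable_EFinP; exact: measurable_indic.
    - by rewrite divr_ge0.
    rewrite integral_indic// setIT.
    have lc : @lebRV R d (cube (u y) 1) = (2 ^+ d)%:E by rewrite -[2]mulr1; apply: lebRV_cube.
    rewrite [X in (_ * X)%E](_ : _ = (2 ^+ d)%:E); last exact: lc.
    by rewrite -EFinM divfK// expf_neq0.
  apply: ge0_le_integral => //.
  - by move=> v _; rewrite lee_fin mulr_ge0// divr_ge0.
  - by apply/measurable_EFinP; apply: measurable_funM => //; exact: measurable_indic.
  - by apply: (measurableT_comp mg); exact: pair1_measurable.
  move=> v _; rewrite lee_fin /g !indicE.
  case: (boolP (v \in _)) => [|_]; last by rewrite mulr0 !mulr_ge0// cauchyd_ge0.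
  rewrite inE => uv; rewrite [(y, v) \in E]mem_set//= !mulr1.
  rewrite /B /A ler_pdivrMr ?exprn_gt0//.
  apply: le_trans (ler_wpM2l _ (cauchyd_near uv)) _.
    by rewrite exprn_ge0// mulr_ge0 ?invr_ge0 ?(ltW r0).
  rewrite le_eqVlt; apply/orP; left; apply/eqP.
  rewrite mulrA -exprMn [RHS]mulrAC -exprMn; congr (_ ^+ _ * _); by field; rewrite gt_eqF.
apply: (@le_trans _ _ (\int[mu]_y \int[@lebRV R d]_v g (y, v))%E).
  apply: ge0_le_integral => //.
  - by move=> y _; rewrite lee_fin ktrid_ge0.
  - apply/measurable_EFinP; apply: (@measurable_ktrid R _ T d (fun y : T => x - (y : 'rV[R]_d))) => i.
    rewrite (_ : (fun _ => _) = (fun y : T => x ord0 i - (y : 'rV[R]_d) ord0 i)); last first.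
      by apply/funext => y; rewrite !mxE.
    by apply: measurable_funB => //; exact: measurable_coord.
  - exact: (measurable_fun_fubini_tonelli_F (m2 := @lebRV R d)).
have -> : (\int[mu]_y \int[@lebRV R d]_v g (y, v) = \int[@lebRV R d]_v \int[mu]_y g (y, v))%E.
  exact: (@sfinite_Fubini _ _ _ _ _ mu (@lebRV R d) g g0 mg).
apply: (@le_trans _ _ (\int[@lebRV R d]_v ((A * K) * cauchyd (v : 'rV[R]_d))%:E)%E); last first.
  under eq_integral do rewrite EFinM.
  rewrite ge0_integralZl_EFin//.
  - rewrite integral_cauchyd -EFinM lee_fin /A.
    rewrite le_eqVlt; apply/orP; left; apply/eqP.
    by rewrite mulrAC -exprMn; congr (_ ^+ _ * _); ring.
  - by move=> v _; rewrite lee_fin cauchyd_ge0.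
  - by apply/measurable_EFinP; exact: measurable_cauchyd.
  - exact: mulr_ge0.
apply: ge0_le_integral => //.
- by move=> v _; exact: integral_ge0.
- exact: (measurable_fun_fubini_tonelli_G (m1 := mu)).
- by apply/measurable_EFinP; apply: measurable_funM => //; exact: measurable_cauchyd.
move=> v _; rewrite /g.
have c0 := cauchyd_ge0 v.
have mc : measurable (cube (x - r *: (v : 'rV[R]_d)) r) by exact: measurable_cube.
rewrite [leLHS](_ : _ = (\int[mu]_y ((A * cauchyd (v : 'rV[R]_d))%:E * (\1_(cube (x - r *: (v : 'rV[R]_d)) r) y)%:E))%E).
  rewrite ge0_integralZl_EFin//; last 2 first.
  - by apply/measurable_EFinP; exact: measurable_indic.
  - exact: mulr_ge0.
  rewrite integral_indic// setIT [A * K * _]mulrAC [(_ * K)%:E]EFinM.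
  by apply: lee_wpmul2l; [rewrite lee_fin mulr_ge0|exact: muK].
apply: eq_integral => y _; rewrite -EFinM; congr (_ * _)%:E.
(* For fixed [v] the condition on [y] describes the cube of radius [r] around [x - r v], to which
   the hypothesis on cubes applies. *)
have key i : (`|(v : 'rV[R]_d) ord0 i - u y ord0 i| <= 1) =
   (`|(y : 'rV[R]_d) ord0 i - (x - r *: (v : 'rV[R]_d)) ord0 i| <= r).
  have -> : (y : 'rV[R]_d) ord0 i - (x - r *: (v : 'rV[R]_d)) ord0 i =
      r * ((v : 'rV[R]_d) ord0 i - u y ord0 i).
    by rewrite /u !mxE; field; rewrite gt_eqF.
  by rewrite normrM (gtr0_norm r0) -[X in _ = (_ <= X)]mulr1 ler_pM2l.
rewrite !indicE; congr ((_ : bool)%:R); apply/idP/idP; rewrite !inE /E /= => h i.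
  by rewrite -key.
by rewrite key.
Qed.


(** The weight [trid r 0] of half-side [1 / r = 2^(k+1)] is at least [2^-d] on the cube. By
    [energy_trid] the weighted integral is a kernel energy; kernel height [r^-d] times cube mass
    [r^s] gives the growth [2^(k (d - s))]. *)
Lemma integral_cube_nfourier_le (mu : {finite_measure set T -> \bar R}) s C k :
  0 <= C -> (forall (x : T) q, mu (cube (x : 'rV[R]_d) (2^-1 ^+ q)) <= (C * (2^-1 ^+ q) `^ s)%:E)%E ->
  (\int[@lebRV R d]_(z in cube 0%R (2 ^+ k)) (nfourier mu z ^+ 2)%:E <=
   ((2 ^+ d * ((15 * pi) ^+ d * (C * 2 `^ (- s))) * mass mu) * (2 `^ (d%:R - s)) ^+ k)%:E)%E.
Proof.
move=> C0 muC; pose r : R := 2^-1 ^+ k.+1.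
have r0 : 0 < r by rewrite exprn_gt0// invr_gt0.
have mc : measurable (cube (0 : 'rV[R]_d) (2 ^+ k)) by exact: measurable_cube.
have mn : measurable_fun setT (fun z : T => nfourier mu z ^+ 2).
  by apply: measurable_funX; exact: measurable_nfourier.
apply: (@le_trans _ _ (\int[@lebRV R d]_z ((2 ^+ d)%:E * (trid r 0 z * nfourier mu z ^+ 2)%:E))%E).
  rewrite integral_mkcond; apply: ge0_le_integral => //.
  - by move=> z _; apply: erestrict_ge0 => y _; rewrite lee_fin sqr_ge0.
  - by apply/(measurable_restrict _ _ _).1 => //; apply: measurable_funTS; exact/measurable_EFinP.
  - apply: emeasurable_funM => //; apply/measurable_EFinP; apply: measurable_funM => //.
    exact: measurable_trid.
  move=> z _; rewrite patchE; case: ifPn => [|_]; last first.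
    by rewrite -EFinM lee_fin mulr_ge0// mulr_ge0 ?trid_ge0 ?sqr_ge0.
  rewrite inE => zc; rewrite -EFinM lee_fin mulrA ler_peMl ?sqr_ge0//.
  rewrite -[d in 2 ^+ d]card_ord -prodr_const -big_split/=.
  apply: (big_ind (fun x : R => 1 <= x)) => // [x y x1 y1|i _]; first exact: mulr_ege1.
  have := zc i; rewrite mxE subr0 => zi.
  rewrite /tri ?mxE ?subr0; have : r * `|(z : 'rV[R]_d) ord0 i| <= 2^-1.
    rewrite /r exprS -mulrA ler_piMr// exprVn mulrC ler_pdivrMr ?exprn_gt0// mul1r//.
  by rewrite /Num.max; case: ltP; lra.
rewrite ge0_integralZl_EFin//; last 2 first.
- by move=> z _; rewrite lee_fin mulr_ge0 ?trid_ge0 ?sqr_ge0.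
- by apply/measurable_EFinP; apply: measurable_funM => //; exact: measurable_trid.
rewrite energy_trid// /prodm fubini_tonelli1//; last 2 first.
- by apply/measurable_EFinP; exact: (measurable_ktrid (@measurable_subpair _ _)).
- by move=> p; rewrite lee_fin ktrid_ge0.
pose K := ((15 / 2 * pi * r^-1) ^+ d * (C * r `^ s)).
apply: (@le_trans _ _ ((2 ^+ d)%:E * \int[mu]_x K%:E)%E).
  apply: lee_wpmul2l; first by rewrite lee_fin.
  apply: ge0_le_integral => //.
  - by move=> x _; apply: integral_ge0 => y _; rewrite lee_fin ktrid_ge0.
  - apply: (measurable_fun_fubini_tonelli_F (m2 := mu)) => //.
      by apply/measurable_EFinP; exact: (measurable_ktrid (@measurable_subpair _ _)).
    by move=> p; rewrite lee_fin ktrid_ge0.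
  move=> x _; apply: integral_ktrid_le => //.
  - by rewrite mulr_ge0 ?powR_ge0.
  - by move=> c; exact: muC.
rewrite integral_cst// [X in (_ * (_ * X))%E](_ : _ = (mass mu)%:E); last exact: massE.
rewrite -!EFinM lee_fin.
pose a : R := 2 `^ (- s).
have rs : r `^ s = a ^+ k * a.
  by rewrite -exprSr /r /a exprVn -powR_inv1 ?exprn_ge0// -powRrM mulN1r powR_pow2.
have -> : (2 : R) `^ (d%:R - s) = 2 ^+ d * a.
  by rewrite powRD ?pnatr_eq0 ?implybT// powR_mulrn.
rewrite /K rs; have -> : 15 / 2 * pi / r = (15 * pi) * 2 ^+ k.
  rewrite /r exprVn invrK exprS; by field.
rewrite -/a [(15 * pi * 2 ^+ k) ^+ d]exprMn [(2 ^+ d * a) ^+ k]exprMn exprAC.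
by rewrite le_eqVlt; apply/orP; left; apply/eqP; ring.
Qed.

Hypothesis d0 : (0 < d)%N.

Lemma frostman_energy (mu : {finite_measure set T -> \bar R}) s t C :
  0 < t -> t < s -> t <= d%:R -> 0 <= C ->
  (forall (x : T) q, mu (cube (x : 'rV[R]_d) (2^-1 ^+ q)) <= (C * (2^-1 ^+ q) `^ s)%:E)%E ->
  (fourier_energy mu t 1 < +oo)%E.
Proof.
move=> t0 ts td C0 muC; apply/fourier_energyE => //; apply: Jfun_far => //.
have E z : Jfun mu t 1 z = nfourier mu z ^+ 2 * enorm (z : 'rV[R]_d) `^ (- (d%:R - t)).
  by rewrite /Jfun !divr1 opprB powR_mulrn ?nfourier_ge0.
under eq_integral do rewrite E.
apply: (integral_shell_lty (A := 2 `^ (d%:R - s))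
   (C := (2 ^+ d * ((15 * pi) ^+ d * (C * 2 `^ (- s))) * mass mu))).
- by apply: measurable_funX; exact: measurable_nfourier.
- by move=> z; exact: sqr_ge0.
- by rewrite subr_ge0.
- by rewrite !mulr_ge0 ?mass_ge0 ?powR_ge0// exprn_ge0// mulr_ge0// pi_ge0.
- exact: powR_ge0.
- by rewrite ltr_pow2 ltrD2l ltrN2.
- by move=> k; exact: integral_cube_nfourier_le.
Qed.

End potential.

(** * Vanishing net contents and vanishing Hausdorff measure *)

Section hausdorff_cover.
Variables (R : realType) (d : nat).
Implicit Types (X : set 'rV[R]_d) (s delta : R).

Lemma ediam_pow_ge0 s (U : set 'rV[R]_d) : (0 <= ediam_pow s U)%E.
Proof. by rewrite /ediam_pow; case: ifPn => // _; exact: poweR_ge0. Qed.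

Lemma hausdorff_content_esum (J : countType) (P : set J) (f : J -> set 'rV[R]_d) s delta X :
  (forall j, P j -> (ediam (f j) <= delta%:E)%E) -> X `<=` \bigcup_(j in P) f j ->
  (hausdorff_content s delta X <= \esum_(j in P) ediam_pow s (f j))%E.
Proof.
move=> fdelta Xf.
pose U n := if pickle_inv n is Some j then if j \in P then f j else set0 else set0.
have UE j : P j -> U (pickle j) = f j by move=> Pj; rewrite /U pickleK_inv mem_set.
have U0 n : ~ (pickle @` P) n -> U n = set0.
  rewrite /U; have := @pickle_invK J n; case: pickle_inv => //= j <- nP.
  by rewrite memNset// => Pj; apply: nP; exists j.
have -> : (\esum_(j in P) ediam_pow s (f j) = \sum_(0 <= n <oo) ediam_pow s (U n))%E.
  rewrite nneseries_esumT; last by move=> n; exact: ediam_pow_ge0.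
  transitivity (\esum_(n in pickle @` P) ediam_pow s (U n))%E.
    rewrite esum_image; last by move=> i j _ _; exact: (pcan_inj pickleK_inv).
    by apply: eq_esum => j Pj; rewrite UE.
  rewrite esum_mkcond; apply: eq_esum => n _; case: ifPn => //.
  by rewrite notin_setE => /U0 ->; rewrite /ediam_pow eqxx.
apply: ereal_inf_lbound; exists U => //; split.
  move=> n; have [[j Pj <-]|/U0 ->] := pselect ((pickle @` P) n).
    by rewrite UE//; exact: fdelta.
  by rewrite /ediam set0X image_set0 ereal_sup0 leNye.
by move=> x /Xf[j Pj fx]; exists (pickle j) => //; rewrite UE.
Qed.

Lemma hausdorff_content_ge0 s delta X : (0 <= hausdorff_content s delta X)%E.
Proof.
apply: le_ereal_inf_tmp => _ [U _ <-].
by apply: nneseries_ge0 => n _ _; exact: ediam_pow_ge0.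
Qed.

Lemma hausdorff_measure_eq0 s X :
  (forall delta, 0 < delta -> (hausdorff_content s delta X <= 0)%E) ->
  hausdorff_measure s X = 0%E.
Proof.
move=> H; apply/eqP; rewrite eq_le; apply/andP; split.
  by apply: ge_ereal_sup => _ [delta d0 <-]; exact: H.
apply: (le_trans (hausdorff_content_ge0 s 1 X)).
by apply: ereal_sup_ubound; exists 1 => //=.
Qed.

Lemma ediam_pow_le s c (U : set 'rV[R]_d) : 0 < s -> 0 <= c ->
  (ediam U <= c%:E)%E -> (ediam_pow s U <= (c `^ s)%:E)%E.
Proof.
move=> s0 c0 Uc; rewrite /ediam_pow; case: ifPn => [_|/set0P[x Ux]].
  by rewrite lee_fin powR_ge0.
have h0 : (0 <= ediam U)%E.
  by apply: ereal_sup_ubound; exists (x, x) => //=; rewrite subrr enorm0.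
rewrite -poweR_EFin; apply: gt0_ler_poweR => //; rewrite ?in_itv/= ?h0 ?leey ?lee_fin ?c0//.
exact: ltW.
Qed.

Lemma esum_halves_le (J : countType) (e : R) : 0 <= e ->
  (\esum_(j in [set: J]) (e / (2 ^ (pickle j).+1)%:R)%:E <= e%:E)%E.
Proof.
move=> e0; pose g n : \bar R := (e / (2 ^ n.+1)%:R)%:E.
have g0 n : (0 <= g n)%E by rewrite lee_fin divr_ge0.
apply: le_trans (epsilon_trick0 predT e0).
rewrite [leRHS](@nneseries_esumT _ g)//.
rewrite -(@esum_image _ _ _ _ pickle g); last by move=> i j _ _; exact: (pcan_inj pickleK_inv).
by rewrite esum_mkcond; apply: le_esum => n _; case: ifP.
Qed.

Hypothesis d0 : (0 < d)%N.

(** Only [size p %/ d] complete rounds of digits are fixed: the rounding costs a factor 2 and the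
    Euclidean norm a factor [d]. *)
Lemma ediam_psi_cyl (k : 'rV[int]_d) p :
  (ediam (psi R k @` cyl p) <= (d%:R * 2 * wgt d 1 (size p))%:E)%E.
Proof.
apply: ge_ereal_sup => _ [[_ _] [/= [a ap <-] [b bp <-]] <-].
rewrite lee_fin; apply: le_trans (enorm_le_norm _) _.
rewrite -mulrA ler_wpM2l//; pose q := (size p %/ d)%N.
have pq x : cyl p x -> pre x (d * q) = take (d * q) p.
  by move=> xp; rewrite -[in RHS]xp /pre /mkseq -map_take take_iota (minn_idPl _)// mulnC leq_trunc_div.
apply: le_trans (psi_pre _ k (q := q) _) _; first by rewrite (pq _ ap) (pq _ bp).
rewrite exprVn /wgt -powR_invn//.
rewrite -[X in X * _](powRr1 (ler0n R 2)) -powRD ?pnatr_eq0 ?implybT//.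
apply: ler_powR; first by rewrite ler1n.
have : (size p)%:R / d%:R <= q.+1%:R :> R.
  by rewrite ler_pdivrMr ?ltr0n// -natrM ler_nat ltnW// ltn_ceil.
by rewrite mulr1 -natr1; lra.
Qed.

Lemma cont_cyl_halves s p n (A : set (nat -> bool)) : A `<=` cyl p ->
  (cont (wgt d s) A <= (2 ^+ n * wgt d s (size p + n))%:E)%E.
Proof.
have w0 := @wgt_ge0 R d s.
elim: n p A => [|n IH] p A Ap.
  by rewrite expr0 mul1r addn0; exact: cont_cyl.
have AE : A `<=` (A `&` cyl (rcons p false)) `|` (A `&` cyl (rcons p true)).
  move=> a Aa; have pa := Ap a Aa; have := mkseqS a (size p).
  rewrite -/(pre a _) -/(pre a _) pa.
  by case: (a (size p)) => ?; [right|left]; split; rewrite /cyl //= size_rcons.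
apply: le_trans (cont_subset _ AE) _; apply: le_trans (contU w0 _ _) _.
apply: (@le_trans _ _ (_ + _)%E); first apply: leeD.
- by apply: (IH (rcons p false)) => a [].
- by apply: (IH (rcons p true)) => a [].
by rewrite !size_rcons -EFinD lee_fin addSnnS exprS -mulrA mulr_natl mulr2n.
Qed.

(** The [2^n] words of length [n] cost [2^(n (1 - s / d))] in total, which tends to 0. *)
Lemma cont_gt_dim s A : d%:R < s -> cont (wgt d s) A = 0%E.
Proof.
move=> ds; have w0 := @wgt_ge0 R d s.
apply/eqP; rewrite eq_le cont_ge0// andbT.
pose x : R := 2 `^ (1 - s / d%:R).
have x1 : x < 1.
  rewrite -(powRr0 2) /x ltr_pow2 subr_lt0 ltr_pdivlMr ?ltr0n// mul1r//.
have xn n : 2 ^+ n * wgt d s n = x ^+ n.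
  rewrite -!powR_mulrn ?powR_ge0// /wgt -powRD ?pnatr_eq0 ?implybT// /x -powRrM.
  by congr (_ `^ _); ring.
apply/lee_addgt0Pr => e e0; rewrite add0e.
have /cvgrPdist_lt /(_ e e0)[N _ hN] : x ^+ n @[n --> \oo] --> (0 : R).
  by apply: cvg_expr; rewrite ger0_norm ?powR_ge0.
apply: (@le_trans _ _ (2 ^+ N * wgt d s (size (Nil bool) + N))%:E).
  by apply: cont_cyl_halves => a _; rewrite /cyl.
rewrite lee_fin add0n xn.
by have := hN N (leqnn N); rewrite /= sub0r normrN => /ltW; apply: le_trans (ler_norm _).
Qed.

Lemma wgt_powR s n : wgt d s n = wgt d 1 n `^ s.
Proof. by rewrite /wgt -powRrM; congr (_ `^ _); ring. Qed.

Lemma hausdorff_measure_cont0 X s : 0 < s ->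
  (forall k, cont (wgt d s) (psi R k @^-1` X) = 0%E) -> hausdorff_measure s X = 0%E.
Proof.
move=> s0 cont0; apply: hausdorff_measure_eq0 => delta delta0.
have w0 := @wgt_ge0 R d s.
have D0 : 0 < d%:R * 2 :> R by rewrite mulr_gt0// ltr0n.
apply/lee_addgt0Pr => e e0; rewrite add0e.
pose c : R := (d%:R * 2) `^ s.
have c0 : 0 < c by exact: powR_gt0.
(* The first bound makes the final sum at most [e]. The second limits each single weight, hence by
   [wgt_powR] each diameter to [delta]: a cheap cover automatically consists of small sets. *)
pose eta := Num.min (e / c) ((delta / (d%:R * 2)) `^ s).
have eta0 : 0 < eta by rewrite lt_min powR_gt0 ?divr_gt0.
have etan k : 0 < eta / (2 ^ (@pickle 'rV[int]_d k).+1)%:R by rewrite divr_gt0// ltr0n expn_gt0.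
have /choice[S hS] : forall k, exists S, covers S (psi R k @^-1` X) /\
    (cost (wgt d s) S <= (eta / (2 ^ (@pickle 'rV[int]_d k).+1)%:R)%:E)%E.
  by move=> k; have [S [SX hS]] := cont_cover w0 (psi R k @^-1` X) (etan k);
    exists S; split => //; move: hS; rewrite cont0 add0e.
have tot : (\esum_(k in [set: 'rV[int]_d]) cost (wgt d s) (S k) <= eta%:E)%E.
  apply: le_trans (esum_halves_le _ (ltW eta0)); apply: le_esum => k _; exact: (hS k).2.
have costE : (\esum_(k in [set: 'rV[int]_d]) cost (wgt d s) (S k) =
    \esum_(j in [set: 'rV[int]_d] `*`` S) (wgt d s (size j.2))%:E)%E.
  by rewrite /cost esum_esum// => k p _ _; rewrite lee_fin.
have wle j : ([set: 'rV[int]_d] `*`` S) j -> wgt d s (size j.2) <= eta.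
  move=> Sj; rewrite -lee_fin; apply: le_trans tot; rewrite costE.
  rewrite -(@esum_set1 _ _ j (fun j => (wgt d s (size j.2))%:E)) ?lee_fin//.
  rewrite [leLHS]esum_mkcond [leRHS]esum_mkcond; apply: le_esum => i _.
  case: ifPn => [|_]; last by case: ifP; rewrite ?lee_fin.
  by rewrite inE => ->; rewrite mem_set.
pose f (j : 'rV[int]_d * seq bool) := psi R j.1 @` cyl j.2.
apply: (@le_trans _ _ (\esum_(j in [set: 'rV[int]_d] `*`` S) ediam_pow s (f j))%E).
  apply: hausdorff_content_esum.
    move=> j Sj; apply: le_trans (ediam_psi_cyl _ _) _; rewrite lee_fin.
    rewrite mulrC -ler_pdivlMr// leNgt; apply/negP => lt1.
    have : (delta / (d%:R * 2)) `^ s < wgt d s (size j.2).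
      by rewrite wgt_powR gt0_ltr_powR// nnegrE ?wgt_ge0// divr_ge0// ltW.
    by rewrite ltNge (le_trans (wle j Sj))// ge_min lexx orbT.
  move=> x Xx; have [a ax] := psi_surj d0 x.
  have [n Sn] := (hS (\row_i Num.floor (x ord0 i))).1 a (eq_ind_r X Xx ax).
  exists (\row_i Num.floor (x ord0 i), pre a n); first by split.
  by exists a => //; rewrite /cyl/= size_mkseq.
apply: (@le_trans _ _ (\esum_(j in [set: 'rV[int]_d] `*`` S) (c%:E * (wgt d s (size j.2))%:E))%E).
  apply: le_esum => j _; apply: le_trans (ediam_pow_le s0 _ (ediam_psi_cyl _ _)) _.
    by rewrite mulr_ge0 ?wgt_ge0// ltW.
  by rewrite powRM ?wgt_ge0 ?(ltW D0)// -wgt_powR EFinM.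
apply: ge_ereal_sup => _ [F [finF FP] <-].
rewrite -ge0_mule_fsumr; last by move=> j; rewrite lee_fin.
apply: (@le_trans _ _ (c%:E * eta%:E)%E); last first.
  by rewrite -EFinM lee_fin mulrC -ler_pdivlMr// ge_min lexx.
apply: lee_wpmul2l; first by rewrite lee_fin ltW.
apply: le_trans tot; rewrite costE; apply: esum_ge.
by exists F.
Qed.

End hausdorff_cover.

(** * Hausdorff dimension at [theta = 1] and the theorem *)

Section fourier_hausdorff.
Variables (R : realType) (d : nat).
Implicit Types X : set 'rV[R]_d.

Lemma hausdorff_dim_le X f :
  (forall s, f < s -> 0 < s -> hausdorff_measure s X = 0%E) ->
  0 <= f -> (hausdorff_dim X <= f%:E)%E.
Proof.
move=> H f0; apply/lee_addgt0Pr => e e0; rewrite -EFinD.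
have fe : 0 < f + e by rewrite ltr_wpDl.
apply: ereal_inf_lbound; exists (f + e) => //; split; first exact: ltW.
by apply: H => //; rewrite ltrDl.
Qed.

(** Let [s] exceed the spectrum. Positive content of exponent [s] in some unit cube would give a
    Frostman measure with finite energy of an order [t] strictly between the two, a contradiction;
    so all contents vanish, and with them the Hausdorff measure of exponent [s]. *)
Lemma hausdorff_dim_le_spectrum1 X : X !=set0 ->
  measurable (X : set (borelRV R d)) ->
  (hausdorff_dim X <= set_fourier_spectrum X 1)%E.
Proof.
move=> X0 mX; have fin := set_fourier_spectrum_fin_num 1 X0.
rewrite -(fineK fin); apply: hausdorff_dim_le; last first.
  by rewrite fine_ge0// set_fourier_spectrum_ge0.
move=> s fs s0; have [d0|d0] := posnP d.
  apply: hausdorff_measure_eq0 => delta delta0.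
  have dX : (ediam X <= 0%:E)%E.
    apply: ge_ereal_sup => _ [[x y] _ <-]; rewrite lee_fin /= /enorm /dotv big1 ?sqrtr0//.
    by move=> i; have := ltn_ord i; rewrite {2}d0.
  apply: (@le_trans _ _ (\esum_(j in [set tt]) ediam_pow s X)%E).
    apply: hausdorff_content_esum; last by move=> x Xx; exists tt.
    by move=> _ _; apply: le_trans dX _; rewrite lee_fin ltW.
  rewrite esum_set1 ?ediam_pow_ge0//; apply: le_trans (ediam_pow_le s0 _ dX) _ => //.
  by rewrite powR0// gt_eqF.
have [ds|sd] := ltP d%:R s.
  by apply: hausdorff_measure_cont0 => // k; exact: cont_gt_dim.
apply: hausdorff_measure_cont0 => // k; apply/eqP; rewrite eq_le cont_ge0 ?andbT; last exact: wgt_ge0.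
rewrite leNgt; apply/negP => ck.
have [mu muX [C C0 muC]] := frostman d0 (souslin_measurable mX) ck.
pose f := fine (set_fourier_spectrum X 1).
have f0 : 0 <= f by rewrite fine_ge0// set_fourier_spectrum_ge0.
pose t := (f + s) / 2.
have ts : t < s by rewrite /t; rewrite -/f in fs; lra.
have ft : f < t by rewrite /t; rewrite -/f in fs; lra.
have t0 : 0 < t by lra.
have td : t <= d%:R by rewrite (le_trans (ltW ts)).
have en := frostman_energy d0 t0 ts td C0 muC.
suff : (t%:E <= set_fourier_spectrum X 1)%E by rewrite -(fineK fin) lee_fin leNgt ft.
apply: (@le_trans _ _ (mine (fourier_spectrum mu 1) d%:R%:E)); last first.
  by apply: ereal_sup_ubound; exists mu.
rewrite le_min lee_fin td andbT; apply: ereal_sup_ubound; right.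
by exists t => //; split; [exact: ltW|].
Qed.

End fourier_hausdorff.

Theorem theorem1p5 (R : realType) (d : nat) (X : set 'rV[R]_d)
    (X_neq0 : X !=set0) :
  (forall theta : R, 0 <= theta <= 1 ->
     (set_fourier_spectrum X theta <=
      set_fourier_dim X +
      d%:R%:E * (1 + set_fourier_dim X * 2^-1%:E) * theta%:E)%E)
  /\ [lipschitz fine (set_fourier_spectrum X theta) |
       theta in [set t : R | 0 <= t <= 1]]
  /\ set_fourier_spectrum X 0 = set_fourier_dim X
  /\ (measurable (X : set (borelRV R d)) ->
        set_fourier_spectrum X 1 = hausdorff_dim X).
Proof.
have fin th := set_fourier_spectrum_fin_num th X_neq0.
have dim_fin : set_fourier_dim X \is a fin_num by rewrite -set_fourier_spectrum0.
have dim0 : 0 <= fine (set_fourier_dim X).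
  by rewrite fine_ge0// -set_fourier_spectrum0 set_fourier_spectrum_ge0.
split; [|split; [|split]].
- move=> th /andP[th0 th1].
  (* The slope [d] obtained here is at most the stated [d (1 + dim / 2)]. *)
  have := set_fourier_spectrum_lip X_neq0 (lexx 0) th0 th1.
  rewrite set_fourier_spectrum0 subr0 => /le_trans; apply.
  rewrite -(fineK dim_fin) -!EFinM -!EFinD lee_fin lerD2l.
  rewrite -mulrA ler_wpM2l// ler_peMl//; lra.
- have lip (t t' : R) : 0 <= t -> t <= t' -> t' <= 1 ->
     `|fine (set_fourier_spectrum X t') - fine (set_fourier_spectrum X t)| <= d%:R * `|t' - t|.
    move=> t0 tt' t1; rewrite !ger0_norm ?subr_ge0//.
      have := set_fourier_spectrum_lip X_neq0 t0 tt' t1.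
      by rewrite -(fineK (fin t)) -(fineK (fin t')) -EFinD lee_fin; lra.
    apply: fine_le => //; exact: set_fourier_spectrum_mono.
  apply: (@klipschitzW _ _ _ d%:R).
    by apply: (@globally_properfilter _ _ (0, 0)) => /=; rewrite lexx ler01.
  move=> [x y] /= [/andP[x0 x1] /andP[y0 y1]].
  have [xy|/ltW yx] := leP x y; last exact: lip.
  by rewrite distrC [`|x - y|]distrC; exact: lip.
- exact: set_fourier_spectrum0.
- move=> mX; apply/eqP; rewrite eq_le set_fourier_spectrum1_le/=.
  exact: hausdorff_dim_le_spectrum1.
Qed.
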